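(* Let $\{\mathcal T_h\}_{h>0}$ be a quasi-uniform family of simplicial partitions of the torus $\mathcal D$, let $\tau=T/N$ be an equidistant time step, let the noise coefficients satisfy $\sum_{k\in\mathbb Z}\lambda_k^2\big(\|\mathfrak g_k\|_{\mathbb W^{1,\infty}}^2+\|\mathfrak g_k\|_{\mathbb H^2}^2\big)<\infty$, let $\sigma\in W^{2,\infty}(\mathbb R)\cap C^1_0((-1,1))$, let $u_0\in\mathbb H^1$ be deterministic with $|u_0|\le 1$ a.e. and $\mathfrak m:=(u_0)_{\mathcal D}\in(-1,1)$, let $U^0=\mathcal P u_0$, and let $0<\delta\le 1/8$. Let $(U^n,W^n)_{n=1,\dots,N}$ be the solution of the regularised fully discrete scheme (given in the context). Then for every $\mathfrak p\in[1,\infty)$ there exists a constant $C=C(T,\mathfrak p)$, independent of $h$, $\tau$ and $\delta$, such that $$\mathbb E\Big[\max_{0\le \tilde N\le N}\|U^{\tilde N}-\mathfrak m\|_*^{2\mathfrak p}\Big]+\mathbb E\Big[\Big(\sum_{n=1}^N\|U^n-U^{n-1}\|_*^2\Big)^{\mathfrak p}\Big]+\mathbb E\Big[\Big(\sum_{n=1}^N\tau\varepsilon\|\nabla U^n\|_{\mathbb L^2}^2\Big)^{\mathfrak p}\Big]$$ $$+\mathbb E\Big[\Big(\sum_{n=1}^N\tfrac{\tau}{\varepsilon}\|U^n-U^{n-1}\|_h^2\Big)^{\mathfrak p}\Big]+\mathbb E\Big[\Big(\sum_{n=1}^N\tfrac{\tau}{\varepsilon}\big(f_\delta(U^n),U^n-\mathfrak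 m\big)_h\Big)^{\mathfrak p}\Big]\le C .$$ Furthermore, $\big(f_\delta(U^n),U^n-\mathfrak m\big)_h\ge \big(F_\delta(U^n),1\big)_h\ge 0$ and $\big(F_\delta(U^n),1\big)_h-2\|U^n\|_h^2\ge-\mathcal C$ with a constant $\mathcal C$ independent of $h$, $\tau$ and $\delta$.
   Context: Fix $d\in\{1,2,3\}$, $T>0$, $\varepsilon>0$. $\mathcal D$ is the $d$-dimensional torus $(0,1)^d$; $\mathbb L^p=L^p(\mathcal D)$, and $\mathbb W^{k,p}$, $\mathbb H^k=\mathbb W^{k,2}$ are Sobolev spaces of periodic functions; $(\cdot,\cdot)$ is the $\mathbb L^2$ inner product; $(v)_{\mathcal D}=|\mathcal D|^{-1}\langle v,1\rangle$ is the mean value. Noise: on a filtered probability space $(\Omega,\mathcal A,\mathcal F,\mathbb P)$ with complete right-continuous filtration, $(\beta_k^i)_{k\in\mathbb Z,\,i=1,\dots,d}$ are independent Brownian motions, $\lambda_k>0$, and $(\mathfrak g_k)_{k\in\mathbb Z}$ is an orthonormal basis of $\mathbb L^2$ of smooth periodic functions. The function $\sigma$ satisfies $\sigma(s)=0$ for $|s|\ge1$. Regularisation: $F_\delta:\mathbb R\to\mathbb R$ is the even convex function with $F_\delta(r)=0$ for $|r|\le1$, $F_\delta(r)=\frac{1}{6\delta^2}(|r|-1)^3$ for $1<|r|<1+\delta$, $F_\delta(r)=\frac1{2\delta}\big(|r|-(1+\frac\delta2)\big)^2+\frac{\delta}{24}$ for $|r|\ge1+\delta$; $f_\delta=F_\delta'$.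 Discretisation: $t^n=n\tau$, $\tau=T/N$. $\mathcal T_h$ is a partition of $\mathcal D$ into disjoint open simplices of diameter at most $h$. $\mathbb V_h$ is the space of periodic continuous piecewise linear functions on $\mathcal T_h$, $\mathcal I_h$ the nodal interpolation operator onto $\mathbb V_h$, $\mathcal P$ the $\mathbb L^2$-projection onto $\mathbb V_h$, $(U,V)_h=\int_{\mathcal D}\mathcal I_h\{UV\}\,dx$, $\|U\|_h^2=(U,U)_h$. For $U\in\mathbb V_h$ with mean zero, $-\Delta_h^{-1}U\in\mathbb V_h$ is the mean-zero function with $(\nabla(-\Delta_h^{-1}U),\nabla V)=(U,V)_h$ for all $V\in\mathbb V_h$. For $U\in\mathbb V_h$, $\|U\|_*^2:=\|\nabla(-\Delta_h^{-1})(U-(U)_{\mathcal D})\|_{\mathbb L^2}^2+(U)_{\mathcal D}^2$. $\mathbb Z_h\subset\mathbb Z$ is a finite set depending on $h$. Regularised scheme: given $U^{n-1}$, find $\mathbb V_h$-valued random variables $U^n,W^n$ such that for all $\varphi_h,\psi_h\in\mathbb V_h$ $$(U^n-U^{n-1},\varphi_h)_h+\tau(\nabla W^n,\nabla\varphi_h)=\sum_{i=1}^d\sum_{k\in\mathbb Z_h}\big(\partial_i\mathcal I_h\{\sigma(U^{n-1})\lambda_k\mathfrak g_k\},\varphi_h\big)\big(\beta_k^i(t^n)-\beta_k^i(t^{n-1})\big),$$ $$\varepsilon(\nabla U^n,\nabla\psi_h)+\tfrac1\varepsilon\big(f_\delta(U^n)-U^{n-1},\psi_h\big)_h=(W^n,\psi_h)_h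 .$$ Solutions satisfy $(U^n)_{\mathcal D}=\mathfrak m$ for all $n$. *)

(* Defs.v *)
From HB Require Import structures.
From mathcomp Require Import all_boot all_order all_algebra finmap.
From mathcomp Require Import all_classical all_reals all_analysis.

Set Implicit Arguments.
Unset Strict Implicit.
Unset Printing Implicit Defensive.

Import Order.TTheory GRing.Theory Num.Theory.
Import numFieldNormedType.Exports.

Local Open Scope classical_set_scope.
Local Open Scope ring_scope.

(* The product sigma-algebra on row vectors, mirroring the library instance  *)
(* for n.-tuple T.                                                            *)
Definition rV_display : measure_display.
Proof. exact. Qed.

Section measurable_rV.
Context {R : realType} (n : nat).

Definition rV_coord (i : 'I_n) (x : 'rV[R]_n) : measurableTypeR R := x ord0 i.

Let rV_meas : set (set 'rV[R]_n) := g_sigma_preimage rV_coord.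

Let rV_set0 : rV_meas set0.
Proof. exact: sigma_algebra0. Qed.

Let rV_setC A : rV_meas A -> rV_meas (~` A).
Proof. exact: sigma_algebraC. Qed.

Let rV_bigcup (F : (set 'rV[R]_n)^nat) :
  (forall i, rV_meas (F i)) -> rV_meas (\bigcup_i (F i)).
Proof. exact: sigma_algebra_bigcup. Qed.

HB.instance Definition _ := @isMeasurable.Build rV_display
  'rV[R]_n rV_meas rV_set0 rV_setC rV_bigcup.

End measurable_rV.

Lemma measurable_rV_coord (R : realType) n (i : 'I_n) :
  measurable_fun setT (@rV_coord R n i).
Proof.
move=> _ Y mY; rewrite setTI; apply: sub_sigma_algebra.
rewrite -bigcup_seq/=; exists i => /=; first by rewrite mem_index_enum.
by exists Y => //; rewrite setTI.
Qed.

Lemma measurable_fun_rV d (T : measurableType d) (R : realType) n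
    (f : T -> 'rV[R]_n) :
  (forall i, measurable_fun setT (@rV_coord R n i \o f)) ->
  measurable_fun setT f.
Proof.
move=> mf; have H : g_sigma_preimage (fun i => @rV_coord R n i \o f)
    `<=` measurable.
  apply: smallest_sub; first exact: sigma_algebra_measurable.
  rewrite -bigcup_seq; apply: bigcup_sub => i _.
  by move=> A [B mB <-]; exact: mf.
move=> _ A mA; apply: H; rewrite g_sigma_preimage_comp.
by exists A.
Qed.

Section cube_measure.
Context {R : realType}.

Definition rV_cons n (p : measurableTypeR R * 'rV[R]_n) : 'rV[R]_n.+1 :=
  row_mx (const_mx p.1 : 'rV[R]_1) p.2.

Lemma measurable_rV_cons n : measurable_fun setT (@rV_cons n).
Proof.
apply: measurable_fun_rV => i.
have [j ->|j ->] := @split_ordP 1 n i.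
- rewrite (_ : _ \o _ = fst); first exact: measurable_fst.
  apply/funext => p; rewrite /= /rV_coord.
  by rewrite (@row_mxEl _ 1 1 n) mxE.
- rewrite (_ : _ \o _ = @rV_coord R n j \o snd).
    by apply: measurableT_comp; [exact: measurable_rV_coord|].
  apply/funext => p; rewrite /= /rV_coord.
  by rewrite (@row_mxEr _ 1 1 n).
Qed.

Section step.
Variables (n : nat) (m : probability 'rV[R]_n R).

Definition cube_step : set 'rV[R]_n.+1 -> \bar R :=
  pushforward (uniform_prob (@ltr01 R) \x m)%E (@rV_cons n).

Let mcons := @measurable_rV_cons n.

Let cube_step0 : cube_step set0 = 0%E.
Proof. by rewrite /cube_step /pushforward preimage_set0 measure0. Qed.

Let cube_step_ge0 A : (0 <= cube_step A)%E.
Proof. exact: measure_ge0. Qed.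

Let cube_step_sigma_additive : semi_sigma_additive cube_step.
Proof.
move=> F mF tF mUF; rewrite /cube_step /pushforward preimage_bigcup.
apply: measure_semi_sigma_additive.
- by move=> k; rewrite -[X in measurable X]setTI; exact: mcons.
- apply/trivIsetP => /= i j _ _ ij; rewrite -preimage_setI.
  by move/trivIsetP : tF => /(_ _ _ _ _ ij) ->//; rewrite preimage_set0.
- by rewrite -preimage_bigcup -[X in measurable X]setTI; exact: mcons.
Qed.

HB.instance Definition _ := isMeasure.Build _ _ _ cube_step
  cube_step0 cube_step_ge0 cube_step_sigma_additive.

Let cube_step_setT : cube_step setT = 1%E.
Proof.
rewrite /cube_step /pushforward preimage_setT -setXTT product_measure1E//.
transitivity (1 * 1 : \bar R)%E; last exact: mule1.
by congr (_ * _)%E; exact: probability_setT.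
Qed.

HB.instance Definition _ := Measure_isProbability.Build _ _ _ cube_step
  cube_step_setT.

End step.

(* Lebesgue measure on D = (0,1)^d, as the d-fold product of the Lebesgue    *)
(* measure on (0,1).  It has total mass |D| = 1, so that averages over D are  *)
(* integrals.                                                                 *)
Fixpoint cube_measure n : probability 'rV[R]_n R :=
  if n is k.+1 then cube_step (cube_measure k)
  else dirac (0 : 'rV[R]_0).

End cube_measure.

Section torus_functions.
Context {R : realType} {d : nat}.
Implicit Types (u v w : 'rV[R]_d -> R) (i : 'I_d).
Local Notation mu := (@cube_measure R d).

(* Functions on the torus are Z^d-periodic functions on R^d. *)
Definition int_vec (z : 'rV[int]_d) : 'rV[R]_d := map_mx intr z.

Definition periodic u := forall x (z : 'rV[int]_d), u (x + int_vec z) = u x.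

Definition partial i u : 'rV[R]_d -> R := fun x => 'D_(delta_mx ord0 i) u x.

Definition smooth u := forall (s : seq 'I_d) (v := foldr partial u s),
  continuous v /\ forall i x, derivable v x (delta_mx ord0 i).

Definition L2ip u v : R := \int[mu]_x (u x * v x).

Definition mean u : R := \int[mu]_x u x.

(* For u in V_h the classical partial derivatives exist off the mesh skeleton *)
(* (a null set) and represent the weak gradient.                              *)
Definition grad_ip u v : R := \sum_i L2ip (partial i u) (partial i v).

Definition grad_norm u : R := Num.sqrt (grad_ip u u).

Definition in_L2 u := measurable_fun setT u /\ finite_norm mu 2%:E u.

Definition weak_partial i u w := forall phi, smooth phi -> periodic phi ->
  L2ip u (partial i phi) = - L2ip w phi.

Definition in_H1 u := in_L2 u /\
  exists w : 'I_d -> 'rV[R]_d -> R, forall i, in_L2 (w i) /\ weak_partial i u (w i).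

(* The Sobolev norms below are only used for smooth functions, whose weak    *)
(* derivatives are the classical ones.                                        *)
Definition W1oo_norm u : \bar R :=
  Order.max ('N[mu]_+oo [EFin \o u])%E
    (\big[Order.max/0%E]_i ('N[mu]_+oo [EFin \o partial i u])%E).

Definition H2_norm_sq u : \bar R :=
  ('N[mu]_2%:E [EFin \o u] ^+ 2
   + \sum_i 'N[mu]_2%:E [EFin \o partial i u] ^+ 2
   + \sum_(i < d) \sum_(j < d | (i <= j)%N)
       'N[mu]_2%:E [EFin \o partial i (partial j u)] ^+ 2)%E.

Definition smooth_orthonormal_basis (g : int -> 'rV[R]_d -> R) :=
  [/\ forall k, smooth (g k) /\ periodic (g k),
      forall k l, L2ip (g k) (g l) = (k == l)%:R
    & forall v (e : R), in_L2 v -> 0 < e ->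
        exists (s : seq int) (c : int -> R),
          ('N[mu]_2%:E [EFin \o (v \- (fun x => \sum_(k <- s) c k * g k x))%R]
             < e%:E)%E].

End torus_functions.

Section mesh.
Context {R : realType} {d : nat}.

(* A d-simplex in R^d is given by its d+1 vertices, the rows of a matrix; the *)
(* point with barycentric coordinates a is a *m K.                            *)
Definition simplex := 'M[R]_(d.+1, d).

Implicit Types (K : simplex) (T : seq simplex).

Definition enorm (x : 'rV[R]_d) : R := Num.sqrt (\sum_i x ord0 i ^+ 2).

Definition affinely_independent K :=
  row_free (row_mx (const_mx 1 : 'cV[R]_d.+1) K).

Definition open_simplex K : set 'rV[R]_d :=
  [set x | exists a : 'rV[R]_d.+1,
    [/\ forall j, 0 < a ord0 j, \sum_j a ord0 j = 1 & x = a *m K]].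

(* Convex hull of the vertices with index in S (empty if S is empty). *)
Definition face K (S : {set 'I_d.+1}) : set 'rV[R]_d :=
  [set x | exists a : 'rV[R]_d.+1,
    [/\ forall j, 0 <= a ord0 j, forall j, j \notin S -> a ord0 j = 0,
        \sum_j a ord0 j = 1 & x = a *m K]].

Definition closed_simplex K := face K [set: 'I_d.+1]%SET.

Definition translate (z : 'rV[int]_d) (A : set 'rV[R]_d) : set 'rV[R]_d :=
  [set x + int_vec z | x in A].

Definition diam K : R :=
  sup [set enorm (x.1 - x.2) | x in open_simplex K `*` open_simplex K].

(* Simplicial partition of the torus R^d / Z^d: the Z^d-translates of the     *)
(* simplices of T form a face-to-face tessellation of R^d, the translates of  *)
(* distinct simplices and the distinct translates of one simplex being        *)
(* disjoint.                                                                  *)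
Definition torus_partition (h : R) T :=
  [/\ forall K, K \in T -> affinely_independent K /\ diam K <= h,
      forall K K' z, K \in T -> K' \in T ->
        open_simplex K `&` translate z (open_simplex K') !=set0 ->
        K = K' /\ z = 0,
      forall x, exists K z, K \in T /\ translate z (closed_simplex K) x
    & forall K K' z, K \in T -> K' \in T -> exists S S' : {set 'I_d.+1},
        [set row j K | j in [set` S]] =
          translate z [set row j K' | j in [set` S']] /\
        closed_simplex K `&` translate z (closed_simplex K') = face K S].

(* Every simplex contains a ball of radius comparable to the largest diameter *)
(* in its mesh, uniformly in h.                                               *)
Definition quasi_uniform (Th : R -> seq simplex) :=
  exists2 kappa : R, 0 < kappa &
    forall h K K', 0 < h -> K \in Th h -> K' \in Th h ->
      exists x, forall y, enorm (y - x) < kappa * diam K' -> open_simplex K y.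

Definition Vh T : set ('rV[R]_d -> R) :=
  [set v | [/\ continuous v, periodic v
    & forall K, K \in T -> exists (b : 'cV[R]_d) (c : R),
        forall x, open_simplex K x -> v x = (x *m b) ord0 ord0 + c]].

Implicit Types u v : 'rV[R]_d -> R.

(* The operators below are given by their characterizing property; on a       *)
(* partition of the torus each is uniquely determined for the arguments to    *)
(* which it is applied.                                                       *)
Definition interp T u : 'rV[R]_d -> R :=
  xget (cst 0) [set v | Vh T v /\
    forall K j, K \in T -> v (row j K) = u (row j K)].

Definition L2_proj T u : 'rV[R]_d -> R :=
  xget (cst 0) [set v | Vh T v /\
    forall phi, Vh T phi -> L2ip v phi = L2ip u phi].

Definition iph T u v : R := mean (interp T (fun x => u x * v x)).

Definition normh T u : R := Num.sqrt (iph T u u).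

Definition inv_lap T u : 'rV[R]_d -> R :=
  xget (cst 0) [set v | [/\ Vh T v, mean v = 0
    & forall phi, Vh T phi -> grad_ip v phi = iph T u phi]].

Definition norm_star T u : R :=
  Num.sqrt (grad_norm (inv_lap T (fun x => u x - mean u)) ^+ 2 + mean u ^+ 2).

End mesh.

Arguments simplex : clear implicits.

Section functions_on_R.
Context {R : realType}.
Implicit Types s phi : R -> R.

Definition in_Loo s :=
  measurable_fun setT s /\ finite_norm (@lebesgue_measure R) +oo%E s.

Definition test_function phi :=
  (forall n x, derivable (derive1n n phi) x 1) /\
  exists M : R, forall x, M < `|x| -> phi x = 0.

Definition weak_derivative s s' := forall phi, test_function phi ->
  \int[@lebesgue_measure R]_x (s x * derive1 phi x) =
  - \int[@lebesgue_measure R]_x (s' x * phi x).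

Definition in_W2oo s := in_Loo s /\ exists s1 s2 : R -> R,
  [/\ in_Loo s1, in_Loo s2, weak_derivative s s1 & weak_derivative s1 s2].

(* C^1 functions on (-1,1) whose extension by 0 to R is C^1. *)
Definition in_C10 s :=
  [/\ forall x, derivable s x 1, continuous (derive1 s)
    & forall x, 1 <= `|x| -> s x = 0].

Definition F_ (delta r : R) : R :=
  if `|r| <= 1 then 0
  else if `|r| < 1 + delta then (`|r| - 1) ^+ 3 / (6 * delta ^+ 2)
  else (`|r| - (1 + delta / 2)) ^+ 2 / (2 * delta) + delta / 24.

Definition f_ (delta : R) : R -> R := derive1 (F_ delta).

End functions_on_R.

Section probability.
Context {dO : measure_display} {Omega : measurableType dO} {R : realType}.
Variable P : probability Omega R.

Definition filtration_usual (F : R -> set (set Omega)) :=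
  [/\ forall t, 0 <= t -> sigma_algebra setT (F t) /\ F t `<=` measurable,
      forall s t, 0 <= s -> s <= t -> F s `<=` F t,
      forall t, 0 <= t -> \bigcap_(s in [set s | t < s]) F s `<=` F t
    & forall A, P.-negligible A -> F 0 A].

Definition brownian_motion (F : R -> set (set Omega)) (B : R -> Omega -> R) :=
  [/\ {ae P, forall w, B 0 w = 0},
      forall t, 0 <= t -> forall A : set R, measurable A -> F t (B t @^-1` A),
      forall s t, 0 <= s -> s < t -> forall A : set R, measurable A ->
        P ((B t \- B s) @^-1` A) = normal_prob 0 (Num.sqrt (t - s)) A,
      forall s t, 0 <= s -> s < t -> forall (E : set Omega) (A : set R),
        F s E -> measurable A ->
        P (E `&` (B t \- B s) @^-1` A) = (P E * P ((B t \- B s)%R @^-1` A))%E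
    & {ae P, forall w, {within `[0, +oo[, continuous (fun t => B t w)}}].

Definition sigma_process (B : R -> Omega -> R) : set (set Omega) :=
  <<s [set E | exists t (A : set R),
         [/\ 0 <= t, measurable A & E = B t @^-1` A]] >>.

Definition independent_processes (I : eqType) (B : I -> R -> Omega -> R) :=
  forall (s : seq I) (A : I -> set Omega), uniq s ->
    (forall i, i \in s -> sigma_process (B i) (A i)) ->
    P (\bigcap_(i in [set` s]) A i) = (\prod_(i <- s) P (A i))%E.

End probability.

Section scheme.
Context {dO : measure_display} {Omega : measurableType dO} {R : realType}.
Context {d : nat}.
Variables (P : probability Omega R).

(* V_h is finite-dimensional, so its Borel sets are generated by evaluations. *)
Definition Vh_random_variable (T : seq (simplex R d))
    (X : Omega -> 'rV[R]_d -> R) :=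
  (forall w, Vh T (X w)) /\ forall x, measurable_fun setT (fun w => X w x).

(* One step of the regularised scheme from Uo = U^{n-1} to (U, W), with       *)
(* db k i the Brownian increment.                                             *)
Definition scheme_step (eps tau delta : R) (sigma : R -> R) (lam : int -> R)
    (g : int -> 'rV[R]_d -> R) (T : seq (simplex R d)) (Z : {fset int})
    (db : int -> 'I_d -> R) (Uo U W : 'rV[R]_d -> R) :=
  (forall phi, Vh T phi ->
     iph T (fun x => U x - Uo x) phi + tau * grad_ip W phi =
     \sum_(i < d) \sum_(k <- Z)
       L2ip (partial i (interp T (fun x => sigma (Uo x) * lam k * g k x))) phi
       * db k i) /\
  (forall psi, Vh T psi ->
     eps * grad_ip U psi + eps^-1 * iph T (fun x => f_ delta (U x) - Uo x) psi =
     iph T W psi).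

Definition scheme_solution (eps tau delta : R) (N : nat) (sigma : R -> R)
    (lam : int -> R) (g : int -> 'rV[R]_d -> R)
    (beta : int -> 'I_d -> R -> Omega -> R) (u0 : 'rV[R]_d -> R)
    (T : seq (simplex R d)) (Z : {fset int})
    (U W : nat -> Omega -> 'rV[R]_d -> R) :=
  (forall w, U 0%N w = L2_proj T u0) /\
  forall n, (0 < n <= N)%N ->
    [/\ Vh_random_variable T (U n), Vh_random_variable T (W n)
      & {ae P, forall w,
          scheme_step eps tau delta sigma lam g T Z
            (fun k i => beta k i (n%:R * tau) w - beta k i (n.-1%:R * tau) w)
            (U n.-1 w) (U n w) (W n w)}].

End scheme.

(* Main.v *)
(* Testing the scheme with z = -Delta_h^{-1}(U^n - m) and with U^n - m gives a one-step energy
   inequality in which the noise enters through a weighted nodal sum of squares of Gaussian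
   increments and through a term b_n that is linear in the increments with previsible
   coefficients.  The energy is therefore dominated by a process with
   v_{n+1} = v_n + K tau + tau rho_n + b_n, where b_n^2 <= 2 tau rho_n v_n and all moments of
   rho_n conditional on the past are bounded independently of h, tau and delta.  Expanding v^q
   to second order and a discrete Gronwall argument bound E[v_n^q], and a pathwise form of
   Doob's inequality bounds the maximum.  Only the independence of the increments from the paths
   themselves is available, so U^n is first shown to be a function of the increments: the
   solution map of one step is Lipschitz in finitely many data and extends continuously. *)

(* Constants must not depend on the mesh. The energy estimate and the initial bounds use
   mesh-independent constants only, from the Poincare inequality and the comparison of lumped and
   exact L2 norms; both rest on the invariance of means of periodic functions under translations and
   integer dilations. Mesh-dependent constants do occur, but only in the continuity of the solution
   map and in integrability arguments, never in the final bound. The energy inequality of the scheme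
   holds only almost surely and only as an inequality. The dominating process is instead defined on
   every path by an exact recursion, with the noise switched off where the process could fall below
   1. Staying above 1 is what makes [b_n] small relative to [v_n]: the square of the quotient is at
   most [2 tau rho_n], of the order of the drift. Expectations are integrals of non-negative
   functions with values in the extended reals. The martingale terms have no sign, so they are
   removed by a comparison of positive and negative parts, which have equal expectation by the
   symmetry of the Gaussian law. *)
From HB Require Import structures.
Require Import Defs.
From mathcomp Require Import all_boot all_order all_algebra finmap.
From mathcomp Require Import all_classical all_reals all_analysis.
From mathcomp Require Import measurable_realfun ess_sup_inf ring lra zify.

Set Implicit Arguments.
Unset Strict Implicit.
Unset Printing Implicit Defensive.

Import Order.TTheory GRing.Theory Num.Theory.
Import numFieldNormedType.Exports.
Import HBNNSimple.

Local Open Scope classical_set_scope.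
Local Open Scope ring_scope.

(** * Integration over the torus *)

(** Neither function is assumed measurable, because the measurability of the random quantities in
    the theorem is never established. A simple function below [f] keeps its integral when it is set
    to 0 on the exceptional null set, and then it lies below [g]. *)
Lemma ge0_le_integral_ae d (T : measurableType d) (R : realType)
    (mu : {measure set T -> \bar R}) (f g : T -> \bar R) :
  (forall x, 0 <= f x)%E -> (forall x, 0 <= g x)%E ->
  {ae mu, forall x, (f x <= g x)%E} ->
  (\int[mu]_x f x <= \int[mu]_x g x)%E.
Proof.
move=> f0 g0 [N [mN N0 fgN]].
rewrite (ge0_integralTE mu f0); apply: ge_ereal_sup => _ [h hf <-].
have mNC : measurable (~` N) by exact: measurableC.
pose h' := proj_nnsfun h mNC.
have hh' : sintegral mu h = sintegral mu h'.
  rewrite -!integralT_nnsfun; apply: ge0_ae_eq_integral => //.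
  - exact/measurable_EFinP.
  - exact/measurable_EFinP.
  - by move=> x _; rewrite lee_fin.
  - by move=> x _; rewrite lee_fin.
  - exists N; split=> // x /= hx; apply: contrapT => Nx; apply: hx => _.
    by rewrite /= mindicE mem_set// mulr1.
rewrite hh' (ge0_integralTE mu g0); apply: ereal_sup_ubound.
exists h' => // x; rewrite /= mindicE.
case: (boolP (x \in ~` N)) => [/set_mem xN|_]; last by rewrite mulr0.
rewrite mulr1; apply: (le_trans (hf x)).
by apply: contrapT => h1; apply: xN; apply: fgN.
Qed.

Lemma ge0_ae_eq_integral' d (T : measurableType d) (R : realType)
    (mu : {measure set T -> \bar R}) (f g : T -> \bar R) :
  (forall x, 0 <= f x)%E -> (forall x, 0 <= g x)%E ->
  {ae mu, forall x, f x = g x} ->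
  (\int[mu]_x f x = \int[mu]_x g x)%E.
Proof.
move=> f0 g0 fg; apply/eqP; rewrite eq_le.
by rewrite !ge0_le_integral_ae//; apply: filterS fg => x ->.
Qed.

Lemma Rintegral_ae_eq d (T : measurableType d) (R : realType)
    (mu : {measure set T -> \bar R}) (f g : T -> R) :
  {ae mu, forall x, f x = g x} ->
  Rintegral mu setT f = Rintegral mu setT g.
Proof.
move=> fg; rewrite /Rintegral; congr fine; rewrite [LHS]integralE [RHS]integralE.
by congr (_ - _)%E; apply: ge0_ae_eq_integral' => //;
  apply: filterS fg => x; rewrite ?funeposE ?funenegE => ->.
Qed.

Section measurable_row_vectors.
Context {R : realType} {n : nat}.

Lemma measurable_rV_fun d (T : measurableType d) (f : T -> 'rV[R]_n) :
  (forall i, measurable_fun setT (fun x => f x ord0 i)) -> measurable_fun setT f.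
Proof. by move=> mf; apply: measurable_fun_rV. Qed.

Lemma measurable_coord (i : 'I_n) : measurable_fun setT (fun x : 'rV[R]_n => x ord0 i).
Proof. exact: measurable_rV_coord. Qed.

Let box (p : 'rV[rat]_n * nat) : set 'rV[R]_n :=
  [set x | forall i, `|x ord0 i - ratr (p.1 ord0 i)| < p.2.+1%:R^-1].

(** Measurability refers to the coordinates, so countability is needed: an open set is the union of
    the boxes with rational centre and radius [1 / (k + 1)] that it contains. *)
Lemma open_measurable_rV (A : set 'rV[R]_n) : open A -> measurable A.
Proof.
move=> oA.
have -> : A = \bigcup_(p in [set p | box p `<=` A]) box p.
  apply/seteqP; split=> [x Ax|x [p /= pA px]]; last exact: pA.
  move: (oA); rewrite openE => /(_ _ Ax) /nbhs_ballP[e /= e0 eA].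
  have [k ke] : exists k, (k.+1%:R^-1 : R) < e / 2.
    have e2 : 0 < e / 2 by rewrite divr_gt0.
    by have [k _ /(_ k (leqnn k))/=] := @near_infty_natSinv_lt R (PosNum e2); exists k.
  have k0 : (0 : R) < k.+1%:R^-1 by rewrite invr_gt0.
  have /choice[q hq] : forall i : 'I_n, exists q : rat,
      `|x ord0 i - ratr q| < (k.+1%:R^-1 : R).
    move=> i; have /rat_in_itvoo[q] : x ord0 i - k.+1%:R^-1 < x ord0 i + k.+1%:R^-1.
      by rewrite ltrBlDr -addrA ltrDl addr_gt0.
    rewrite in_itv/= => /andP[q1 q2]; exists q.
    by rewrite ltr_distlC q1 q2.
  exists (\row_i q i, k) => /=; last by move=> i; rewrite mxE.
  move=> y hy; apply: eA; split=> // a i; have -> : a = ord0 by exact: ord1.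
  rewrite /ball /= -(subrKA (ratr (q i))).
  have := hy i; rewrite mxE /= => hy'.
  apply: (le_lt_trans (ler_normD _ _)).
  rewrite (_ : `|ratr (q i) - y ord0 i| = `|y ord0 i - ratr (q i)|); last by rewrite distrC.
  by apply: (le_lt_trans (lerD (ltW (hq i)) (ltW hy'))); rewrite [ltRHS](splitr e) ltrD.
rewrite bigcup_mkcond; apply: countable_bigcupT_measurable; first exact: countableP.
move=> p; case: ifPn => // _.
rewrite (_ : box p = \big[setI/setT]_(i : 'I_n)
    ((fun x : 'rV[R]_n => x ord0 i) @^-1`
      [set t | `|t - ratr (p.1 ord0 i)| < p.2.+1%:R^-1])); last first.
  apply/seteqP; split=> x.
    by move=> bx; elim/big_ind : _ => // i _; exact: bx.
  by rewrite -bigcap_seq => h i; apply: h; rewrite /= mem_index_enum.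
apply: bigsetI_measurable => i _.
rewrite -[X in measurable X]setTI; apply: measurable_coord => //.
rewrite (_ : mkset _ = ball (ratr (p.1 ord0 i) : R) (p.2.+1%:R^-1)).
  exact: measurable_ball.
by apply/seteqP; split => t; rewrite /ball/= distrC.
Qed.

Lemma continuous_measurable_rV (f : 'rV[R]_n -> R) :
  continuous f -> measurable_fun setT f.
Proof.
move=> cf; apply: (measurability _ (RGenOpens.measurableE R)).
move=> _ [_ [a [b ->] <-]]; rewrite setTI.
apply: open_measurable_rV; apply: open_comp; last exact: interval_open.
by move=> x _; exact: cf.
Qed.

End measurable_row_vectors.

Section affine_change_of_variable.
Context {R : realType}.
Local Notation lam := (@lebesgue_measure R).
Implicit Types (f : R -> \bar R) (c : R).

Let aff (M c : R) (x : measurableTypeR R) : measurableTypeR R := M * x + c.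

Let measurable_aff M c : measurable_fun setT (aff M c).
Proof. by apply: measurable_funD => //; apply: measurable_funM. Qed.

Let maff M c : {mfun _ >-> measurableTypeR R} :=
  HB.pack (aff M c) (isMeasurableFun.Build _ _ _ _ _ (measurable_aff M c)).

(** Both sides are measures that agree on half-open intervals, which determines Lebesgue measure. *)
Let lebesgue_aff (M c : R) (M0 : 0 < M) A : measurable A ->
  lam A = (M%:E * lam (aff M c @^-1` A))%E.
Proof.
move=> mA.
pose p' : {measure set (measurableTypeR R) -> \bar R} := pushforward lam (maff M c).
pose p := p' (measurable_aff M c).
pose m : {measure set (measurableTypeR R) -> \bar R} :=
  mscale (NngNum (ltW M0)) p.
rewrite (@lebesgue_measure_unique _ m)//= => _ [[a b]] _ <-.
rewrite /m /mscale/= /p /pushforward.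
have -> : aff M c @^-1` `]a, b]%classic = `](a - c) / M, (b - c) / M]%classic.
  apply/seteqP; split=> x /=; rewrite !in_itv/= /aff ltr_pdivrMr// ler_pdivlMr//;
    rewrite ltrBlDr lerBrDr (mulrC x); exact.
rewrite !lebesgue_measure_itv/= !lte_fin ltr_pM2r ?invr_gt0// ltrD2r.
case: ifPn => ab; last by rewrite mule0.
by rewrite -!EFinB -EFinM; congr EFin; field; rewrite gt_eqF.
Qed.

Lemma ge0_integral_aff (M c : R) f : 0 < M -> measurable_fun setT f ->
  (forall x, 0 <= f x)%E ->
  (\int[lam]_x f x = M%:E * \int[lam]_x f (M * x + c)%R)%E.
Proof.
move=> M0 mf f0.
have h : (\int[pushforward lam (aff M c)]_x f x = \int[lam]_x f (aff M c x))%E.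
  by rewrite (ge0_integral_pushforward (measurable_aff M c))// preimage_setT.
rewrite -[X in (_ * X)%E]h.
pose p' : {measure set (measurableTypeR R) -> \bar R} := pushforward lam (maff M c).
pose p := p' (measurable_aff M c).
rewrite -(@ge0_integral_mscale _ _ _ p _ _ (NngNum (ltW M0)))//.
by apply: eq_measure_integral => A mA _; rewrite /mscale/=; exact: lebesgue_aff.
Qed.

Lemma ge0_integral_itvco_aff (M c a b : R) f : 0 < M -> measurable_fun setT f ->
  (forall x, 0 <= f x)%E ->
  (\int[lam]_(x in `[(M * a + c)%R, (M * b + c)%R[) f x =
   M%:E * \int[lam]_(x in `[a, b[) f (M * x + c)%R)%E.
Proof.
move=> M0 mf f0.
rewrite integral_mkcond [in RHS]integral_mkcond (@ge0_integral_aff M c)//.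
- congr (_ * _)%E; apply: eq_integral => x _; rewrite !patchE.
  have -> // : (M * x + c \in `[M * a + c, M * b + c[%classic) = (x \in `[a, b[%classic).
  apply/idP/idP; rewrite !inE/= !in_itv/= lerD2r ltrD2r ler_pM2l// ltr_pM2l//.
- apply/(measurable_restrictT _ _).1 => //; exact: measurable_funTS.
- by move=> x; rewrite patchE; case: ifP.
Qed.

Lemma ge0_integral_itvco_split (a b c : R) f : a <= b -> b <= c ->
  measurable_fun setT f -> (forall x, 0 <= f x)%E ->
  (\int[lam]_(x in `[a, c[) f x =
   \int[lam]_(x in `[a, b[) f x + \int[lam]_(x in `[b, c[) f x)%E.
Proof.
move=> ab bc mf f0; rewrite -ge0_integral_setU//.
- congr integral; apply/seteqP; split=> x /=; rewrite !in_itv/=.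
    by case: (ltP x b) => xb /andP[-> h]; [left|right].
  by case=> /andP[h1 h2]; [rewrite h1 (lt_le_trans h2)|rewrite h2 (le_trans ab)].
- exact: measurable_funTS.
- apply/disj_setPS => x /= []; rewrite !in_itv/= => /andP[_ h1] /andP[h2 _].
  by move: h1; rewrite ltNge h2.
Qed.

(** Translating by the integer part of [c] brings the left end into the unit interval; the piece
    beyond 1 is then moved back by one period. *)
Lemma ge0_integral_period f c : measurable_fun setT f -> (forall x, 0 <= f x)%E ->
  (forall x (z : int), f (x + z%:~R) = f x) ->
  (\int[lam]_(x in `[c, (c + 1)%R[) f x = \int[lam]_(x in `[0%R, 1%R[) f x)%E.
Proof.
move=> mf f0 pf.
have sh (z : int) a b : (\int[lam]_(x in `[(a + z%:~R)%R, (b + z%:~R)%R[) f x =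
    \int[lam]_(x in `[a, b[) f x)%E.
  have := @ge0_integral_itvco_aff 1 z%:~R a b f ltr01 mf f0.
  rewrite !mul1r mul1e => ->; apply: eq_integral => x _.
  by rewrite mul1r pf.
pose k := Num.floor c; pose t := c - k%:~R.
have t0 : 0 <= t by rewrite subr_ge0 floor_le.
have t1 : t <= 1.
  by have := floorD1_gt c; rewrite intrD1 /t /k; lra.
have -> : c = t + k%:~R by rewrite subrK.
rewrite (addrAC t) sh (@ge0_integral_itvco_split t 1 (t + 1))//; last by rewrite lerDr.
rewrite (@ge0_integral_itvco_split 0 t 1)// addeC; congr (_ + _)%E.
by rewrite -(sh 1 0 t) add0r.
Qed.

(** The image of the unit interval covers [M.+1] periods, which cancels the Jacobian. The case
    [M = 0] gives translation invariance, and [M = 3] the fourfold dilation used for mass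
    lumping. *)
Lemma ge0_integral_unit_aff f (M : nat) (c : R) : measurable_fun setT f ->
  (forall x, 0 <= f x)%E -> (forall x (z : int), f (x + z%:~R) = f x) ->
  (\int[uniform_prob (@ltr01 R)]_x f (M.+1%:R * x + c)%R =
   \int[uniform_prob (@ltr01 R)]_x f x)%E.
Proof.
move=> mf f0 pf.
have M0 : (0 : R) < M.+1%:R by rewrite ltr0n.
have maffM : measurable_fun setT (fun x : R => f (M.+1%:R * x + c)).
  exact: (measurableT_comp mf (measurable_aff M.+1%:R c)).
have toco (h : R -> \bar R) : measurable_fun setT h -> (forall x, 0 <= h x)%E ->
    (\int[uniform_prob (@ltr01 R)]_x h x = \int[lam]_(x in `[0%R, 1%R[) h x)%E.
  move=> mh h0; rewrite integral_uniform// subr0 invr1 mul1e.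
  rewrite integral_itv_bndo_bndc//; exact: measurable_funTS.
rewrite !toco//.
have N (j : nat) : (\int[lam]_(x in `[c, (c + j%:R)%R[) f x =
    j%:R%:E * \int[lam]_(x in `[0%R, 1%R[) f x)%E.
  elim: j => [|j IH]; first by rewrite addr0 set_itvco0 integral_set0 mul0e.
  rewrite (@ge0_integral_itvco_split c (c + j%:R))//; last 2 first.
  - by rewrite lerDl.
  - by rewrite lerD2l ler_nat.
  have -> : c + j.+1%:R = (c + j%:R) + 1 by rewrite -natr1 addrA.
  rewrite IH -natr1 (@ge0_integral_period f (c + j%:R))// EFinD ge0_muleDl//.
  by rewrite mul1e.
have := @ge0_integral_itvco_aff M.+1%:R c 0 1 f M0 mf f0.
rewrite mulr0 add0r mulr1 (addrC _ c) N => /esym.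
move=> /(congr1 (fun x => ((M.+1%:R^-1)%:E * x)%E)).
by rewrite !muleA -!EFinM mulVf ?gt_eqF// !mul1e.
Qed.

End affine_change_of_variable.

Section cube_integrals.
Context {R : realType}.
Local Notation U := (uniform_prob (@ltr01 R)).

Lemma cube_integralS n (f : 'rV[R]_n.+1 -> \bar R) :
  measurable_fun setT f -> (forall x, 0 <= f x)%E ->
  (\int[@cube_measure R n.+1]_x f x =
   \int[U]_t \int[@cube_measure R n]_y f (@rV_cons R n (t, y)))%E.
Proof.
move=> mf f0.
transitivity (\int[pushforward (U \x @cube_measure R n)%E (@rV_cons R n)]_x f x)%E => //.
rewrite (ge0_integral_pushforward (@measurable_rV_cons R n))// preimage_setT.
rewrite fubini_tonelli1//; last by move=> x; exact: f0.
exact: (measurableT_comp mf (@measurable_rV_cons R n)).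
Qed.

Lemma measurable_cube_section n (f : 'rV[R]_n.+1 -> \bar R) :
  measurable_fun setT f -> (forall x, 0 <= f x)%E ->
  measurable_fun setT
    (fun t : R => \int[@cube_measure R n]_y f (@rV_cons R n (t, y)))%E.
Proof.
move=> mf f0; apply: (@measurable_fun_fubini_tonelli_F _ _ _ _ _ (@cube_measure R n)
  (f \o @rV_cons R n)) => //; last by move=> x; exact: f0.
exact: (measurableT_comp mf (@measurable_rV_cons R n)).
Qed.

Lemma rV_cons0 n (p : measurableTypeR R * 'rV[R]_n) : rV_cons p ord0 ord0 = p.1.
Proof.
rewrite /rV_cons (_ : (ord0 : 'I_n.+1) = @lshift 1 n ord0); last exact: val_inj.
by rewrite (@row_mxEl _ 1 1 n) mxE.
Qed.

Lemma rV_consS n (p : measurableTypeR R * 'rV[R]_n) i :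
  rV_cons p ord0 (lift ord0 i) = p.2 ord0 i.
Proof.
rewrite /rV_cons (_ : lift ord0 i = @rshift 1 n i); last exact: val_inj.
by rewrite (@row_mxEr _ 1 1 n).
Qed.

Lemma rowS_eqP n (x y : 'rV[R]_n.+1) : x ord0 ord0 = y ord0 ord0 ->
  (forall i, x ord0 (lift ord0 i) = y ord0 (lift ord0 i)) -> x = y.
Proof. by move=> h0 hS; apply/rowP => i; case: (unliftP ord0 i) => [j|] ->. Qed.

Definition rV_tail {T : Type} n (x : 'rV[T]_n.+1) : 'rV[T]_n :=
  \row_i x ord0 (lift ord0 i).

Lemma rV_consD n (t s : R) (y z : 'rV[R]_n) :
  @rV_cons R n (t, y) + @rV_cons R n (s, z) = @rV_cons R n (t + s, y + z).
Proof. by apply: rowS_eqP => [|i]; rewrite [LHS]mxE ?rV_cons0 ?rV_consS/= ?mxE. Qed.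

Lemma rV_consZ n (a t : R) (y : 'rV[R]_n) :
  a *: @rV_cons R n (t, y) = @rV_cons R n (a * t, a *: y).
Proof. by apply: rowS_eqP => [|i]; rewrite [LHS]mxE ?rV_cons0 ?rV_consS/= ?mxE. Qed.

Lemma rV_consE n (x : 'rV[R]_n.+1) : x = @rV_cons R n (x ord0 ord0, rV_tail x).
Proof. by apply: rowS_eqP => [|i]; rewrite ?rV_cons0 ?rV_consS ?mxE. Qed.

Lemma int_vec_rV_cons n (k : int) (z : 'rV[int]_n) :
  exists z', @rV_cons R n (k%:~R, int_vec z) = int_vec z'.
Proof.
exists (\row_i if unlift ord0 i is Some j then z ord0 j else k).
by apply: rowS_eqP => [|i]; rewrite ?rV_cons0 ?rV_consS !mxE ?unlift_none ?liftK.
Qed.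

Lemma measurable_affine_rV n (M : R) (c : 'rV[R]_n) :
  measurable_fun setT (fun x : 'rV[R]_n => M *: x + c).
Proof.
apply: measurable_rV_fun => i.
have -> : (fun x : 'rV[R]_n => (M *: x + c) ord0 i) =
    (fun x => M * x ord0 i + c ord0 i) by apply/funext => x; rewrite !mxE.
apply: measurable_funD => //; apply: measurable_funM => //.
exact: measurable_coord.
Qed.

(** Induction on the dimension by Tonelli; lattice periodicity splits into that of the first
    coordinate and that of the remaining ones. *)
Lemma ge0_integral_cube_aff n (f : 'rV[R]_n -> \bar R) (M : nat) (c : 'rV[R]_n) :
  measurable_fun setT f -> (forall x, 0 <= f x)%E ->
  (forall x z, f (x + int_vec z) = f x) ->
  (\int[@cube_measure R n]_x f (M.+1%:R *: x + c)%R = \int[@cube_measure R n]_x f x)%E.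
Proof.
elim: n f c => [|n IH] f c mf f0 pf.
  by apply: eq_integral => x _; congr f; apply/matrixP => i [].
have pfc s (w : 'rV_n) (k : int) (z : 'rV[int]_n) :
    f (@rV_cons R n (s + k%:~R, w + int_vec z)) = f (@rV_cons R n (s, w)).
  by have [z' h] := int_vec_rV_cons k z; rewrite -rV_consD h pf.
have msec s : measurable_fun setT (fun y : 'rV_n => f (@rV_cons R n (s, y))).
  apply: (measurableT_comp mf).
  apply: (measurableT_comp (@measurable_rV_cons R n)).
  exact: pair1_measurable.
rewrite [RHS]cube_integralS// cube_integralS//; last first.
  exact: (measurableT_comp mf (measurable_affine_rV _ _)).
pose g (t : R) := (\int[@cube_measure R n]_y f (@rV_cons R n (t, y)))%E.
rewrite -[RHS](@ge0_integral_unit_aff R g M (c ord0 ord0)).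
- apply: eq_integral => t _; rewrite /g -[RHS](IH _ (rV_tail c))//.
  + by apply: eq_integral => y _; rewrite rV_consZ [X in _ + X](rV_consE c) rV_consD.
  + by move=> w z; have := pfc (M.+1%:R * t + c ord0 ord0) w 0 z; rewrite addr0.
- exact: measurable_cube_section.
- by move=> t; apply: integral_ge0.
- move=> t z; apply: eq_integral => y _.
  have := pfc t y z 0; rewrite (_ : int_vec 0 = 0) ?addr0//.
  by apply/matrixP => i j; rewrite !mxE.
Qed.

(** Tonelli in the first coordinate: either the rest of the normal vector is non-zero and every
    slice is null by induction, or the set fixes the value of the first coordinate. This is what
    makes the mesh skeleton null. *)
Lemma hyperplane_null n (a : 'rV[R]_n) (c : R) : a != 0 ->
  @cube_measure R n [set x | \sum_i a ord0 i * x ord0 i = c] = 0%E.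
Proof.
elim: n a c => [|n IH] a c a0; first by case/eqP: a0; apply/matrixP => i [].
set H := [set x | _].
have mH m (b : 'rV[R]_m) e : measurable [set x : 'rV[R]_m | \sum_i b ord0 i * x ord0 i = e].
  rewrite -[X in measurable X]setTI.
  suff mf : measurable_fun setT (fun x : 'rV[R]_m => \sum_i b ord0 i * x ord0 i).
    by apply: (mf measurableT [set e]).
  by apply: measurable_sum => i; apply: measurable_funM => //; exact: measurable_coord.
have consE t (y : 'rV_n) : H (@rV_cons R n (t, y)) <->
    a ord0 ord0 * t + \sum_i rV_tail a ord0 i * y ord0 i = c.
  rewrite /H/= big_ord_recl rV_cons0/=; set l := _ + _; set r := _ + _.
  suff -> : l = r by [].
  by congr (_ + _); apply: eq_bigr => i _; rewrite rV_consS !mxE.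
transitivity ((U \x @cube_measure R n)%E (@rV_cons R n @^-1` H)) => //.
have mHc : measurable (@rV_cons R n @^-1` H).
  by rewrite -[X in measurable X]setTI; apply: measurable_rV_cons => //; exact: mH.
case: (eqVneq (rV_tail a) 0) => [ra0|ra0].
- have a00 : a ord0 ord0 != 0.
    apply: contra a0 => /eqP a00; rewrite (rV_consE a) ra0 a00.
    by apply/eqP/rowS_eqP => [|i]; rewrite ?rV_cons0 ?rV_consS !mxE.
  have -> : @rV_cons R n @^-1` H = [set c / a ord0 ord0] `*` setT.
    apply/seteqP; split => -[t y].
      move=> /consE; rewrite big1 => [|i _]; last by rewrite ra0 mxE mul0r.
      by rewrite addr0 => <-; split => //=; rewrite mulrAC divff// mul1r.
    move=> [/= -> _]; apply/consE; rewrite big1 => [|i _]; last by rewrite ra0 mxE mul0r.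
    by rewrite addr0 mulrC divfK.
  rewrite product_measure1E//.
  apply/eqP; rewrite mule_eq0; apply/orP; left; apply/eqP.
  have /null_content_dominatesP h := dominates_uniform_prob (@ltr01 R).
  by apply: h => //; exact: lebesgue_measure_set1.
- rewrite /product_measure1 /=.
  apply: integral0_eq => t _.
  rewrite -(IH (rV_tail a) (c - a ord0 ord0 * t) ra0); congr (cube_measure n _).
  apply/seteqP; split => y.
    by move=> /set_mem /(consE t y).1 <-; rewrite addrAC subrr add0r.
  by move=> h; apply/mem_set/(consE t y).2; rewrite [X in _ + X]h addrC subrK.
Qed.

End cube_integrals.

Lemma negligible_countable d (T : measurableType d) (R : realType)
    (mu : {measure set T -> \bar R}) (I : countType) (F : I -> set T) :
  (forall i, mu.-negligible (F i)) -> mu.-negligible (\bigcup_i F i).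
Proof.
move=> nF; pose G n := if @choice.unpickle I n is Some i then F i else set0.
apply: (@negligibleS _ _ _ mu (\bigcup_n G n)) => [x [i _ Fx]|].
  by exists (choice.pickle i) => //; rewrite /G choice.pickleK.
apply: negligible_bigcup => n; rewrite /G; by case: choice.unpickle => [i|]; [exact: nF|exact: negligible_set0].
Qed.

(* Locked: otherwise [done] tries to prove the measurability side conditions by itself. *)
HB.lock Definition bmeas {R : realType} {d : nat} (u : 'rV[R]_d -> R) : Prop :=
  measurable_fun setT u /\ exists M : R, forall x, `|u x| <= M.

Section bounded_measurable.
Context {R : realType} {d : nat}.
Implicit Types (u v w : 'rV[R]_d -> R).
Local Notation mu := (@cube_measure R d).

Lemma bmeasP u :
  bmeas u <-> measurable_fun setT u /\ exists M : R, forall x, `|u x| <= M.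
Proof. by rewrite bmeas.unlock. Qed.

Lemma bmeas_measurable u : bmeas u -> measurable_fun setT u.
Proof. by move=> /bmeasP[]. Qed.

Lemma bmeas_integrable u : bmeas u -> mu.-integrable setT (EFin \o u).
Proof.
move=> /bmeasP[mu0 [M uM]]; apply: measurable_bounded_integrable => //.
  by apply: (le_lt_trans (probability_le1 mu measurableT)); exact: ltry.
exists M; split; first exact: num_real.
by move=> x Mx y _; apply: (le_trans (uM y)); exact: ltW.
Qed.

Lemma bmeas_cst (c : R) : bmeas (cst c : 'rV[R]_d -> R).
Proof. by apply/bmeasP; split=> //; exists `|c| => x. Qed.

Lemma bmeasD u v : bmeas u -> bmeas v -> bmeas (fun x => u x + v x).
Proof.
move=> /bmeasP[mu0 [M uM]] /bmeasP[mv [L vL]]; apply/bmeasP; split; first exact: measurable_funD.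
by exists (M + L) => x; rewrite (le_trans (ler_normD _ _))// lerD.
Qed.

Lemma bmeasM u v : bmeas u -> bmeas v -> bmeas (fun x => u x * v x).
Proof.
move=> /bmeasP[mu0 [M uM]] /bmeasP[mv [L vL]]; apply/bmeasP; split; first exact: measurable_funM.
by exists (M * L) => x; rewrite normrM ler_pM.
Qed.

Lemma bmeasZ c u : bmeas u -> bmeas (fun x => c * u x).
Proof. by move=> bu; apply: bmeasM => //; exact: bmeas_cst. Qed.

Lemma bmeasN u : bmeas u -> bmeas (fun x => - u x).
Proof.
move=> bu; have -> : (fun x => - u x) = (fun x => -1 * u x).
  by apply/funext => x; rewrite mulN1r.
exact: bmeasZ.
Qed.

Lemma bmeasB u v : bmeas u -> bmeas v -> bmeas (fun x => u x - v x).
Proof. by move=> bu bv; apply: (bmeasD bu (bmeasN bv)). Qed.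

Lemma bmeasX u n : bmeas u -> bmeas (fun x => u x ^+ n).
Proof.
move=> bu; elim: n => [|n IH]; first exact: bmeas_cst.
under eq_fun do rewrite exprS; exact: bmeasM.
Qed.

Lemma bmeas_sum (I : Type) (s : seq I) (f : I -> 'rV[R]_d -> R) :
  (forall i, bmeas (f i)) -> bmeas (fun x => \sum_(i <- s) f i x).
Proof.
move=> bf; elim: s => [|i s IH].
  by under eq_fun do rewrite big_nil; exact: bmeas_cst.
under eq_fun do rewrite big_cons; exact: bmeasD.
Qed.

Lemma mean_ae_eq u v : {ae mu, forall x, u x = v x} -> mean u = mean v.
Proof. exact: Rintegral_ae_eq. Qed.

Lemma meanD u v : bmeas u -> bmeas v -> mean (fun x => u x + v x) = mean u + mean v.
Proof. by move=> /bmeas_integrable iu /bmeas_integrable iv; rewrite /mean RintegralD. Qed.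

Lemma meanB u v : bmeas u -> bmeas v -> mean (fun x => u x - v x) = mean u - mean v.
Proof. by move=> /bmeas_integrable iu /bmeas_integrable iv; rewrite /mean RintegralB. Qed.

Lemma meanZ c u : bmeas u -> mean (fun x => c * u x) = c * mean u.
Proof. by move=> /bmeas_integrable iu; rewrite /mean RintegralZl. Qed.

Lemma mean_cst c : mean (cst c : 'rV[R]_d -> R) = c.
Proof. by rewrite /mean Rintegral_cst// [X in fine X]probability_setT mulr1. Qed.

Lemma mean_sum (I : Type) (s : seq I) (f : I -> 'rV[R]_d -> R) :
  (forall i, bmeas (f i)) ->
  mean (fun x => \sum_(i <- s) f i x) = \sum_(i <- s) mean (f i).
Proof.
move=> bf; elim: s => [|i s IH].
  by under eq_fun do rewrite big_nil; rewrite big_nil mean_cst.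
under eq_fun do rewrite big_cons.
by rewrite meanD ?IH ?big_cons//; exact: bmeas_sum.
Qed.

Lemma mean_ge0 u : (forall x, 0 <= u x) -> 0 <= mean u.
Proof. by move=> u0; apply: Rintegral_ge0. Qed.

Lemma mean_le u v : bmeas u -> bmeas v -> (forall x, u x <= v x) -> mean u <= mean v.
Proof.
by move=> bu bv uv; rewrite -subr_ge0 -meanB//; apply: mean_ge0 => x; rewrite subr_ge0.
Qed.

Lemma mean_ge0_ae u : {ae mu, forall x, 0 <= u x} -> 0 <= mean u.
Proof.
move=> u0; rewrite (@mean_ae_eq u (fun x => Num.max 0 (u x))).
  by apply: mean_ge0 => x; rewrite le_max lexx.
by apply: filterS u0 => x ux; rewrite max_r.
Qed.

Lemma mean_EFin u : bmeas u -> (mean u)%:E = (\int[mu]_x (u x)%:E)%E.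
Proof.
by move=> /bmeas_integrable iu; rewrite /mean /Rintegral fineK// integrable_fin_num.
Qed.

Lemma mean_cvg (f : nat -> 'rV[R]_d -> R) u (M : R) :
  (forall n, measurable_fun setT (f n)) -> bmeas u ->
  (forall n x, `|f n x| <= M) ->
  {ae mu, forall x, f n x @[n --> \oo] --> u x} ->
  mean (f n) @[n --> \oo] --> mean u.
Proof.
move=> mf bu fM fu.
have bf n : bmeas (f n) by apply/bmeasP; split=> //; exists M.
have := @dominated_convergence _ _ _ mu setT measurableT
  (fun n => EFin \o f n) (EFin \o u) (cst M%:E).
case.
- by move=> n; apply/measurable_EFinP; exact: mf.
- by apply/measurable_EFinP; exact: bmeas_measurable.
- by apply: filterS fu => x fx _; apply/fine_cvgP; split=> //; exact: nearW.
- apply: (@bmeas_integrable (cst M)); exact: bmeas_cst.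
- by apply: aeW => x n _ /=; rewrite lee_fin.
- move=> _ _ h; apply/fine_cvg.
  by rewrite mean_EFin.
Qed.

Lemma mean_aff u (M : nat) (c : 'rV[R]_d) : bmeas u -> Defs.periodic u ->
  mean (fun x : 'rV[R]_d => u (M.+1%:R *: x + c)) = mean u.
Proof.
move=> bu pu; have /bmeasP[mu0 [B uB]] := bu.
pose v x := u x + B.
have v0 x : 0 <= v x by have := uB x; rewrite /v ler_norml => /andP[]; lra.
have bv : bmeas v by apply: bmeasD => //; exact: bmeas_cst.
have maff : measurable_fun setT (fun x : 'rV[R]_d => u (M.+1%:R *: x + c)).
  exact: (measurableT_comp mu0 (measurable_affine_rV _ _)).
have baff : bmeas (fun x : 'rV[R]_d => u (M.+1%:R *: x + c)) by apply/bmeasP; split=> //; exists B.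
have h : mean (fun x => v (M.+1%:R *: x + c)) = mean v.
  rewrite /mean /Rintegral; congr fine.
  apply: (@ge0_integral_cube_aff R d (EFin \o v) M c).
  - by apply/measurable_EFinP; exact: bmeas_measurable.
  - by move=> x; rewrite lee_fin.
  - by move=> x z; rewrite /= /v pu.
move: h; rewrite /v meanD//; last exact: bmeas_cst.
by rewrite [in RHS]meanD//; [exact: addIr|exact: bmeas_cst].
Qed.

Lemma mean_shift u (c : 'rV[R]_d) : bmeas u -> Defs.periodic u ->
  mean (fun x => u (x + c)) = mean u.
Proof.
move=> bu pu; rewrite -(mean_aff 0 c bu pu); congr mean; apply/funext => x.
by rewrite scale1r.
Qed.

Lemma bmeas_aff u (M : R) (c : 'rV[R]_d) : bmeas u -> bmeas (fun x : 'rV[R]_d => u (M *: x + c)).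
Proof.
move=> /bmeasP[mu0 [B uB]]; apply/bmeasP; split; last by exists B.
exact: (measurableT_comp mu0 (measurable_affine_rV _ _)).
Qed.

Lemma bmeas_shift u (c : 'rV[R]_d) : bmeas u -> bmeas (fun x => u (x + c)).
Proof.
move=> bu; have := bmeas_aff 1 c bu; congr bmeas; apply/funext => x.
by rewrite scale1r.
Qed.

(** The measure sees only the unit cube, while the conclusion concerns all of space. If the set
    contained a point, its rational translates would cover everything, and each of them is null by
    translation invariance, against total mass 1. *)
Lemma periodic_open_null (A : set 'rV[R]_d) : open A ->
  (forall x z, A x -> A (x + int_vec z)) -> mu A = 0%E -> A = set0.
Proof.
move=> oA pA A0; apply/seteqP; split=> // x0 Ax0.
have mA : measurable A by exact: open_measurable_rV.
have pA' x z : A (x + int_vec z) <-> A x.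
  split=> [/pA h|]; last exact: pA.
  have := h (- z); rewrite -addrA (_ : int_vec z + int_vec (- z) = 0) ?addr0//.
  by apply/matrixP => i j; rewrite !mxE intrN subrr.
have mshift c : measurable ((fun x : 'rV[R]_d => x + c) @^-1` A).
  rewrite -[X in measurable X]setTI.
  have -> : (fun x : 'rV[R]_d => x + c) = (fun x => 1 *: x + c).
    by apply/funext => x; rewrite scale1r.
  exact: measurable_affine_rV.
have null c : mu ((fun x : 'rV[R]_d => x + c) @^-1` A) = 0%E.
  have := @ge0_integral_cube_aff R d (fun x => (\1_A x)%:E) 0 c.
  have e1 : (\int[mu]_x (\1_A x)%:E = mu A)%E by rewrite integral_indic// setIT.
  rewrite e1 => h.
  rewrite -[RHS]A0 -h.
  - rewrite -[in LHS](setIT (_ @^-1` _)) -integral_indic//.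
    by apply: eq_integral => x _; rewrite !indicE scale1r.
  - exact/measurable_EFinP.
  - by move=> x; rewrite lee_fin.
  - by move=> x z; rewrite !indicE; congr (_%:R%:E); congr nat_of_bool; apply/idP/idP; rewrite !inE => /pA'.
pose rv (q : 'rV[rat]_d) : 'rV[R]_d := \row_i ratr (q ord0 i).
have cov : setT `<=` \bigcup_(q : 'rV[rat]_d) ((fun x => x + rv q) @^-1` A).
  move=> x _; move: (oA); rewrite openE => /(_ _ Ax0) /nbhs_ballP[e /= e0 eA].
  have /choice[q hq] : forall i : 'I_d, exists q : rat,
      `|(x0 - x) ord0 i - ratr q| < e.
    move=> i; have /rat_in_itvoo[q] : (x0 - x) ord0 i - e < (x0 - x) ord0 i + e.
      by rewrite ltrBlDr -addrA ltrDl addr_gt0.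
    by rewrite in_itv/= => /andP[q1 q2]; exists q; rewrite ltr_distlC q1 q2.
  exists (\row_i q i) => //=; apply: eA; split=> // a i.
  have -> : a = ord0 by exact: ord1.
  rewrite /ball/= !mxE; have := hq i; rewrite !mxE; congr (`|_| < _); ring.
have : mu.-negligible setT.
  apply: (negligibleS cov); apply: negligible_countable => q.
  exact: (negligibleP _ (mshift (rv q))).2 (null (rv q)).
move=> /(negligibleP _ measurableT).1 e2.
by have /eqP := etrans (esym (probability_setT mu)) e2; rewrite onee_eq0.
Qed.

Lemma periodic_ae_bound u (M : R) : continuous u -> Defs.periodic u ->
  {ae mu, forall x, u x <= M} -> forall x, u x <= M.
Proof.
move=> cu pu uM x; rewrite leNgt; apply/negP => Mx.
have oA : open [set y | M < u y].
  by apply: (@open_comp _ _ u [set t | M < t]) => [y _|]; [exact: cu|exact: open_gt].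
suff : [set y | M < u y] = set0 by move=> /seteqP[/(_ x Mx)].
apply: periodic_open_null => //; first by move=> y z /=; rewrite pu.
apply: measure_negligible; first exact: open_measurable_rV.
by apply: negligibleS uM => y /=; rewrite ltNge => /negP.
Qed.

Lemma mean0_continuous u : continuous u -> Defs.periodic u -> bmeas u ->
  (forall x, 0 <= u x) -> mean u = 0 -> forall x, u x = 0.
Proof.
move=> cu pu bu u0 mu0 x; apply/eqP; rewrite eq_le u0 andbT.
apply: periodic_ae_bound => //.
have : (\int[mu]_x (u x)%:E = 0)%E by rewrite -mean_EFin// mu0.
have mu1 : measurable_fun setT (EFin \o u) by apply/measurable_EFinP; exact: bmeas_measurable.
move=> h.
have := (@ae_eq_integral_abs _ _ _ mu setT measurableT _ mu1).1.
under eq_integral do rewrite /= ger0_norm//.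
by move=> /(_ h); apply: filterS => y /(_ I) /= [->].
Qed.

End bounded_measurable.

Ltac bmeas_tac := solve [repeat first [assumption | apply: bmeas_cst | apply: bmeasB
  | apply: bmeasD | apply: bmeasX | apply: bmeasN | apply: bmeasM]].

(** * Finite elements on the torus *)

(** Prefixing a 1 turns the two conditions on barycentric coordinates, unit sum and [a *m K = x],
    into one square linear system, invertible exactly when the vertices are affinely independent. *)
Definition hmx {R : realType} {d : nat} (K : simplex R d) : 'M[R]_(1 + d) :=
  @row_mx R (1 + d) 1 d (const_mx 1) K.

Definition hom {R : realType} {d : nat} (x : 'rV[R]_d) : 'rV[R]_(1 + d) :=
  @row_mx R 1 1 d (const_mx 1) x.

HB.lock Definition bar {R : realType} {d : nat} (K : simplex R d) (x : 'rV[R]_d) :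
  'rV[R]_d.+1 := @mulmx R 1 (1 + d) (1 + d) (hom x) (invmx (hmx K)).

(** Its rows are the constant partial derivatives of the barycentric coordinates. *)
HB.lock Definition bar_slope {R : realType} {d : nat} (K : simplex R d) :
  'M[R]_(d, d.+1) := @dsubmx R 1 d d.+1 (invmx (hmx K)).

Section barycentric.
Context {R : realType} {d : nat}.
Implicit Types (K : simplex R d) (x y : 'rV[R]_d) (a : 'rV[R]_d.+1).

Lemma mul_hmx a K : \sum_j a ord0 j = 1 -> @mulmx R 1 (1 + d) (1 + d) a (hmx K) = hom (a *m K).
Proof.
move=> a1; rewrite /hmx /hom (@mul_mx_row R 1 (1 + d)); congr (@row_mx R 1 1 d _ _).
apply/matrixP => i j; rewrite !mxE (ord1 i) -[RHS]a1.
by apply: eq_bigr => l _; rewrite !mxE mulr1.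
Qed.

Lemma hom_inj x y : hom x = hom y -> x = y.
Proof. by move=> /(@eq_row_mx R 1 1 d)[]. Qed.

Lemma bar_sub K x y : bar K x - bar K y = (x - y) *m bar_slope K.
Proof.
rewrite bar.unlock -[LHS](@mulmxBl R 1 (1 + d) (1 + d)).
have -> : hom x - hom y = @row_mx R 1 1 d 0 (x - y).
  rewrite /hom (@opp_row_mx R 1 1 d) (@add_row_mx R 1 1 d); congr (@row_mx R 1 1 d _ _).
  exact: subrr.
rewrite -[invmx (hmx K)](@vsubmxK R 1 d (1 + d)) (@mul_row_col R 1 1 d) mul0mx add0r.
by rewrite bar_slope.unlock; congr (_ *m @dsubmx R 1 d (1 + d) _); rewrite (@vsubmxK R 1 d (1 + d)).
Qed.

Lemma bar_subE K x y j :
  bar K x ord0 j - bar K y ord0 j =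
  \sum_i (x ord0 i - y ord0 i) * bar_slope K i j.
Proof.
have := congr1 (fun A : 'rV_d.+1 => A ord0 j) (bar_sub K x y).
by rewrite /= !mxE => ->; apply: eq_bigr => i _; rewrite !mxE.
Qed.

Lemma bar_comb K x y (s t : R) : s + t = 1 ->
  bar K (s *: x + t *: y) = s *: bar K x + t *: bar K y.
Proof.
move=> st; rewrite bar.unlock.
have -> : hom (s *: x + t *: y) = s *: hom x + t *: hom y; last first.
  apply/rowP => j; rewrite !mxE mulr_sumr mulr_sumr -big_split/=.
  by apply: eq_bigr => i _; rewrite !mxE mulrDl !mulrA.
rewrite /hom !(@scale_row_mx R 1 1 d) (@add_row_mx R 1 1 d); congr (@row_mx R 1 1 d _ _).
by apply/matrixP => i j; rewrite !mxE !mulr1 st.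
Qed.

Section independent.
Variable K : simplex R d.
Hypothesis indK : affinely_independent K.

Lemma hmx_unit : hmx K \in unitmx.
Proof. by rewrite -row_free_unit. Qed.

Lemma bar_uniq a x : \sum_j a ord0 j = 1 -> x = a *m K -> a = bar K x.
Proof.
move=> a1 ->; rewrite bar.unlock -(mul_hmx K a1).
by rewrite mulmxK ?hmx_unit.
Qed.

Lemma bar_hmx x : @mulmx R 1 (1 + d) (1 + d) (bar K x) (hmx K) = hom x.
Proof. by rewrite bar.unlock mulmxKV// hmx_unit. Qed.

Lemma bar_sum x : \sum_j bar K x ord0 j = 1.
Proof.
have := bar_hmx x; rewrite /hmx /hom (@mul_mx_row R 1 (1 + d)) => /(@eq_row_mx R 1 1 d)[+ _].
move=> /(congr1 (fun A : 'M[R]_1 => A ord0 ord0)); rewrite !mxE => h.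
by rewrite -[RHS]h; apply: eq_bigr => j _; rewrite !mxE mulr1.
Qed.

Lemma bar_mulK x : bar K x *m K = x.
Proof. by apply: hom_inj; rewrite -mul_hmx ?bar_hmx// bar_sum. Qed.

Lemma bar_row j : bar K (row j K) = delta_mx ord0 j.
Proof.
apply/esym/bar_uniq; last by rewrite rowE.
by rewrite (bigD1 j)//= mxE !eqxx big1 ?addr0// => i ij; rewrite mxE eqxx (negbTE ij).
Qed.

Lemma open_simplexP x : open_simplex K x <-> forall j, 0 < bar K x ord0 j.
Proof.
split=> [[a [a0 a1 xa]] j|h].
  by rewrite -(bar_uniq a1 xa).
by exists (bar K x); split=> //; [exact: bar_sum|rewrite bar_mulK].
Qed.

Lemma faceP (S : {set 'I_d.+1}) x : face K S x <->
  (forall j, 0 <= bar K x ord0 j) /\ (forall j, j \notin S -> bar K x ord0 j = 0).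
Proof.
split=> [[a [a0 aS a1 xa]]|[h hS]].
  by rewrite -(bar_uniq a1 xa).
by exists (bar K x); split=> //; [exact: bar_sum|rewrite bar_mulK].
Qed.

Lemma closed_simplexP x : closed_simplex K x <-> forall j, 0 <= bar K x ord0 j.
Proof.
rewrite /closed_simplex faceP; split=> [[]//|h]; split=> // j.
by rewrite inE.
Qed.

Lemma closed_simplex_row j : closed_simplex K (row j K).
Proof. by apply/closed_simplexP => i; rewrite bar_row mxE ler0n. Qed.

End independent.

Lemma translateP (A : set 'rV[R]_d) z x : translate z A x <-> A (x - int_vec z).
Proof.
split=> [[y Ay <-]|h]; first by rewrite addrK.
by exists (x - int_vec z) => //; rewrite subrK.
Qed.

Lemma int_vecD (z w : 'rV[int]_d) : int_vec (z + w) = int_vec z + int_vec w :> 'rV[R]_d.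
Proof. by apply/matrixP => i j; rewrite !mxE intrD. Qed.

Lemma int_vecN (z : 'rV[int]_d) : int_vec (- z) = - int_vec z :> 'rV[R]_d.
Proof. by apply/matrixP => i j; rewrite !mxE intrN. Qed.

Lemma int_vec0 : int_vec (0 : 'rV[int]_d) = 0 :> 'rV[R]_d.
Proof. by apply/matrixP => i j; rewrite !mxE. Qed.

Lemma periodicB (u : 'rV[R]_d -> R) x z : Defs.periodic u -> u (x - int_vec z) = u x.
Proof. by move=> pu; rewrite -int_vecN pu. Qed.

Lemma row_coord_le (a : 'rV[R]_d.+1) K i : (forall j, 0 <= a ord0 j) ->
  \sum_j a ord0 j = 1 -> `|(a *m K) ord0 i| <= \sum_j \sum_i `|K j i|.
Proof.
move=> a0 a1; rewrite mxE (le_trans (ler_norm_sum _ _ _))// ler_sum// => j _.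
rewrite normrM ger0_norm// (le_trans (ler_piMl _ _))//.
  by rewrite -a1 (bigD1 j)//= lerDl sumr_ge0.
by rewrite (bigD1 i)//= lerDl sumr_ge0.
Qed.

Definition int_box (M : nat) : seq 'rV[int]_d :=
  [seq \row_i ((f i : nat)%:Z - M%:Z) | f : {ffun 'I_d -> 'I_(M + M).+1}].

Lemma int_boxP (M : nat) (z : 'rV[int]_d) :
  (forall i, `|z ord0 i| <= M%:Z) -> z \in int_box M.
Proof.
move=> zM; apply/mapP; exists [ffun i => inord (absz (z ord0 i + M%:Z))]; first by rewrite mem_enum.
apply/rowP => i; rewrite !mxE ffunE inordK; have := zM i; rewrite ler_norml => /andP[h1 h2].
  by change (z 0 i) with (z ord0 i); rewrite gez0_abs; lia.
by rewrite ltnS; lia.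
Qed.

End barycentric.

Section l1_distance.
Context {R : realType} {d : nat}.
Implicit Types (x y : 'rV[R]_d) (u : 'rV[R]_d -> R).

Definition l1 x : R := \sum_i `|x ord0 i|.

Lemma l1_ge0 x : 0 <= l1 x. Proof. by rewrite sumr_ge0. Qed.

Lemma l1_coord x i : `|x ord0 i| <= l1 x.
Proof. by rewrite /l1 (bigD1 i)//= lerDl sumr_ge0. Qed.

Lemma l1_ball x e : 0 < e -> exists2 r : R, 0 < r & forall y, ball x r y -> l1 (y - x) < e.
Proof.
move=> e0; have d0 : (0 : R) < d.+1%:R by rewrite ltr0n.
exists (e / d.+1%:R); first by rewrite divr_gt0.
move=> y [_ xy]; apply: (@le_lt_trans _ _ (\sum_(i < d) e / d.+1%:R)).
  by apply: ler_sum => i _; rewrite !mxE distrC; exact/ltW/xy.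
rewrite sumr_const card_ord -[_ *+ d]mulr_natr -mulrA gtr_pMr// mulrC ltr_pdivrMr// mul1r.
by rewrite ltr_nat.
Qed.

Lemma ball_l1 x y (e : R) : l1 (y - x) < e -> ball x e y.
Proof.
move=> h; split; first exact: le_lt_trans (l1_ge0 _) h.
move=> a i; have -> : a = ord0 by exact: ord1.
rewrite /ball/= distrC; apply: le_lt_trans h.
by have := l1_coord (y - x) i; rewrite !mxE.
Qed.

Lemma l1_continuous_at u x :
  (forall e, 0 < e -> exists2 r, 0 < r & forall y, l1 (y - x) < r -> `|u y - u x| < e) ->
  u y @[y --> x] --> u x.
Proof.
move=> h; apply/(@cvgrPdist_lt R R^o _ (nbhs x) (nbhs_filter x)) => e /h[r r0 hr].
have [s s0 hs] := l1_ball x r0.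
apply/nbhs_ballP; exists s => //= y /hs /hr; rewrite distrC; exact.
Qed.

Lemma open_l1 (A : set 'rV[R]_d) x : open A -> A x ->
  exists2 r, 0 < r & forall y, l1 (y - x) < r -> A y.
Proof.
rewrite openE => oA /oA /nbhs_ballP[e /= e0 eA].
by exists e => // y /ball_l1 /eA.
Qed.

Lemma l1_all_seq (I : eqType) (s : seq I) x (Q : I -> 'rV[R]_d -> Prop) :
  (forall i, i \in s -> exists2 r, 0 < r & forall y, l1 (y - x) < r -> Q i y) ->
  exists2 r, 0 < r & forall y, l1 (y - x) < r -> forall i, i \in s -> Q i y.
Proof.
elim: s => [|i s IH] hQ; first by exists 1.
have [r1 r10 h1] := hQ i (mem_head _ _).
have [r2 r20 h2] : exists2 r, 0 < r & forall y, l1 (y - x) < r -> forall i, i \in s -> Q i y.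
  by apply: IH => j js; apply: hQ; rewrite inE js orbT.
exists (Num.min r1 r2); first by rewrite lt_min r10.
move=> y; rewrite lt_min => /andP[/h1 q1 /h2 q2] j.
by rewrite inE => /orP[/eqP->|/q2].
Qed.

End l1_distance.

(** * Piecewise linear functions through barycentric coordinates *)

Section piecewise_linear.
Context {R : realType} {d : nat}.
Variables (h : R) (T : seq (simplex R d)).
Hypothesis hT : torus_partition h T.
Implicit Types (K : simplex R d) (x y : 'rV[R]_d) (v : 'rV[R]_d -> R).

Lemma mesh_independent K : K \in T -> affinely_independent K.
Proof. by move=> KT; case: hT => /(_ K KT)[]. Qed.

Definition in_cell x K z := [/\ K \in T & forall j, 0 <= bar K (x - int_vec z) ord0 j].

Lemma cell_cover x : exists K z, in_cell x K z.
Proof.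
case: hT => _ _ /(_ x)[K [z [KT /translateP /closed_simplexP h0]]] _.
exists K, z; split => //; exact/h0/mesh_independent.
Qed.

Definition slope_bd K : R := \sum_j \sum_i `|bar_slope K i j|.

Lemma bar_lip K x y z j :
  `|bar K (y - int_vec z) ord0 j - bar K (x - int_vec z) ord0 j| <= slope_bd K * l1 (y - x).
Proof.
rewrite bar_subE (le_trans (ler_norm_sum _ _ _))// /l1 mulr_sumr ler_sum// => i _.
rewrite normrM mulrC !mxE; apply: ler_pM => //; last by rewrite le_eqVlt; apply/orP; left; apply/eqP; congr (`|_|); ring.
rewrite /slope_bd (bigD1 j)//= (bigD1 i)//= -addrA lerDl addr_ge0 ?sumr_ge0// => a _.
exact: sumr_ge0.
Qed.

Lemma slope_bd_ge0 K : 0 <= slope_bd K.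
Proof. by apply: sumr_ge0 => j _; apply: sumr_ge0. Qed.

Lemma ler_sum_mem (I : eqType) (s : seq I) (f : I -> R) i :
  (forall j, 0 <= f j) -> i \in s -> f i <= \sum_(j <- s) f j.
Proof.
move=> f0; elim: s => // a s IH; rewrite inE big_cons => /orP[/eqP<-|/IH h1].
  by rewrite lerDl sumr_ge0.
by rewrite (le_trans h1)// lerDr.
Qed.

(** Only finitely many translated cells come close to [x], and those that do not contain [x] have a
    negative coordinate there, which stays negative nearby. A cell of a nearby point therefore
    contains [x] as well. *)
Lemma near_cell x : exists2 r, 0 < r &
  forall y, l1 (y - x) < r -> exists K z, in_cell x K z /\ in_cell y K z.
Proof.
pose S : R := \sum_(K <- T) \sum_j \sum_i `|K j i|.
(* A cell that meets the unit ball about [x] is translated by at most [M] in each coordinate. *)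
pose M := (Num.truncn (l1 x + 1 + S)).+1.
pose s := [seq (K, z) | K <- T, z <- @int_box d M].
pose Q (p : simplex R d * 'rV[int]_d) y := in_cell y p.1 p.2 -> in_cell x p.1 p.2.
have [r r0 hr] : exists2 r, 0 < r & forall y, l1 (y - x) < r -> forall p, p \in s -> Q p y.
  apply: l1_all_seq => -[K' z'] /allpairsP[[K z] [/= KT _ [-> ->]]].
  have [cx|ncx] := pselect (in_cell x K z); first by exists 1 => // y _ _.
  have [j hj] : exists j, bar K (x - int_vec z) ord0 j < 0.
    apply: contrapT => hn; apply: ncx; split=> // j; rewrite leNgt; apply/negP => hj.
    by apply: hn; exists j.
  have s0 : 0 < slope_bd K + 1 by rewrite ltr_wpDl// slope_bd_ge0.
  exists (- bar K (x - int_vec z) ord0 j / (slope_bd K + 1)).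
    by rewrite divr_gt0// oppr_gt0.
  move=> y; rewrite ltr_pdivlMr// mulrDr mulr1 mulrC => hy [_ /(_ j)] yj.
  have := bar_lip K x y z j; rewrite ler_norml => /andP[_].
  by have := l1_ge0 (y - x); lra.
exists (Num.min r 1); first by rewrite lt_min r0 ltr01.
move=> y; rewrite lt_min => /andP[/hr q1 y1].
have [K [z cy]] := cell_cover y; exists K, z; split=> //.
apply: (q1 (K, z)) => //; apply/allpairsP; exists (K, z); split=> //=; first by case: cy.
apply: int_boxP => i; rewrite -(ler_int R) intr_norm.
have zE : (z ord0 i)%:~R = x ord0 i + (y - x) ord0 i - (y - int_vec z) ord0 i :> R.
  by rewrite !mxE; ring.
have [KT c0] := cy.
rewrite zE (le_trans (ler_normB _ _))//.
apply: (@le_trans _ _ (l1 x + 1 + S)); last by rewrite ltW// /M; exact: truncnS_gt.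
apply: lerD.
  rewrite (le_trans (ler_normD _ _))// lerD// ?l1_coord//.
  by rewrite (le_trans (l1_coord _ _))// ltW.
have indK := mesh_independent KT.
rewrite -{1}(bar_mulK indK (y - int_vec z)) (le_trans (row_coord_le _ _ c0 _))//.
  exact: bar_sum.
apply: (@ler_sum_mem _ T (fun K : simplex R d => \sum_j \sum_i `|K j i|)) => // K'.
by apply: sumr_ge0 => a _; apply: sumr_ge0.
Qed.

(** For a torus partition this is membership in [Vh], rewritten with closed simplices and nodal
    values; continuity becomes a consequence instead of a requirement. *)
Definition pl v := Defs.periodic v /\
  forall K x, K \in T -> (forall j, 0 <= bar K x ord0 j) ->
    v x = \sum_j bar K x ord0 j * v (row j K).

Lemma pl_cell v x K z : pl v -> in_cell x K z ->
  v x = \sum_j bar K (x - int_vec z) ord0 j * v (row j K).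
Proof. by move=> [pv hv] [KT c0]; rewrite -(periodicB x z pv); exact: hv. Qed.

Lemma bar_le1 K x z j : in_cell x K z -> bar K (x - int_vec z) ord0 j <= 1.
Proof.
move=> [KT c0]; rewrite -(bar_sum (mesh_independent KT) (x - int_vec z)).
by rewrite (bigD1 j)//= lerDl sumr_ge0.
Qed.

Lemma pl_bounded v : pl v -> exists M : R, forall x, `|v x| <= M.
Proof.
move=> plv; exists (\sum_(K <- T) \sum_j `|v (row j K)|) => x.
have [K [z cx]] := cell_cover x; have [KT c0] := cx.
rewrite (pl_cell plv cx) (le_trans (ler_norm_sum _ _ _))//.
apply: (@le_trans _ _ (\sum_j `|v (row j K)|)).
  apply: ler_sum => j _; rewrite normrM ger0_norm// ler_piMl//.
  exact: bar_le1 cx.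
apply: (@ler_sum_mem _ T (fun K : simplex R d => \sum_j `|v (row j K)|)) => // K'.
exact: sumr_ge0.
Qed.

Definition lip_at (L : R) v x := exists2 r, 0 < r &
  forall y, l1 (y - x) < r -> `|v y - v x| <= L * l1 (y - x).

Lemma pl_lip_at v : pl v -> exists2 L : R, 0 <= L & forall x, lip_at L v x.
Proof.
move=> plv; pose c K := slope_bd K * \sum_j `|v (row j K)|.
have c0 K : 0 <= c K by rewrite mulr_ge0 ?slope_bd_ge0 ?sumr_ge0.
exists (\sum_(K <- T) c K); first exact: sumr_ge0.
move=> x; have [r r0 hr] := near_cell x; exists r => // y /hr[K [z [cx cy]]].
rewrite (pl_cell plv cx) (pl_cell plv cy) -sumrB (le_trans (ler_norm_sum _ _ _))//.
apply: (@le_trans _ _ (c K * l1 (y - x))); last first.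
  by rewrite ler_wpM2r ?l1_ge0//; apply: ler_sum_mem => //; case: cx.
rewrite /c mulrAC mulr_sumr; apply: ler_sum => j _.
by rewrite -mulrBl normrM ler_wpM2r// bar_lip.
Qed.

Lemma lip_at_continuous L v : 0 <= L -> (forall x, lip_at L v x) -> continuous v.
Proof.
move=> L0 lv x; apply: l1_continuous_at => e e0; have [r r0 hr] := lv x.
have L1 : 0 < L + 1 by rewrite ltr_wpDl.
exists (Num.min r (e / (L + 1))); first by rewrite lt_min r0 divr_gt0.
move=> y; rewrite lt_min => /andP[/hr h1]; rewrite ltr_pdivlMr// mulrDr mulr1 mulrC => h2.
by rewrite (le_lt_trans h1)//; have := l1_ge0 (y - x); lra.
Qed.

Lemma pl_continuous v : pl v -> continuous v.
Proof. by move=> /pl_lip_at[L L0 hL]; exact: lip_at_continuous L0 hL. Qed.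

Lemma pl_Vh v : pl v -> Vh T v.
Proof.
move=> plv; split; [exact: pl_continuous|by case: plv|].
move=> K KT; have indK := mesh_independent KT.
exists (\col_i \sum_j bar_slope K i j * v (row j K)).
exists (\sum_j bar K 0 ord0 j * v (row j K)) => x /(open_simplexP indK) c0.
have [_ /(_ K x KT) ->] := plv; last by move=> j; exact/ltW.
rewrite !mxE -[X in X + _](_ : \sum_j (\sum_i x ord0 i * bar_slope K i j) * v (row j K) = _).
  rewrite -big_split/=; apply: eq_bigr => j _; rewrite -mulrDl; congr (_ * _).
  rewrite -[LHS](subrK (bar K 0 ord0 j)) bar_subE; congr (_ + _).
  by apply: eq_bigr => i _; rewrite mxE subr0.
under eq_bigr do rewrite mulr_suml.
rewrite exchange_big/=; apply: eq_bigr => i _; rewrite !mxE mulr_sumr.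
by apply: eq_bigr => j _; rewrite mulrA.
Qed.

(** Membership in [Vh] gives an affine formula on the open simplex only. A point of the closed
    simplex is approached along the segment from the barycentre [g], which stays in the open
    simplex, and continuity carries the formula over. *)
Lemma Vh_pl v : Vh T v -> pl v.
Proof.
move=> [cv pv av]; split=> // K x KT c0.
have indK := mesh_independent KT; have [b [c hb]] := av K KT.
pose l (y : 'rV[R]_d) := (y *m b) ord0 ord0 + c.
have lcl y : (forall j, 0 <= bar K y ord0 j) -> v y = l y.
  move=> y0.
  pose g : 'rV[R]_d := (\row_j (d.+1%:R^-1 : R)) *m K.
  have d0 : (0 : R) < d.+1%:R^-1 by rewrite invr_gt0 ltr0n.
  have gE : bar K g = \row_j d.+1%:R^-1.
    apply/esym/bar_uniq => //; under eq_bigr do rewrite mxE.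
    by rewrite sumr_const card_ord -[_ *+ _]mulr_natr mulVf// pnatr_eq0.
  pose p (s : R) := s *: g + (1 - s) *: y.
  have lp s : l (p s) = s * l g + (1 - s) * l y.
    by rewrite /l /p mulmxDl -!scalemxAl !mxE; ring.
  have hp s : 0 < s -> s <= 1 -> v (p s) = l (p s).
    move=> s0 s1; apply: hb; apply/(open_simplexP indK) => j.
    rewrite /p bar_comb; last by rewrite addrC subrK.
    rewrite gE !mxE ltr_pwDl// ?mulr_gt0//.
    by rewrite mulr_ge0// subr_ge0.
  apply/eqP; rewrite -subr_eq0 -normr_le0; apply/ler_addgt0Pr => e e0; rewrite add0r.
  have e2 : 0 < e / 2 by rewrite divr_gt0.
  have oA : open [set t : 'rV[R]_d | `|v t - v y| < e / 2].
    apply: (@open_comp _ _ v [set r | `|r - v y| < e / 2]) => [t _|]; first exact: cv.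
    rewrite (_ : mkset _ = ball (v y) (e / 2)); first exact: ball_open.
    by apply/seteqP; split=> t; rewrite /ball/= distrC.
  have Ay : [set t | `|v t - v y| < e / 2] y by rewrite /= subrr normr0.
  have [r r0 hr] := open_l1 oA Ay.
  pose D := l1 (g - y) + `|l g - l y| + 1.
  have D0 : 0 < D by rewrite /D ltr_wpDl// addr_ge0 ?l1_ge0.
  pose s := Num.min 1 (Num.min (r / D) (e / 2 / D)).
  have s0 : 0 < s by rewrite !lt_min ltr01 !divr_gt0.
  have s1 : s <= 1 by rewrite /s ge_min lexx.
  have sr : s * D <= r by rewrite -ler_pdivlMr// /s !ge_min lexx !orbT.
  have se : s * D <= e / 2 by rewrite -ler_pdivlMr// /s !ge_min lexx !orbT.
  have lps : l1 (p s - y) = s * l1 (g - y).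
    rewrite /l1 mulr_sumr; apply: eq_bigr => i _.
    rewrite -[s in RHS]gtr0_norm// -normrM; congr (`|_|).
    by rewrite !mxE; ring.
  have h1 : `|v (p s) - v y| < e / 2.
    apply: hr; rewrite lps; apply: lt_le_trans sr; rewrite ltr_pM2l// /D -addrA ltrDl.
    by rewrite ltr_wpDl.
  have h2 : `|v (p s) - l y| <= e / 2.
    rewrite hp// lp (_ : _ - _ = s * (l g - l y)); last by ring.
    rewrite normrM gtr0_norm// (le_trans _ se)// ler_pM2l// /D -addrA (addrC (l1 _)) -addrA lerDl.
    by rewrite addr_ge0// l1_ge0.
  rewrite (_ : v y - l y = - (v (p s) - v y) + (v (p s) - l y)); last by ring.
  rewrite (le_trans (ler_normD _ _))// normrN; lra.
rewrite lcl// /l -{1}(bar_mulK indK x).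
under eq_bigr => j _.
  rewrite lcl; last by apply/(closed_simplexP indK); exact: closed_simplex_row.
  rewrite /l mulrDr; over.
rewrite big_split/= -mulr_suml bar_sum// mul1r; congr (_ + _).
rewrite -mulmxA mxE; apply: eq_bigr => j _; congr (_ * _).
by rewrite -row_mul [RHS]mxE.
Qed.

End piecewise_linear.

Section interpolation.
Context {R : realType} {d : nat}.
Variables (h : R) (T : seq (simplex R d)).
Hypothesis hT : torus_partition h T.
Implicit Types (K : simplex R d) (x y : 'rV[R]_d) (u v w : 'rV[R]_d -> R).

(** This makes the interpolant well defined. Two translated closed simplices that contain [x] meet
    in a common face; the coordinates of [x] vanish off that face, and on it the vertices agree up
    to a lattice vector, where [u] takes equal values. *)
Lemma cell_value u x K z K' z' : Defs.periodic u -> in_cell T x K z -> in_cell T x K' z' ->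
  \sum_j bar K (x - int_vec z) ord0 j * u (row j K) =
  \sum_j bar K' (x - int_vec z') ord0 j * u (row j K').
Proof.
move=> pu [KT c0] [KT' c0'].
have indK := mesh_independent hT KT; have indK' := mesh_independent hT KT'.
have [_ _ _ /(_ K K' (z' - z) KT KT')[S [S' [hS hf]]]] := hT.
set a := bar K (x - int_vec z).
have xw : x - int_vec z' = x - int_vec z - int_vec (z' - z).
  by rewrite int_vecD int_vecN opprD opprK !addrA addrAC subrK.
have aS j : j \notin S -> a ord0 j = 0.
  have : face K S (x - int_vec z).
    rewrite -hf; split; first exact/closed_simplexP.
    by apply/translateP/closed_simplexP => //; rewrite -xw.
  by move=> /(faceP indK)[_ +]; exact.
have /choice[pi hpi] : forall j, exists j', j \in S -> row j K = row j' K' + int_vec (z' - z).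
  move=> j; have [jS|jS] := boolP (j \in S); last by exists ord0.
  have : [set row j K | j in [set` S]] (row j K) by exists j.
  by rewrite hS => -[_ [j' _ <-] <-]; exists j'.
(* The coordinates relative to [K], carried to the matching vertices of [K']; uniqueness identifies
   them with the coordinates relative to [K']. *)
pose a' : 'rV[R]_d.+1 := \sum_j a ord0 j *: delta_mx ord0 (pi j).
have a'E j' : a' ord0 j' = \sum_j a ord0 j * (j' == pi j)%:R.
  by rewrite /a' summxE; apply: eq_bigr => j _; rewrite !mxE eqxx.
have swap (f : 'I_d.+1 -> R) : \sum_j' a' ord0 j' * f j' = \sum_j a ord0 j * f (pi j).
  under eq_bigr do rewrite a'E mulr_suml.
  rewrite exchange_big/=; apply: eq_bigr => j _.
  rewrite (bigD1 (pi j))//= eqxx mulr1 big1 ?addr0// => i /negbTE->.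
  by rewrite mulr0 mul0r.
have <- : a' = bar K' (x - int_vec z').
  apply: bar_uniq => //.
    have := swap (fun => 1); under eq_bigr do rewrite mulr1.
    by move=> ->; under eq_bigr do rewrite mulr1; exact: bar_sum.
  rewrite xw -{1}(bar_mulK indK (x - int_vec z)) -/a.
  apply/rowP => i; rewrite [RHS]mxE swap !mxE.
  have -> : (z' ord0 i - z ord0 i)%:~R = \sum_j a ord0 j * (z' ord0 i - z ord0 i)%:~R :> R.
    by rewrite -mulr_suml bar_sum// mul1r.
  rewrite -sumrB; apply: eq_bigr => j _; rewrite -mulrBr.
  have [jS|/aS->] := boolP (j \in S); last by rewrite !mul0r.
  congr (_ * _); have := congr1 (fun A : 'rV_d => A ord0 i) (hpi j jS).
  by rewrite !mxE => ->; rewrite addrK.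
rewrite swap; apply: eq_bigr => j _.
have [jS|/aS->] := boolP (j \in S); last by rewrite !mul0r.
by rewrite (hpi j jS) pu.
Qed.

Lemma interpolant_exists u : Defs.periodic u ->
  exists v, Vh T v /\ forall K j, K \in T -> v (row j K) = u (row j K).
Proof.
move=> pu.
have /choice[c hc] : forall x, exists p : simplex R d * 'rV[int]_d, in_cell T x p.1 p.2.
  by move=> x; have [K [z cx]] := cell_cover hT x; exists (K, z).
pose v x := \sum_j bar (c x).1 (x - int_vec (c x).2) ord0 j * u (row j (c x).1).
have vE x K z : in_cell T x K z -> v x = \sum_j bar K (x - int_vec z) ord0 j * u (row j K).
  by move=> cx; exact: (cell_value pu (hc x) cx).
have vrow K j : K \in T -> v (row j K) = u (row j K).
  move=> KT; have indK := mesh_independent hT KT; rewrite (vE _ K 0).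
    rewrite int_vec0 subr0 bar_row// (bigD1 j)//= mxE !eqxx mul1r big1 ?addr0// => i ij.
    by rewrite mxE (negbTE ij) andbF mul0r.
  split=> // i; rewrite int_vec0 subr0.
  by move: i; apply/(closed_simplexP indK); exact: closed_simplex_row.
exists v; split=> //; apply: (pl_Vh hT); split.
  move=> x w; have [KT c0] := hc x.
  rewrite [RHS](vE x _ _ (hc x)) (vE _ (c x).1 ((c x).2 + w)).
    by rewrite int_vecD opprD addrA addrAC addrK.
  by split=> // j; rewrite int_vecD opprD addrA addrAC addrK.
move=> K x KT c0; rewrite (vE x K 0); last by split=> // j; rewrite int_vec0 subr0.
by rewrite int_vec0 subr0; apply: eq_bigr => j _; rewrite vrow.
Qed.

Lemma pl_eq v w : pl T v -> pl T w ->
  (forall K j, K \in T -> v (row j K) = w (row j K)) -> v = w.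
Proof.
move=> plv plw vw; apply/funext => x; have [K [z cx]] := cell_cover hT x.
rewrite (pl_cell plv cx) (pl_cell plw cx); apply: eq_bigr => j _.
by rewrite vw//; case: cx.
Qed.

Lemma Vh_eq v w : Vh T v -> Vh T w ->
  (forall K j, K \in T -> v (row j K) = w (row j K)) -> v = w.
Proof. by move=> /(Vh_pl hT) ? /(Vh_pl hT) ?; exact: pl_eq. Qed.

Lemma interp_eq u v : Vh T v -> (forall K j, K \in T -> v (row j K) = u (row j K)) ->
  interp T u = v.
Proof.
move=> Vv vu; rewrite /interp; case: xgetP => [w _ [Vw wu]|/(_ v)[]//].
by apply: Vh_eq => // K j KT; rewrite wu// vu.
Qed.

Lemma interpP u : Defs.periodic u ->
  Vh T (interp T u) /\ forall K j, K \in T -> interp T u (row j K) = u (row j K).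
Proof. by move=> /interpolant_exists[v [Vv vu]]; rewrite (interp_eq Vv vu). Qed.

Lemma interp_Vh v : Vh T v -> interp T v = v.
Proof. by move=> Vv; apply: interp_eq. Qed.

Lemma Vh_cst c : Vh T (cst c).
Proof.
apply: (pl_Vh hT); split=> // K x KT _.
by rewrite -mulr_suml bar_sum ?mul1r//; exact: (mesh_independent hT KT).
Qed.

Lemma VhD v w : Vh T v -> Vh T w -> Vh T (fun x => v x + w x).
Proof.
move=> /(Vh_pl hT)[pv hv] /(Vh_pl hT)[pw hw]; apply: (pl_Vh hT); split.
  by move=> x z; rewrite pv pw.
by move=> K x KT c0; rewrite (hv K)// (hw K)// -big_split; apply: eq_bigr => j _; rewrite mulrDr.
Qed.

Lemma VhZ c v : Vh T v -> Vh T (fun x => c * v x).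
Proof.
move=> /(Vh_pl hT)[pv hv]; apply: (pl_Vh hT); split.
  by move=> x z; rewrite pv.
by move=> K x KT c0; rewrite (hv K)// mulr_sumr; apply: eq_bigr => j _; rewrite mulrCA.
Qed.

Lemma VhB v w : Vh T v -> Vh T w -> Vh T (fun x => v x - w x).
Proof.
move=> Vv Vw; have := VhD Vv (VhZ (-1) Vw); congr Vh.
by apply/funext => x; rewrite mulN1r.
Qed.

Lemma Vh_sum (I : Type) (s : seq I) (f : I -> 'rV[R]_d -> R) :
  (forall i, Vh T (f i)) -> Vh T (fun x => \sum_(i <- s) f i x).
Proof.
move=> Vf; elim: s => [|i s IH].
  by under eq_fun do rewrite big_nil; exact: Vh_cst.
by under eq_fun do rewrite big_cons; exact: VhD.
Qed.

Lemma Vh_continuous v : Vh T v -> continuous v. Proof. by case. Qed.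

Lemma Vh_periodic v : Vh T v -> Defs.periodic v. Proof. by case. Qed.

Lemma Vh_bmeas v : Vh T v -> bmeas v.
Proof.
move=> Vv; apply/bmeasP; split; first by apply: continuous_measurable_rV; exact: Vh_continuous.
exact: (pl_bounded hT (Vh_pl hT Vv)).
Qed.

Lemma Vh_ge0 v : Vh T v -> (forall K j, K \in T -> 0 <= v (row j K)) -> forall x, 0 <= v x.
Proof.
move=> /(Vh_pl hT) plv v0 x; have [K [z cx]] := cell_cover hT x.
rewrite (pl_cell plv cx) sumr_ge0// => j _; have [KT c0] := cx.
by rewrite mulr_ge0// v0.
Qed.

End interpolation.

Section nodes.
Context {R : realType} {d : nat}.
Implicit Types (x y : 'rV[R]_d) (u v : 'rV[R]_d -> R).

(* Identifies the vertices that differ by a lattice vector. *)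
Definition frac x : 'rV[R]_d := x - int_vec (\row_i Num.floor (x ord0 i)).

Lemma fracP u x : Defs.periodic u -> u (frac x) = u x.
Proof. by move=> pu; rewrite periodicB. Qed.

Lemma frac_int x z : frac (x + int_vec z) = frac x.
Proof.
apply/rowP => i; rewrite /frac !mxE floorDrz ?intrKfloor ?intrD; last exact: intr_int.
by ring.
Qed.

Definition nodes (T : seq (simplex R d)) : seq 'rV[R]_d :=
  undup [seq frac (row j K) | K <- T, j <- enum 'I_d.+1].

Definition hat T r : 'rV[R]_d -> R := interp T (fun x => (frac x == r)%:R).

(** The diagonal entry of the lumped mass matrix. *)
Definition wt T r : R := mean (hat T r).

Variables (h : R) (T : seq (simplex R d)).
Hypothesis hT : torus_partition h T.

Lemma node_frac K j : K \in T -> frac (row j K) \in nodes T.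
Proof.
by move=> KT; rewrite mem_undup; apply/allpairsP; exists (K, j); rewrite /= mem_enum.
Qed.

Lemma nodeP r : r \in nodes T -> exists K j, K \in T /\ r = frac (row j K).
Proof. by rewrite mem_undup => /allpairsP[[K j] /= [KT _ ->]]; exists K, j. Qed.

Lemma hatP r : Vh T (hat T r) /\
  forall K j, K \in T -> hat T r (row j K) = (frac (row j K) == r)%:R.
Proof. by apply: (interpP hT) => x z; rewrite frac_int. Qed.

Lemma hat_Vh r : Vh T (hat T r). Proof. by have [] := hatP r. Qed.

Lemma hat_node r s : s \in nodes T -> hat T r s = (s == r)%:R.
Proof.
move=> /nodeP[K [j [KT ->]]]; rewrite fracP; first by have [_ ->] := hatP r.
exact: (Vh_periodic (hat_Vh r)).
Qed.

Lemma hat_ge0 r x : 0 <= hat T r x.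
Proof.
apply: (Vh_ge0 hT (hat_Vh r)) => K j KT; have [_ ->//] := hatP r.
Qed.

Lemma sum_node (f : 'rV[R]_d -> R) K j : K \in T ->
  \sum_(r <- nodes T) f r * (frac (row j K) == r)%:R = f (frac (row j K)).
Proof.
move=> KT; rewrite (bigD1_seq (frac (row j K))) ?node_frac ?undup_uniq//= eqxx mulr1.
by rewrite big1 ?addr0// => r /negbTE; rewrite eq_sym => ->; rewrite mulr0.
Qed.

Lemma interp_hat u : Defs.periodic u ->
  interp T u = fun x => \sum_(r <- nodes T) u r * hat T r x.
Proof.
move=> pu; apply: (interp_eq hT).
  by apply: (Vh_sum hT) => r; apply: (VhZ hT); exact: hat_Vh.
move=> K j KT; under eq_bigr => r _ do have [_ ->//] := hatP r.
by rewrite sum_node// fracP.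
Qed.

Lemma Vh_hat v : Vh T v -> v = fun x => \sum_(r <- nodes T) v r * hat T r x.
Proof.
by move=> Vv; rewrite -{1}(interp_Vh hT Vv) interp_hat//; exact: Vh_periodic Vv.
Qed.

Lemma hat_sum x : \sum_(r <- nodes T) hat T r x = 1.
Proof.
have := congr1 (fun v => v x) (Vh_hat (Vh_cst hT 1)) => /= h1.
by rewrite [RHS]h1; apply: eq_bigr => r _; rewrite mul1r.
Qed.

Lemma hat_bmeas r : bmeas (hat T r). Proof. exact: Vh_bmeas hT _ (hat_Vh r). Qed.

(** A null mean would force the continuous non-negative hat function to vanish everywhere, although
    it is 1 at its node. *)
Lemma wt_gt0 r : r \in nodes T -> 0 < wt T r.
Proof.
move=> rN; rewrite lt_neqAle; apply/andP; split; last by apply: mean_ge0 => x; exact: hat_ge0.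
apply/eqP => /esym w0.
have := @mean0_continuous R d (hat T r) (Vh_continuous (hat_Vh r)) (Vh_periodic (hat_Vh r))
  (hat_bmeas r) (hat_ge0 r) w0 r.
by rewrite hat_node// eqxx => /eqP; rewrite oner_eq0.
Qed.

Lemma wt_ge0 r : 0 <= wt T r.
Proof. by apply: mean_ge0 => x; exact: hat_ge0. Qed.

Lemma wt_sum : \sum_(r <- nodes T) wt T r = 1.
Proof.
rewrite -mean_sum; last by move=> r; exact: hat_bmeas.
by rewrite -[RHS](@mean_cst R d); congr mean; apply/funext => x; rewrite hat_sum.
Qed.

Lemma mean_interp u : Defs.periodic u ->
  mean (interp T u) = \sum_(r <- nodes T) wt T r * u r.
Proof.
move=> pu; rewrite interp_hat// mean_sum; last by move=> r; apply: bmeasZ; exact: hat_bmeas.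
apply: eq_bigr => r _; rewrite meanZ; last exact: hat_bmeas.
exact: mulrC.
Qed.

Lemma mean_Vh v : Vh T v -> mean v = \sum_(r <- nodes T) wt T r * v r.
Proof. by move=> Vv; rewrite -{1}(interp_Vh hT Vv) mean_interp//; exact: Vh_periodic Vv. Qed.

Lemma iphE u v : Defs.periodic u -> Defs.periodic v ->
  iph T u v = \sum_(r <- nodes T) wt T r * (u r * v r).
Proof. by move=> pu pv; rewrite /iph mean_interp// => x z; rewrite pu pv. Qed.

End nodes.

(** * The piecewise constant gradient *)

Section gradient.
Context {R : realType} {d : nat}.
Variables (h : R) (T : seq (simplex R d)).
Hypothesis hT : torus_partition h T.
Hypothesis d_gt0 : (0 < d)%N.
Implicit Types (K : simplex R d) (x y : 'rV[R]_d) (u v w : 'rV[R]_d -> R).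
Local Notation mu := (@cube_measure R d).
Local Notation e_ i := (delta_mx ord0 i : 'rV[R]_d).

Definition cells K : set 'rV[R]_d := \bigcup_z translate z (open_simplex K).

Definition cell_ind K x : R := \1_(cells K) x.

Lemma cellsP K x : K \in T -> cells K x <-> exists z, forall j, 0 < bar K (x - int_vec z) ord0 j.
Proof.
move=> /(mesh_independent hT) indK; split=> [[z _ /translateP/(open_simplexP indK)]|[z hz]].
  by exists z.
by exists z => //; apply/translateP/open_simplexP.
Qed.

Lemma cells_in_cell K x : K \in T -> cells K x ->
  exists2 z, in_cell T x K z & forall j, 0 < bar K (x - int_vec z) ord0 j.
Proof. by move=> KT /cellsP[//|z hz]; exists z => //; split=> // j; exact/ltW. Qed.

Lemma cells_int K x z : cells K (x + int_vec z) <-> cells K x.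
Proof.
have H y (w : 'rV[int]_d) : cells K y -> cells K (y + int_vec w).
  move=> [z' _ /translateP h']; exists (z' + w) => //; apply/translateP.
  by rewrite int_vecD opprD addrACA subrr addr0.
split; last exact: H.
by move=> /H -/(_ (- z)); rewrite int_vecN addrK.
Qed.

Lemma cell_ind_periodic K : Defs.periodic (cell_ind K).
Proof.
move=> x z; rewrite /cell_ind !indicE; congr (_%:R); congr nat_of_bool.
by apply/idP/idP; rewrite !inE => /cells_int.
Qed.

Lemma cells_disjoint K K' x : K \in T -> K' \in T -> cells K x -> cells K' x -> K = K'.
Proof.
move=> KT KT' [z _ /translateP xz] [z' _ /translateP xz'].
have [_ /(_ K K' (z' - z) KT KT') H _ _] := hT.
apply: (H _).1; exists (x - int_vec z); split=> //; apply/translateP.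
by rewrite int_vecD int_vecN opprB addrA subrK.
Qed.

Lemma bar_near K x z j : 0 < bar K (x - int_vec z) ord0 j ->
  exists2 r, 0 < r & forall y, l1 (y - x) < r -> 0 < bar K (y - int_vec z) ord0 j.
Proof.
move=> b0; have s0 : 0 < slope_bd K + 1 by rewrite ltr_wpDl// slope_bd_ge0.
exists (bar K (x - int_vec z) ord0 j / (slope_bd K + 1)); first by rewrite divr_gt0.
move=> y; rewrite ltr_pdivlMr// mulrDr mulr1 mulrC => hy.
have := bar_lip K x y z j; rewrite ler_norml => /andP[+ _].
by have := l1_ge0 (y - x); lra.
Qed.

Lemma cells_near K x z : (forall j, 0 < bar K (x - int_vec z) ord0 j) ->
  exists2 r, 0 < r & forall y, l1 (y - x) < r -> forall j, 0 < bar K (y - int_vec z) ord0 j.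
Proof.
move=> b0; have [r r0 hr] := @l1_all_seq R d _ (enum 'I_d.+1) x
  (fun j y => 0 < bar K (y - int_vec z) ord0 j) (fun j _ => bar_near (b0 j)).
by exists r => // y /hr H j; apply: H; rewrite mem_enum.
Qed.

Lemma cells_open K : K \in T -> open (cells K).
Proof.
move=> KT; rewrite openE => x /cellsP[//|z hz].
have [r r0 hr] := cells_near hz; have [s s0 hs] := l1_ball x r0.
by apply/nbhs_ballP; exists s => //= y /hs /hr hy; apply/cellsP => //; exists z.
Qed.

Lemma cell_ind_bmeas K : K \in T -> bmeas (cell_ind K).
Proof.
move=> KT; apply/bmeasP; split.
  by apply: measurable_indic; apply: open_measurable_rV; exact: cells_open.
by exists 1 => x; rewrite /cell_ind indicE; case: (_ \in _); rewrite ?normr1 ?normr0.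
Qed.

(** The coordinate is 1 at its own vertex and 0 at another one, which exists since [d] is
    positive. *)
Lemma bar_slope_neq0 K j : K \in T -> exists i, bar_slope K i j != 0.
Proof.
move=> KT; have indK := mesh_independent hT KT; apply: contrapT => H.
have s0 i : bar_slope K i j = 0 by apply: contrapT => /eqP si; apply: H; exists i.
have [j' jj'] : exists j' : 'I_d.+1, j' != j.
  have [->|j0] := eqVneq j ord0; first by exists (inord 1); rewrite -val_eqE /= inordK.
  by exists ord0; rewrite eq_sym.
have := bar_subE K (row j K) (row j' K) j; rewrite big1; last by move=> i _; rewrite s0 mulr0.
by rewrite !bar_row// !mxE !eqxx/= eq_sym (negbTE jj') subr0 => /eqP; rewrite oner_eq0.
Qed.

(** A point in no open cell lies in some closed one with a vanishing coordinate, so the exceptional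
    set is covered by countably many hyperplanes. *)
Lemma cells_ae : {ae mu, forall x, exists2 K, K \in T & cells K x}.
Proof.
pose H (p : 'I_(size T) * ('I_d.+1 * 'rV[int]_d)) : set 'rV[R]_d :=
  [set x | bar (nth (nth 0 T 0) T p.1) (x - int_vec p.2.2) ord0 p.2.1 = 0].
suff nH : mu.-negligible (\bigcup_p H p).
  apply: negligibleS nH => x /= nx.
  have [K [z [KT c0]]] := cell_cover hT x.
  have [j hj] : exists j, bar K (x - int_vec z) ord0 j = 0.
    apply: contrapT => hn; apply: nx; exists K => //; apply/cellsP => //; exists z => j.
    rewrite lt_neqAle c0 andbT eq_sym; apply/eqP => bj; apply: hn; by exists j.
  have iK : (index K T < size T)%N by rewrite index_mem.
  by exists (Ordinal iK, (j, z)) => //; rewrite /H/= nth_index.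
apply: negligible_countable => -[i [j z]].
set K := nth (nth 0 T 0) T i; have KT : K \in T by rewrite /K mem_nth.
have [i0 hi0] := bar_slope_neq0 j KT.
pose a : 'rV[R]_d := \row_i bar_slope K i j.
have a0 : a != 0.
  by apply/eqP => /rowP/(_ i0); rewrite !mxE => /eqP; rewrite (negbTE hi0).
pose c := - (bar K (0 - int_vec z) ord0 j).
have HE : H (i, (j, z)) = [set x | \sum_i a ord0 i * x ord0 i = c].
  have E x : bar K (x - int_vec z) ord0 j = \sum_i a ord0 i * x ord0 i - c.
    rewrite /c opprK; apply/eqP; rewrite -subr_eq bar_subE; apply/eqP.
    by apply: eq_bigr => l _; rewrite !mxE mulrC; congr (_ * _); ring.
  apply/seteqP; split=> x; rewrite /H /mkset/= -/K E => /eqP; first by rewrite subr_eq0 => /eqP.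
  by rewrite -subr_eq0 => /eqP.
rewrite HE; apply/negligibleP; last exact: hyperplane_null.
suff mf : measurable_fun setT (fun x : 'rV[R]_d => \sum_i a ord0 i * x ord0 i).
  rewrite -[X in measurable X]setTI; exact: (mf measurableT [set c]).
by apply: measurable_sum => l; apply: measurable_funM => //; exact: measurable_coord.
Qed.

Definition slope i K v : R := \sum_j bar_slope K i j * v (row j K).

(** A bounded measurable representative of the partial derivative, defined everywhere with value 0
    on the mesh skeleton. Unlike [partial], it is linear in [v] at every point without any
    differentiability assumption. *)
Definition gr i v x : R := \sum_(K <- undup T) slope i K v * cell_ind K x.

Lemma sum_cell_ind (f : simplex R d -> R) K x : K \in T -> cells K x ->
  \sum_(K' <- undup T) f K' * cell_ind K' x = f K.
Proof.
move=> KT cK; rewrite (bigD1_seq K) ?mem_undup ?undup_uniq//= /cell_ind indicE mem_set// mulr1.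
rewrite big_seq_cond big1 ?addr0// => K' /andP[]; rewrite mem_undup => KT' KK'.
rewrite indicE memNset ?mulr0// => cK'; move/eqP: KK'; apply.
exact: cells_disjoint cK' cK.
Qed.

Lemma gr_cell i v K x : K \in T -> cells K x -> gr i v x = slope i K v.
Proof. exact: sum_cell_ind (fun K => slope i K v) K x. Qed.

Lemma gr_bmeas i v : bmeas (gr i v).
Proof.
rewrite /gr; have : {subset undup T <= T} by move=> K; rewrite mem_undup.
elim: (undup T) => [|K s IH] sT.
  by under eq_fun do rewrite big_nil; exact: bmeas_cst.
under eq_fun do rewrite big_cons; apply: bmeasD.
  by apply: bmeasZ; apply: cell_ind_bmeas; apply: sT; rewrite mem_head.
by apply: IH => L Ls; apply: sT; rewrite inE Ls orbT.
Qed.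

Lemma grD i u v x : gr i (fun y => u y + v y) x = gr i u x + gr i v x.
Proof.
rewrite /gr -big_split/=; apply: eq_bigr => K _; rewrite -mulrDl; congr (_ * _).
by rewrite /slope -big_split/=; apply: eq_bigr => j _; rewrite mulrDr.
Qed.

Lemma grZ i c v x : gr i (fun y => c * v y) x = c * gr i v x.
Proof.
rewrite /gr mulr_sumr; apply: eq_bigr => K _; rewrite mulrA; congr (_ * _).
by rewrite /slope mulr_sumr; apply: eq_bigr => j _; rewrite mulrCA.
Qed.

Lemma cell_affine v i K x : Vh T v -> K \in T -> cells K x ->
  exists2 r, 0 < r & forall t, `|t| < r -> v (x + t *: e_ i) = v x + t * slope i K v.
Proof.
move=> /(Vh_pl hT) plv KT /cells_in_cell[//|z cx hz].
have [r r0 hr] := cells_near hz; exists r => // t tr.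
have lt1 : l1 (x + t *: e_ i - x) = `|t|.
  rewrite addrAC subrr add0r /l1 (bigD1 i)//= !mxE !eqxx mulr1 big1 ?addr0// => l li.
  by rewrite !mxE (negbTE li) andbF mulr0 normr0.
have cy : in_cell T (x + t *: e_ i) K z.
  by split=> // j; apply/ltW/hr; rewrite lt1.
have sE j : bar K (x + t *: e_ i - int_vec z) ord0 j - bar K (x - int_vec z) ord0 j =
    t * bar_slope K i j.
  rewrite bar_subE (bigD1 i)//= big1 ?addr0 => [|l li]; rewrite !mxE.
    by rewrite !eqxx/=; congr (_ * _); ring.
  by rewrite (negbTE li) andbF mulr0 addr0 subrr mul0r.
rewrite (pl_cell plv cx) (pl_cell plv cy) /slope mulr_sumr -big_split/=.
by apply: eq_bigr => j _; rewrite mulrA -sE; ring.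
Qed.

Lemma partial_cell v i K x : Vh T v -> K \in T -> cells K x -> partial i v x = slope i K v.
Proof.
move=> Vv KT cx; have [r r0 hr] := cell_affine i Vv KT cx.
rewrite /partial /derive; apply: cvg_lim => //; apply: cvg_near_cst.
apply/nbhs_ballP; exists r => //= t /=.
rewrite /ball/= sub0r normrN => tr t0; rewrite /shift/= (addrC (t *: _)) hr// addrAC subrr add0r.
by rewrite scalerA mulVf// scale1r.
Qed.

Lemma partial_ae v i : Vh T v -> {ae mu, forall x, partial i v x = gr i v x}.
Proof.
move=> Vv; apply: filterS cells_ae => x [K KT cx].
by rewrite (partial_cell i Vv KT cx) (gr_cell i v KT cx).
Qed.

Lemma L2ip_partialE i u w : Vh T u -> L2ip (partial i u) w = mean (fun x => gr i u x * w x).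
Proof. by move=> Vu; apply: mean_ae_eq; apply: filterS (partial_ae i Vu) => x ->. Qed.

Lemma grad_ipE u v : Vh T u -> Vh T v ->
  grad_ip u v = \sum_i mean (fun x => gr i u x * gr i v x).
Proof.
move=> Vu Vv; apply: eq_bigr => i _; rewrite L2ip_partialE//; apply: mean_ae_eq.
by apply: filterS (partial_ae i Vv) => x ->.
Qed.

End gradient.

(* The set of t in [a, b] where the estimate holds from a contains its supremum, and
   cannot stop before b. *)
Lemma lipschitz_of_local {R : realType} (f : R -> R) (L : R) :
  (forall t, exists2 r, 0 < r & forall s, `|s - t| < r -> `|f s - f t| <= L * `|s - t|) ->
  forall a b, `|f b - f a| <= L * `|b - a|.
Proof.
move=> lf; suff H a b : a <= b -> `|f b - f a| <= L * (b - a).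
  move=> a b; have [ab|/ltW ba] := leP a b; first by rewrite [X in L * X]ger0_norm ?subr_ge0 ?H.
  by rewrite distrC (distrC b) [X in L * X]ger0_norm ?subr_ge0 ?H.
move=> ab; pose S := [set t | a <= t <= b /\ `|f t - f a| <= L * (t - a)].
have Sa : S a by split; rewrite ?lexx ?ab// !subrr normr0 mulr0.
have hS : has_sup S by split; [exists a|exists b => t [/andP[]]].
pose c := sup S.
have ac : a <= c by apply: ub_le_sup => //; case: hS.
have cb : c <= b by apply: ge_sup => [|t [/andP[]]//]; exists a.
have [r r0 hr] := lf c.
have Sc : `|f c - f a| <= L * (c - a).
  have [t St ct] := sup_adherent r0 hS.
  have tc : t <= c by apply: ub_le_sup => //; case: hS.
  have [_ h1] := St.
  have h2 : `|f t - f c| <= L * (c - t).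
    have := hr t; rewrite ler0_norm ?subr_le0// opprB; apply.
    by rewrite ltrBlDr addrC -ltrBlDr.
  rewrite (_ : f c - f a = - (f t - f c) + (f t - f a)); last by ring.
  rewrite (le_trans (ler_normD _ _))// normrN.
  by rewrite (_ : L * (c - a) = L * (c - t) + L * (t - a)) ?lerD//; ring.
have [<-//|cb'] := eqVneq c b.
have {cb'}cb' : c < b by rewrite lt_neqAle cb' cb.
pose t := Num.min b (c + r / 2).
have ct : c < t by rewrite lt_min cb' ltrDl divr_gt0.
have tr : t - c < r.
  rewrite ltrBlDl; apply: (@le_lt_trans _ _ (c + r / 2)); first by rewrite ge_min lexx orbT.
  by rewrite ltrD2l ltr_pdivrMr// ltr_pMr// ltr1n.
have St : S t.
  split; first by rewrite (le_trans ac (ltW ct)) ge_min lexx.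
  have := hr t; rewrite ger0_norm ?subr_ge0 ?(ltW ct)// => /(_ tr) h2.
  rewrite (_ : f t - f a = (f t - f c) + (f c - f a)); last by ring.
  rewrite (le_trans (ler_normD _ _))//.
  by rewrite (_ : L * (t - a) = L * (t - c) + L * (c - a)) ?lerD//; ring.
have : t <= c by apply: ub_le_sup => //; case: hS.
by rewrite leNgt ct.
Qed.

Lemma sqr_sum_le {R : realFieldType} n (f : 'I_n -> R) :
  (\sum_k f k) ^+ 2 <= n%:R * \sum_k f k ^+ 2.
Proof.
case: n f => [|n] f; first by rewrite !big_ord0 expr0n mulr0.
set S := \sum_k f k; have n0 : (0 : R) < n.+1%:R by rewrite ltr0n.
have : 0 <= \sum_k (f k - S / n.+1%:R) ^+ 2 by apply: sumr_ge0 => k _; exact: sqr_ge0.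
under eq_bigr do rewrite sqrrB.
rewrite big_split/= sumrB sumr_const card_ord.
have -> : \sum_(i < n.+1) f i * (S / n.+1%:R) *+ 2 = 2 * (S ^+ 2 / n.+1%:R).
  by rewrite sumrMnl -mulr_suml -/S; field; rewrite gt_eqF.
rewrite -[X in _ + X]mulr_natl (_ : n.+1%:R * (S / n.+1%:R) ^+ 2 = S ^+ 2 / n.+1%:R); last first.
  by field; rewrite gt_eqF.
move: (\sum_(i < n.+1) f i ^+ 2) => Q.
rewrite -ler_pdivrMl// [n.+1%:R^-1 * _]mulrC; move: (S ^+ 2 / n.+1%:R) => q; lra.
Qed.

Section gradient_calculus.
Context {R : realType} {d : nat}.
Variables (h : R) (T : seq (simplex R d)).
Hypothesis hT : torus_partition h T.
Hypothesis d_gt0 : (0 < d)%N.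
Implicit Types (K : simplex R d) (x y : 'rV[R]_d) (u v w : 'rV[R]_d -> R).
Local Notation mu := (@cube_measure R d).
Local Notation e_ i := (delta_mx ord0 i : 'rV[R]_d).
Local Notation gr := (gr T).

Lemma l1_dir x (t : R) i : l1 (x + t *: e_ i - x) = `|t|.
Proof.
rewrite addrAC subrr add0r /l1 (bigD1 i)//= !mxE !eqxx mulr1 big1 ?addr0// => l li.
by rewrite !mxE (negbTE li) andbF mulr0 normr0.
Qed.

Lemma Vh_lip_dir v : Vh T v -> exists2 L : R, 0 <= L &
  forall x i t, `|v (x + t *: e_ i) - v x| <= L * `|t|.
Proof.
move=> /(Vh_pl hT) /(pl_lip_at hT)[L L0 hL]; exists L => // x i t.
have := @lipschitz_of_local R (fun s => v (x + s *: e_ i)) L _ 0 t.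
rewrite scale0r addr0 subr0; apply => s.
have [r r0 hr] := hL (x + s *: e_ i); exists r => // s' hs'.
have E : x + s' *: e_ i = x + s *: e_ i + (s' - s) *: e_ i.
  by rewrite -addrA -scalerDl (addrC s) subrK.
have := hr (x + s' *: e_ i); rewrite E l1_dir; exact.
Qed.

Definition dq i (t : R) v x := t^-1 * (v (x + t *: e_ i) - v x).

Lemma dq_bmeas i t v : bmeas v -> bmeas (dq i t v).
Proof. by move=> bv; apply: bmeasZ; apply: bmeasB => //; exact: bmeas_shift. Qed.

Lemma dq_cvg i v (t : nat -> R) : Vh T v -> (forall n, t n != 0) -> t n @[n --> \oo] --> (0 : R) ->
  {ae mu, forall x, dq i (t n) v x @[n --> \oo] --> gr i v x}.
Proof.
move=> Vv t0 tc; apply: filterS (cells_ae hT d_gt0) => x [K KT cx].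
rewrite (gr_cell hT i v KT cx).
have [r r0 hr] := cell_affine hT i Vv KT cx.
apply: cvg_near_cst.
move/cvgr_dist_lt : tc => /(_ r r0); apply: filterS => n /=; rewrite sub0r normrN => tr.
by rewrite /dq hr// addrAC subrr add0r mulKf.
Qed.

Lemma mean_dq_cvg i v w (t : nat -> R) : Vh T v -> bmeas w -> (forall n, t n != 0) ->
  t n @[n --> \oo] --> (0 : R) ->
  mean (fun x => dq i (t n) v x * w x) @[n --> \oo] --> mean (fun x => gr i v x * w x).
Proof.
move=> Vv bw t0 tc; have [L L0 hL] := Vh_lip_dir Vv.
have bv := Vh_bmeas hT Vv.
have /bmeasP[_ [M hM]] := bw.
apply: (@mean_cvg R d _ _ (L * M)).
- by move=> n; apply: bmeas_measurable; apply: bmeasM => //; exact: dq_bmeas.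
- by apply: bmeasM => //; exact: (gr_bmeas hT).
- move=> n x; rewrite normrM ler_pM// /dq normrM normfV.
  by rewrite mulrC ler_pdivrMr ?normr_gt0// hL.
- apply: filterS (@dq_cvg i _ _ Vv t0 tc) => x hx; apply: cvgM => //; exact: cvg_cst.
Qed.

Lemma mean_dq2_cvg i v (t : nat -> R) : Vh T v -> (forall n, t n != 0) ->
  t n @[n --> \oo] --> (0 : R) ->
  mean (fun x => dq i (t n) v x ^+ 2) @[n --> \oo] --> mean (fun x => gr i v x ^+ 2).
Proof.
move=> Vv t0 tc; have [L L0 hL] := Vh_lip_dir Vv.
have bv := Vh_bmeas hT Vv.
apply: (@mean_cvg R d _ _ (L ^+ 2)).
- by move=> n; apply: bmeas_measurable; apply: bmeasX; exact: dq_bmeas.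
- by apply: bmeasX; exact: (gr_bmeas hT).
- move=> n x; rewrite normrX lerXn2r ?nnegrE// /dq normrM normfV.
  by rewrite mulrC ler_pdivrMr ?normr_gt0// hL.
- by apply: filterS (@dq_cvg i _ _ Vv t0 tc) => x hx; apply: cvgM.
Qed.

(** For difference quotients the identity is exact by translation invariance, with step [t] on one
    side and [- t] on the other; the uniform Lipschitz bound lets dominated convergence pass to the
    limit. *)
Lemma gr_ibp i u v : Vh T u -> Vh T v ->
  mean (fun x => gr i u x * v x) = - mean (fun x => gr i v x * u x).
Proof.
move=> Vu Vv; have bu := Vh_bmeas hT Vu; have bv := Vh_bmeas hT Vv.
pose t n : R := n.+1%:R^-1.
have t0 n : t n != 0 by rewrite invr_eq0 pnatr_eq0.
have tc : t n @[n --> \oo] --> (0 : R) by exact: cvg_harmonic.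
have nt0 n : - t n != 0 by rewrite oppr_eq0.
have ntc : - t n @[n --> \oo] --> (0 : R) by rewrite -oppr0; exact: cvgN.
have h1 := @mean_dq_cvg i _ _ _ Vu bv t0 tc.
have h2 := @mean_dq_cvg i _ _ _ Vv bu nt0 ntc.
have E n : mean (fun x => dq i (t n) u x * v x) = - mean (fun x => dq i (- t n) v x * u x).
  pose s := t n.
  have bs c w : bmeas w -> bmeas (fun x => w (x + c)) by exact: bmeas_shift.
  have -> : (fun x => dq i s u x * v x) = (fun x => s^-1 * (u (x + s *: e_ i) * v x - u x * v x)).
    by apply/funext => x; rewrite /dq; ring.
  have -> : (fun x => dq i (- s) v x * u x) =
      (fun x => - s^-1 * (v (x + - s *: e_ i) * u x - v x * u x)).
    by apply/funext => x; rewrite /dq invrN; ring.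
  have b1 := bmeasM (bs (s *: e_ i) u bu) bv.
  have b2 := bmeasM (bs (- s *: e_ i) v bv) bu.
  have b3 := bmeasM bu bv; have b4 := bmeasM bv bu.
  rewrite !meanZ ?meanB//; [|exact: bmeasB|exact: bmeasB].
  have -> : mean (fun x => u (x + s *: e_ i) * v x) = mean (fun x => v (x + - s *: e_ i) * u x).
    rewrite -(@mean_shift R d (fun x => v (x + - s *: e_ i) * u x) (s *: e_ i))//.
      by congr mean; apply/funext => x; rewrite scaleNr addrK mulrC.
    move=> x z; rewrite (addrAC x) (Vh_periodic Vv) (Vh_periodic Vu); exact: erefl.
  have -> : (fun x => u x * v x) = (fun x => v x * u x) by apply/funext => x; rewrite mulrC.
  by ring.
have h3 : mean (fun x => dq i (t n) u x * v x) @[n --> \oo] --> - mean (fun x => gr i v x * u x).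
  by under eq_fun do rewrite E; exact: cvgN.
exact: (cvg_unique _ h1 h3).
Qed.

(** The shift is cut into [n.+1] equal steps. Translation invariance gives them equal mean squares,
    Cauchy-Schwarz adds them up, and the difference quotients converge to the derivative as [n]
    grows. *)
Lemma shift_dir_L2 i v (s : R) : Vh T v ->
  mean (fun x => (v (x + s *: e_ i) - v x) ^+ 2) <= s ^+ 2 * mean (fun x => gr i v x ^+ 2).
Proof.
move=> Vv; have [->|s0] := eqVneq s 0.
  under eq_fun do rewrite scale0r addr0 subrr expr0n/=.
  by rewrite mean_cst expr0n mul0r.
have bv := Vh_bmeas hT Vv; have pv := Vh_periodic Vv.
pose t n : R := s / n.+1%:R.
have t0 n : t n != 0 by rewrite mulf_neq0// invr_eq0 pnatr_eq0.
have tc : t n @[n --> \oo] --> (0 : R).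
  by rewrite -(mulr0 s); apply: cvgM; [exact: cvg_cst|exact: cvg_harmonic].
have H n : mean (fun x => (v (x + s *: e_ i) - v x) ^+ 2) <=
    s ^+ 2 * mean (fun x => dq i (t n) v x ^+ 2).
  pose b (k : nat) x := (v (x + k.+1%:R * t n *: e_ i) - v (x + k%:R * t n *: e_ i)) ^+ 2.
  have bb k : bmeas (b k) by apply: bmeasX; apply: bmeasB; exact: bmeas_shift.
  have N0 : (n.+1%:R : R) != 0 by rewrite pnatr_eq0.
  have meanb k : mean (b k) = t n ^+ 2 * mean (fun x => dq i (t n) v x ^+ 2).
    rewrite -meanZ; last by apply: bmeasX; exact: dq_bmeas.
    rewrite -[RHS](@mean_shift R d _ (k%:R * t n *: e_ i)); last 2 first.
    - by apply: bmeasZ; apply: bmeasX; exact: dq_bmeas.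
    - by move=> x z; rewrite /dq (addrAC x) !pv.
    congr mean; apply/funext => x; rewrite /b /dq -[RHS]exprMn mulVKf//.
    by congr ((v _ - _) ^+ 2); rewrite -addrA -scalerDl -natr1 mulrDl mul1r.
  apply: (@le_trans _ _ (mean (fun x => n.+1%:R * \sum_(k < n.+1) b k x))).
    apply: mean_le.
    - by apply: bmeasX; apply: bmeasB => //; exact: bmeas_shift.
    - by apply: bmeasZ; exact: bmeas_sum.
    move=> x; pose c k := v (x + k%:R * t n *: e_ i).
    have -> : v (x + s *: e_ i) - v x = \sum_(k < n.+1) (c k.+1 - c k).
      rewrite -(big_mkord xpredT (fun k => c k.+1 - c k)) telescope_sumr// /c mul0r scale0r addr0.
      by rewrite /t mulrCA mulfV// mulr1.
    exact: sqr_sum_le.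
  rewrite meanZ; last exact: bmeas_sum.
  rewrite mean_sum//; under eq_bigr do rewrite meanb.
  rewrite sumr_const card_ord -[X in _ * X <= _]mulr_natl; move: (mean _) => m.
  by rewrite le_eqVlt; apply/orP; left; apply/eqP; rewrite /t; field.
have h2 := @mean_dq2_cvg i _ _ Vv t0 tc.
have h3 : s ^+ 2 * mean (fun x => dq i (t n) v x ^+ 2) @[n --> \oo] -->
    s ^+ 2 * mean (fun x => gr i v x ^+ 2) by apply: cvgM => //; exact: cvg_cst.
rewrite -(cvg_lim _ h3)//; apply: limr_ge; first by apply/cvg_ex; eexists; exact: h3.
exact: nearW.
Qed.

End gradient_calculus.

(** * The Poincare inequality on the torus *)

Section poincare.
Context {R : realType} {d : nat}.
Variables (h : R) (T : seq (simplex R d)).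
Hypothesis hT : torus_partition h T.
Hypothesis d_gt0 : (0 < d)%N.
Implicit Types (K : simplex R d) (x y : 'rV[R]_d) (u v w : 'rV[R]_d -> R).
Local Notation mu := (@cube_measure R d).
Local Notation e_ i := (delta_mx ord0 i : 'rV[R]_d).
Local Notation gr := (gr T).

Lemma grad_ip_ge0 u : 0 <= grad_ip u u :> R.
Proof. by apply: sumr_ge0 => i _; apply: mean_ge0 => x; rewrite -expr2 sqr_ge0. Qed.

Lemma grad_norm_sqr u : grad_norm u ^+ 2 = grad_ip u u :> R.
Proof. by rewrite sqr_sqrtr// grad_ip_ge0. Qed.

Lemma grad_ip_sqr v : Vh T v -> grad_ip v v = \sum_i mean (fun x => gr i v x ^+ 2).
Proof. by move=> Vv; rewrite (grad_ipE hT d_gt0 Vv Vv). Qed.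

(** Modulo the lattice each coordinate of the shift lies between 0 and 1. Moving one coordinate at a
    time produces [d] terms, hence the factor [d%:R] from Cauchy-Schwarz. *)
Lemma shift_L2 v y : Vh T v ->
  mean (fun x => (v (x + y) - v x) ^+ 2) <= d%:R * grad_ip v v.
Proof.
move=> Vv; have bv := Vh_bmeas hT Vv; have pv := Vh_periodic Vv.
pose c := frac y.
have c01 i : 0 <= c ord0 i <= 1.
  rewrite !mxE; have := floorD1_gt (y ord0 i); have := floor_le (y ord0 i).
  by rewrite intrD1; lra.
pose p (k : nat) : 'rV[R]_d := \row_i (if (i < k)%N then c ord0 i else 0).
have pS (k : 'I_d) : p k.+1 = p k + c ord0 k *: e_ k.
  apply/rowP => i; rewrite !mxE eqxx/= ltnS leq_eqVlt; have [->|ik] := eqVneq i k.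
    by rewrite eqxx ltnn mulr1 add0r.
  by rewrite -val_eqE/= in ik; rewrite (negbTE ik) mulr0 addr0.
have p0 : p 0%N = 0 by apply/rowP => i; rewrite !mxE.
have pd : p d = c by apply/rowP => i; rewrite !mxE ltn_ord.
pose b (k : 'I_d) x := (v (x + p k.+1) - v (x + p k)) ^+ 2.
have bb k : bmeas (b k) by apply: bmeasX; apply: bmeasB; exact: bmeas_shift.
have meanb k : mean (b k) <= mean (fun x => gr k v x ^+ 2).
  apply: (@le_trans _ _ (c ord0 k ^+ 2 * mean (fun x => gr k v x ^+ 2))); last first.
    apply: ler_piMl; first by apply: mean_ge0 => x; exact: sqr_ge0.
    by have /andP[c0 c1] := c01 k; rewrite expr_le1.
  apply: le_trans (shift_dir_L2 hT d_gt0 k (c ord0 k) Vv).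
  rewrite -[leRHS](@mean_shift R d _ (p k)); last 2 first.
  - by apply: bmeasX; apply: bmeasB => //; exact: bmeas_shift.
  - by move=> x z; rewrite (addrAC x) !pv.
  by rewrite le_eqVlt; apply/orP; left; apply/eqP; congr mean; apply/funext => x; rewrite /b pS addrA.
have -> : (fun x => (v (x + y) - v x) ^+ 2) = (fun x => (v (x + c) - v x) ^+ 2).
  by apply/funext => x; rewrite /c /frac addrA periodicB.
rewrite (grad_ip_sqr Vv); apply: (@le_trans _ _ (mean (fun x => d%:R * \sum_k b k x))).
  apply: mean_le.
  - by apply: bmeasX; apply: bmeasB => //; exact: bmeas_shift.
  - by apply: bmeasZ; exact: bmeas_sum.
  move=> x; have -> : v (x + c) - v x = \sum_(k < d) (v (x + p k.+1) - v (x + p k)).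
    rewrite -(big_mkord xpredT (fun k => v (x + p k.+1) - v (x + p k))) telescope_sumr//.
    by rewrite pd p0 addr0.
  exact: sqr_sum_le.
rewrite meanZ; last exact: bmeas_sum.
by rewrite mean_sum// ler_wpM2l//; apply: ler_sum => k _.
Qed.

Lemma mean_exchange (f : 'rV[R]_d -> 'rV[R]_d -> R) (M : R) :
  (forall x y, 0 <= f x y <= M) ->
  measurable_fun setT (fun p : 'rV[R]_d * 'rV[R]_d => f p.1 p.2) ->
  mean (fun x => mean (f x)) = mean (fun y => mean (f^~ y)).
Proof.
move=> f0 mf.
have f0e p : (0 <= (f p.1 p.2)%:E)%E by rewrite lee_fin; case/andP: (f0 p.1 p.2).
have mfE : measurable_fun setT (fun p : 'rV[R]_d * 'rV[R]_d => (f p.1 p.2)%:E).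
  exact/measurable_EFinP.
have b1 x : bmeas (f x).
  apply/bmeasP; split.
    by have := measurableT_comp mf (@pair1_measurable _ _ _ _ x); exact.
  by exists M => y; have /andP[h1 h2] := f0 x y; rewrite ger0_norm.
have b2 y : bmeas (f^~ y).
  apply/bmeasP; split.
    by have := measurableT_comp mf (@pair2_measurable _ _ _ _ y); exact.
  by exists M => x; have /andP[h1 h2] := f0 x y; rewrite ger0_norm.
have := @fubini_tonelli _ _ _ _ R mu mu _ mfE f0e.
rewrite /fubini_F /fubini_G => E.
rewrite {1}/mean {2}/mean /Rintegral; congr fine.
transitivity (\int[mu]_x \int[mu]_y (f x y)%:E)%E.
  by apply: eq_integral => x _; rewrite mean_EFin.
by rewrite E; apply: eq_integral => y _; rewrite mean_EFin.
Qed.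

Lemma mean_param_bmeas (f : 'rV[R]_d -> 'rV[R]_d -> R) (M : R) :
  (forall x y, 0 <= f x y <= M) ->
  measurable_fun setT (fun p : 'rV[R]_d * 'rV[R]_d => f p.1 p.2) ->
  bmeas (fun x => mean (f x)).
Proof.
move=> f0 mf.
have b1 x : bmeas (f x).
  apply/bmeasP; split.
    by have := measurableT_comp mf (@pair1_measurable _ _ _ _ x); exact.
  by exists M => y; have /andP[h1 h2] := f0 x y; rewrite ger0_norm.
apply/bmeasP; split; last first.
  exists M => x; rewrite ger0_norm; last by apply: mean_ge0 => y; case/andP: (f0 x y).
  rewrite -[leRHS](@mean_cst R d); apply: mean_le => //; first exact: bmeas_cst.
  by move=> y; case/andP: (f0 x y).
have f0e p : (0 <= (f p.1 p.2)%:E)%E by rewrite lee_fin; case/andP: (f0 p.1 p.2).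
have mfE : measurable_fun setT (fun p : 'rV[R]_d * 'rV[R]_d => (f p.1 p.2)%:E).
  exact/measurable_EFinP.
have mF := @measurable_fun_fubini_tonelli_F _ _ _ _ R mu _ mfE f0e.
apply/measurable_EFinP; suff -> : EFin \o (fun x => mean (f x)) =
  fubini_F mu (fun p : 'rV[R]_d * 'rV[R]_d => (f p.1 p.2)%:E) by [].
by apply/funext => x; rewrite /= mean_EFin.
Qed.

(** The double mean over [x] and [y] of [(v (x + y) - v x) ^+ 2] is twice the variance of [v], and
    for every fixed shift [y] the inner mean is bounded by [shift_L2]. *)
Lemma poincare v : Vh T v ->
  mean (fun x => (v x - mean v) ^+ 2) <= d%:R * grad_ip v v.
Proof.
move=> Vv; have bv := Vh_bmeas hT Vv; have pv := Vh_periodic Vv.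
have b2 := bmeasX 2 bv.
have /bmeasP[mv [M hM]] := bv.
have pv2 : Defs.periodic (fun x => v x ^+ 2) by move=> x z; rewrite pv.
pose f y x := (v (x + y) - v x) ^+ 2.
have f0 y x : 0 <= f y x <= (M + M) ^+ 2.
  rewrite sqr_ge0/= /f -real_normK ?num_real// lerXn2r ?nnegrE//.
    by rewrite (le_trans (normr_ge0 (v 0)))// (le_trans (hM 0))// lerDl (le_trans _ (hM 0)).
  by rewrite (le_trans (ler_normB _ _))// lerD.
have mf : measurable_fun setT (fun p : 'rV[R]_d * 'rV[R]_d => f p.1 p.2).
  apply: measurable_funX; apply: measurable_funB.
    apply: (measurableT_comp mv); apply: measurable_rV_fun => i.
    have -> : (fun p : 'rV[R]_d * 'rV[R]_d => (p.2 + p.1) ord0 i) =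
       (fun p => p.2 ord0 i + p.1 ord0 i) by apply/funext => p; rewrite !mxE.
    apply: measurable_funD.
      by apply: (measurableT_comp (measurable_coord i)); exact: measurable_snd.
    by apply: (measurableT_comp (measurable_coord i)); exact: measurable_fst.
  by apply: (measurableT_comp mv); exact: measurable_snd.
have ex := mean_exchange f0 mf.
have Vle : mean (fun y => mean (f y)) <= d%:R * grad_ip v v.
  rewrite -[leRHS](@mean_cst R d); apply: mean_le; [|exact: bmeas_cst|].
    exact: (mean_param_bmeas f0 mf).
  by move=> y; exact: shift_L2.
have E x : mean (f^~ x) = mean (fun y => v y ^+ 2) - 2 * mean v * v x + v x ^+ 2.
  have -> : f^~ x = fun y => v (y + x) ^+ 2 + ((- 2 * v x) * v (y + x) + v x ^+ 2).
    by apply/funext => y; rewrite /f (addrC y); ring.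
  have bs := bmeas_shift x bv; have bs2 := bmeas_shift x b2.
  rewrite meanD ?meanD ?meanZ; [|bmeas_tac..].
  by rewrite (mean_shift x b2 pv2) (mean_shift x bv pv) mean_cst; ring.
have V2 : mean (fun x => (v x - mean v) ^+ 2) = mean (fun x => v x ^+ 2) - mean v ^+ 2.
  have -> : (fun x => (v x - mean v) ^+ 2) = (fun x => v x ^+ 2 + ((- 2 * mean v) * v x + mean v ^+ 2)).
    by apply/funext => x; ring.
  by rewrite meanD ?meanD ?meanZ ?mean_cst; [ring|bmeas_tac..].
have F : mean (fun x => mean (f^~ x)) = 2 * mean (fun x => (v x - mean v) ^+ 2).
  rewrite V2; under eq_fun do rewrite E.
  by rewrite meanD ?meanB ?meanZ ?mean_cst; [ring|bmeas_tac..].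
have V0 : 0 <= mean (fun x => (v x - mean v) ^+ 2) by apply: mean_ge0 => x; exact: sqr_ge0.
by move: Vle; rewrite ex F; lra.
Qed.

End poincare.

(** * Comparison of the lumped and the exact L2 norm *)

Section mass_lumping.
Context {R : realType} {d : nat}.
Variables (h : R) (T : seq (simplex R d)).
Hypothesis hT : torus_partition h T.
Hypothesis d_gt0 : (0 < d)%N.
Implicit Types (K : simplex R d) (x y : 'rV[R]_d) (u v w : 'rV[R]_d -> R).
Local Notation mu := (@cube_measure R d).

Lemma mean_le_ae u v : bmeas u -> bmeas v -> {ae mu, forall x, u x <= v x} -> mean u <= mean v.
Proof.
move=> bu bv uv; rewrite -subr_ge0 -meanB//; apply: mean_ge0_ae.
by apply: filterS uv => x; rewrite subr_ge0.
Qed.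

Lemma bmeas_sum_in (I : eqType) (s : seq I) (f : I -> 'rV[R]_d -> R) :
  (forall i, i \in s -> bmeas (f i)) -> bmeas (fun x => \sum_(i <- s) f i x).
Proof.
elim: s => [_|i s IH bf]; first by under eq_fun do rewrite big_nil; exact: bmeas_cst.
under eq_fun do rewrite big_cons; apply: bmeasD; first by apply: bf; rewrite mem_head.
by apply: IH => j js; apply: bf; rewrite inE js orbT.
Qed.

Lemma mean_sum_in (I : eqType) (s : seq I) (f : I -> 'rV[R]_d -> R) :
  (forall i, i \in s -> bmeas (f i)) ->
  mean (fun x => \sum_(i <- s) f i x) = \sum_(i <- s) mean (f i).
Proof.
elim: s => [_|i s IH bf].
  by under eq_fun do rewrite big_nil; rewrite big_nil mean_cst.
under eq_fun do rewrite big_cons.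
have bs : forall j, j \in s -> bmeas (f j) by move=> j js; apply: bf; rewrite inE js orbT.
rewrite meanD ?IH ?big_cons//; last exact: bmeas_sum_in.
by apply: bf; rewrite mem_head.
Qed.

Definition cell_sq v K y := v y ^+ 2 * cell_ind K y.

Lemma cell_sq_bmeas v K : Vh T v -> K \in T -> bmeas (cell_sq v K).
Proof.
by move=> Vv KT; apply: bmeasM; [apply: bmeasX; exact: (Vh_bmeas hT Vv)|exact: (cell_ind_bmeas hT)].
Qed.

(* The homothety of ratio 1/4 about a vertex p where |v| is maximal maps the cell into a part of it
   where |v| >= |v p| / 2; the fourfold dilation preserves means of periodic functions. *)
Lemma cell_homothety v K j : Vh T v -> K \in T ->
  (forall l, `|v (row l K)| <= `|v (row j K)|) ->
  v (row j K) ^+ 2 * mean (cell_ind K) <= 4 ^+ d.+1 * mean (cell_sq v K).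
Proof.
move=> Vv KT jmax; have indK := mesh_independent hT KT.
have [pv plv] := Vh_pl hT Vv.
set p := row j K; set M := v p.
pose sh (c : {ffun 'I_d -> 'I_4}) : 'rV[R]_d := \row_i ((c i : nat)%:R / 4).
have bK := cell_ind_bmeas hT KT; have bw := cell_sq_bmeas Vv KT.
have pw : Defs.periodic (cell_sq v K) by move=> x z; rewrite /cell_sq pv cell_ind_periodic.
have w0 y : 0 <= cell_sq v K y by rewrite mulr_ge0 ?sqr_ge0// /cell_ind indicE.
have key x : M ^+ 2 / 4 * cell_ind K (3.+1%:R *: x + - (3 *: p)) <=
    \sum_c cell_sq v K (x + - sh c).
  rewrite {1}/cell_ind indicE; case: (boolP (_ \in _)) => [|_]; last first.
    by rewrite mulr0 sumr_ge0.
  rewrite inE => /(cellsP hT _ KT)[z hz]; rewrite mulr1.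
  set y := _ - int_vec z in hz.
  pose x' := 4^-1 *: y + (3 / 4) *: p.
  have e4 : 4^-1 + 3 / 4 = 1 :> R by field.
  have bx' l : bar K x' ord0 l = 4^-1 * bar K y ord0 l + 3 / 4 * bar K p ord0 l.
    by rewrite /x' bar_comb// !mxE.
  have bp l : 0 <= bar K p ord0 l by rewrite bar_row// mxE ler0n.
  have bx'0 l : 0 < bar K x' ord0 l.
    rewrite bx'; have := hz l; have := bp l; lra.
  have vp : M = \sum_l bar K p ord0 l * v (row l K) by apply: plv.
  have vy : v y = \sum_l bar K y ord0 l * v (row l K) by apply: plv => // l; exact/ltW.
  have vx' : v x' = 4^-1 * v y + 3 / 4 * M.
    rewrite (plv K x' KT) => [|l]; last exact/ltW.
    rewrite vy vp !mulr_sumr -big_split/=; apply: eq_bigr => l _; rewrite bx'; ring.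
  have vyM : `|v y| <= `|M|.
    rewrite vy (le_trans (ler_norm_sum _ _ _))//.
    apply: (@le_trans _ _ (\sum_l bar K y ord0 l * `|M|)).
      by apply: ler_sum => l _; rewrite normrM gtr0_norm ?ler_wpM2l// ltW.
    by rewrite -mulr_suml bar_sum// mul1r.
  have Mx' : M ^+ 2 / 4 <= v x' ^+ 2.
    have h1 : `|M| / 2 <= `|v x'|.
      have -> : v x' = 3 / 4 * M - (- (4^-1 * v y)) by rewrite vx'; ring.
      apply: le_trans (lerB_normD _ _).
      have n1 : `|3 / 4| = 3 / 4 :> R by rewrite ger0_norm// divr_ge0.
      have n2 : `|4^-1| = 4^-1 :> R by rewrite ger0_norm.
      rewrite !normrN (normrM (3 / 4)) (normrM 4^-1) n1 n2; move: vyM.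
      by move: (`|v y|) (`|M|) => a b; lra.
    rewrite -(real_normK (num_real (v x'))) -(real_normK (num_real M)).
    rewrite (_ : `|M| ^+ 2 / 4 = (`|M| / 2) ^+ 2); last by field.
    by rewrite lerXn2r// nnegrE ?divr_ge0.
  (* The dilated point lies in the translate of the cell by [z]. Dividing by 4 turns [z] into an
     integral part [q], invisible to periodic functions, and a remainder in quarters; this is why
     the right-hand side sums over all quarter shifts [sh c]. *)
  pose c := [ffun i => inord (absz (z ord0 i %% 4)%Z) : 'I_4].
  pose q : 'rV[int]_d := \row_i (z ord0 i %/ 4)%Z.
  have xc : x + - sh c = x' + int_vec q.
    apply/rowP => i; rewrite !mxE ffunE.
    have m0 : (0 <= (z ord0 i %% 4)%Z)%R by exact: modz_ge0.
    have m4 : ((z ord0 i %% 4)%Z < 4)%R by exact: ltz_pmod.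
    rewrite inordK; last by lia.
    have -> : (absz (z ord0 i %% 4)%Z)%:R = (z ord0 i %% 4)%Z%:~R :> R.
      by rewrite -[in RHS](gez0_abs m0).
    have := divz_eq (z ord0 i) 4 => /(congr1 (fun t : int => t%:~R : R)).
    rewrite intrD intrM => E; move: E.
    change (z 0 i) with (z ord0 i).
    move: ((z ord0 i %/ 4)%Z%:~R) ((z ord0 i %% 4)%Z%:~R) ((z ord0 i)%:~R) => a b e ->.
    by field.
  apply: (@le_trans _ _ (cell_sq v K (x + - sh c))); last first.
    by rewrite (bigD1 c)//= lerDl sumr_ge0.
  rewrite xc pw /cell_sq /cell_ind indicE mem_set ?mulr1//.
  by apply/(cellsP hT _ KT); exists 0 => l; rewrite int_vec0 subr0.
have : mean (fun x => M ^+ 2 / 4 * cell_ind K (3.+1%:R *: x + - (3 *: p))) <=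
    mean (fun x => \sum_c cell_sq v K (x + - sh c)).
  apply: mean_le => //; first by apply: bmeasZ; exact: bmeas_aff.
  by apply: bmeas_sum => c; exact: bmeas_shift.
rewrite meanZ; last exact: bmeas_aff.
rewrite (mean_aff 3 _ bK (cell_ind_periodic K)).
rewrite mean_sum => [|c]; last exact: bmeas_shift.
under eq_bigr do rewrite mean_shift//.
rewrite sumr_const card_ffun !card_ord -[X in _ <= X]mulr_natl natrX [4 ^+ d.+1]exprS.
move: (mean (cell_sq v K)) (mean (cell_ind K)) (4%:R ^+ d : R) (M ^+ 2) => a b c m.
by rewrite -mulrA; lra.
Qed.

(** On a cell the interpolant of the square is at most the largest nodal square, and the homothety
    argument compares this with the integral of the square over the cell. The constant depends on
    [d] alone, hence not on [h]. *)
Lemma lump_le_L2 v : Vh T v -> iph T v v <= 4 ^+ d.+1 * mean (fun x => v x ^+ 2).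
Proof.
move=> Vv; have pv := Vh_periodic Vv; have plv := Vh_pl hT Vv; have bv := Vh_bmeas hT Vv.
have /choice[j hj] : forall K, exists j, forall l, `|v (row l K)| <= `|v (row j K)|.
  move=> K; exists [arg max_(l > ord0) `|v (row l K)|]%O.
  by case: arg_maxP => // l _ hl i; exact: hl.
have [Vi hi] : Vh T (interp T (fun x => v x * v x)) /\ forall K j, K \in T ->
    interp T (fun x => v x * v x) (row j K) = v (row j K) * v (row j K).
  by apply: (interpP hT) => x z; rewrite pv.
have bK K : K \in undup T -> bmeas (cell_ind K).
  by rewrite mem_undup; exact: (cell_ind_bmeas hT).
have bw K : K \in undup T -> bmeas (cell_sq v K).
  by rewrite mem_undup; exact: cell_sq_bmeas.
apply: (@le_trans _ _ (mean (fun x => \sum_(K <- undup T) v (row (j K) K) ^+ 2 * cell_ind K x))).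
  apply: mean_le_ae; first exact: (Vh_bmeas hT Vi).
    by apply: bmeas_sum_in => K KT; apply: bmeasZ; exact: bK.
  apply: filterS (cells_ae hT d_gt0) => x [K KT cx].
  rewrite (sum_cell_ind hT (fun K => v (row (j K) K) ^+ 2) KT cx).
  have [z cz _] := cells_in_cell hT KT cx; have [_ c0] := cz.
  rewrite (pl_cell (Vh_pl hT Vi) cz).
  apply: (@le_trans _ _ (\sum_l bar K (x - int_vec z) ord0 l * v (row (j K) K) ^+ 2)); last first.
    by rewrite -mulr_suml bar_sum ?mul1r//; exact: (mesh_independent hT KT).
  apply: ler_sum => l _; rewrite hi// ler_wpM2l// -expr2.
  by rewrite -(real_normK (num_real (v (row l K)))) -(real_normK (num_real (v (row (j K) K))))
    lerXn2r// nnegrE.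
rewrite mean_sum_in => [|K KT]; last by apply: bmeasZ; exact: bK.
apply: (@le_trans _ _ (\sum_(K <- undup T) 4 ^+ d.+1 * mean (cell_sq v K))).
  rewrite big_seq [leRHS]big_seq; apply: ler_sum => K KT; rewrite meanZ; last exact: bK.
  by move: KT; rewrite mem_undup => KT; exact: cell_homothety.
rewrite -mulr_sumr -mean_sum_in// ler_wpM2l ?exprn_ge0//.
rewrite le_eqVlt; apply/orP; left; apply/eqP; apply: mean_ae_eq.
apply: filterS (cells_ae hT d_gt0) => x [K KT cx].
exact: (sum_cell_ind hT (fun=> v x ^+ 2) KT cx).
Qed.

End mass_lumping.

(** * The discrete inverse Laplacian and the L2 projection *)

Section discrete_operators.
Context {R : realType} {d : nat}.
Variables (h : R) (T : seq (simplex R d)).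
Hypothesis hT : torus_partition h T.
Hypothesis d_gt0 : (0 < d)%N.
Implicit Types (K : simplex R d) (x y : 'rV[R]_d) (u v w phi : 'rV[R]_d -> R).
Local Notation gr := (gr T).

Definition symmetric_form (B : ('rV[R]_d -> R) -> ('rV[R]_d -> R) -> R) :=
  (forall c u v w, Vh T u -> Vh T v -> Vh T w ->
    B (fun x => c * u x + v x) w = c * B u w + B v w) /\
  (forall u v, Vh T u -> Vh T v -> B u v = B v u).

Lemma form_sum B (I : Type) (s : seq I) (c : I -> R) (f : I -> 'rV[R]_d -> R) w :
  symmetric_form B -> (forall i, Vh T (f i)) -> Vh T w ->
  B (fun x => \sum_(i <- s) c i * f i x) w = \sum_(i <- s) c i * B (f i) w.
Proof.
move=> [Bl _] Vf Vw; elim: s => [|i s IH].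
  under eq_fun do rewrite big_nil; rewrite big_nil.
  have := Bl (-1) _ _ w (Vh_cst hT 0) (Vh_cst hT 0) Vw.
  rewrite (_ : (fun x => -1 * cst 0 x + cst 0 x) = cst 0); last first.
    by apply/funext => x; rewrite /= mulr0 addr0.
  by rewrite mulN1r addNr.
under eq_fun do rewrite big_cons; rewrite big_cons.
by rewrite Bl ?IH//; apply: (Vh_sum hT) => j; exact: (VhZ hT).
Qed.

(** In the hat functions the form has a Gram matrix, which definiteness makes injective and hence
    invertible. The functional on the right is prescribed by its values [l] on the hat functions. *)
Lemma form_solve B (l : 'rV[R]_d -> R) : symmetric_form B ->
  (forall v, Vh T v -> B v v = 0 -> v = cst 0) ->
  exists2 v, Vh T v & forall phi, Vh T phi ->
    B v phi = \sum_(r <- nodes T) phi r * l r.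
Proof.
move=> sB B0; pose n := size (nodes T); pose nd (i : 'I_n) := nth 0 (nodes T) i.
have ndN i : nd i \in nodes T by exact: mem_nth.
have sumE (f : 'rV[R]_d -> R) : \sum_(r <- nodes T) f r = \sum_i f (nd i).
  by rewrite (big_nth 0) big_mkord.
have Vhat r := hat_Vh hT r.
pose M : 'M[R]_n := \matrix_(i, j) B (hat T (nd i)) (hat T (nd j)).
pose V (a : 'rV[R]_n) x := \sum_i a ord0 i * hat T (nd i) x.
have VV a : Vh T (V a) by apply: (Vh_sum hT) => i; exact: (VhZ hT).
have VM a j : (a *m M) ord0 j = B (V a) (hat T (nd j)).
  by rewrite /V form_sum// mxE; apply: eq_bigr => i _; rewrite mxE.
have Bphi v phi : Vh T v -> Vh T phi -> B v phi = \sum_i phi (nd i) * B v (hat T (nd i)).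
  move=> Vv Vp; have [_ Bs] := sB; rewrite Bs// {1}(Vh_hat hT Vp).
  by rewrite form_sum// sumE; apply: eq_bigr => i _; rewrite Bs.
have Mu : M \in unitmx.
  rewrite -row_free_unit; apply: inj_row_free => a aM.
  have := B0 _ (VV a); rewrite Bphi// big1 => [/(_ erefl) V0|i _]; last first.
    by rewrite -VM aM mxE mulr0.
  apply/rowP => i; rewrite mxE; have := congr1 (fun f => f (nd i)) V0.
  rewrite /V (bigD1 i)//= (hat_node hT)// eqxx mulr1 big1 ?addr0// => j ji.
  rewrite (hat_node hT)// [nd i == _](_ : _ = false) ?mulr0//.
  by apply/negbTE; rewrite nth_uniq ?undup_uniq// eq_sym.
exists (V ((\row_i l (nd i)) *m invmx M)) => // phi Vp.
rewrite Bphi// sumE; apply: eq_bigr => i _; congr (_ * _).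
by rewrite -VM mulmxKV// mxE.
Qed.

Lemma grad_ip_cst v c : grad_ip v (cst c) = 0 :> R.
Proof.
rewrite /grad_ip big1// => i _; rewrite /L2ip -[RHS](@mean_cst R d).
congr Rintegral; apply/funext => x.
by rewrite /partial (_ : cst c = fun=> c)// derive_cst mulr0.
Qed.

Lemma grad_ip_form : symmetric_form (@grad_ip R d).
Proof.
split=> [c u v w Vu Vv Vw|u v Vu Vv]; last first.
  rewrite !(grad_ipE hT d_gt0)//; apply: eq_bigr => i _; congr mean.
  by apply/funext => x; rewrite mulrC.
rewrite !(grad_ipE hT d_gt0)//; last by apply: (VhD hT) => //; exact: (VhZ hT).
rewrite mulr_sumr -big_split/=; apply: eq_bigr => i _.
have bg w' : bmeas (gr i w') by exact: (gr_bmeas hT).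
transitivity (mean (fun x => c * (gr i u x * gr i w x) + gr i v x * gr i w x)).
  by congr mean; apply/funext => x; rewrite grD grZ; ring.
have b1 := bg u; have b2 := bg v; have b3 := bg w.
by rewrite meanD ?meanZ; [|bmeas_tac..].
Qed.

Lemma L2_form : symmetric_form (@L2ip R d).
Proof.
split=> [c u v w Vu Vv Vw|u v Vu Vv]; last first.
  by congr Rintegral; apply/funext => x; rewrite mulrC.
have bu := Vh_bmeas hT Vu; have bv := Vh_bmeas hT Vv; have bw := Vh_bmeas hT Vw.
have -> : L2ip (fun x => c * u x + v x) w = mean (fun x => c * (u x * w x) + v x * w x).
  by congr Rintegral; apply/funext => x; ring.
by rewrite meanD ?meanZ//; [exact: bmeasM|apply: bmeasZ; exact: bmeasM|exact: bmeasM].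
Qed.

Lemma meanZD c u v : Vh T u -> Vh T v -> mean (fun x => c * u x + v x) = c * mean u + mean v.
Proof.
move=> /(Vh_bmeas hT) bu /(Vh_bmeas hT) bv.
by rewrite meanD ?meanZ//; exact: bmeasZ.
Qed.

Lemma Vh_L2_eq0 v : Vh T v -> mean (fun x => v x ^+ 2) = 0 -> v = cst 0.
Proof.
move=> Vv v0; apply/funext => x; apply/eqP; rewrite -sqrf_eq0; apply/eqP.
apply: (@mean0_continuous R d (fun x => v x ^+ 2)) => //.
- move=> y; apply: (@cvg_comp _ _ _ v (fun t => t ^+ 2) _ (nbhs (v y))).
    exact: (Vh_continuous Vv).
  exact: exprn_continuous.
- by move=> y z; rewrite (Vh_periodic Vv).
- by apply: bmeasX; exact: (Vh_bmeas hT Vv).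
- by move=> y; exact: sqr_ge0.
Qed.

Lemma grad0_mean0 v : Vh T v -> grad_ip v v = 0 -> mean v = 0 -> v = cst 0.
Proof.
move=> Vv g0 m0; apply: Vh_L2_eq0 => //; apply/eqP; rewrite eq_le; apply/andP; split; last first.
  by apply: mean_ge0 => x; exact: sqr_ge0.
have := poincare hT d_gt0 Vv; rewrite g0 mulr0 m0.
by under eq_fun do rewrite subr0.
Qed.

Lemma iph_sum u phi : Defs.periodic u -> Vh T phi ->
  iph T u phi = \sum_(r <- nodes T) phi r * iph T u (hat T r).
Proof.
move=> pu Vp; rewrite (iphE hT)//; last exact: (Vh_periodic Vp).
rewrite [LHS]big_seq [RHS]big_seq; apply: eq_bigr => r rN.
rewrite (iphE hT)//; last exact: (Vh_periodic (hat_Vh hT r)).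
rewrite (bigD1_seq r) ?undup_uniq//= (hat_node hT)// eqxx mulr1.
rewrite big_seq_cond big1 => [|s /andP[sN sr]]; last by rewrite (hat_node hT)// (negbTE sr) !mulr0.
by ring.
Qed.

Lemma inv_lap_unique u v : Vh T v -> mean v = 0 ->
  (forall phi, Vh T phi -> grad_ip v phi = iph T u phi) -> inv_lap T u = v.
Proof.
move=> Vv mv hv; rewrite /inv_lap; case: xgetP => [w _ [Vw mw hw]|/(_ v)[]//].
have VB := VhB hT Vw Vv.
have wv : (fun x => w x - v x) = (fun x => -1 * v x + w x).
  by apply/funext => x; rewrite mulN1r addrC.
suff : (fun x => w x - v x) = cst 0.
  by move=> E; apply/funext => x; apply/eqP; rewrite -subr_eq0 [w x - v x](congr1 (@^~ x) E).
have [gl gs] := grad_ip_form.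
apply: grad0_mean0 => //.
  by rewrite {1}wv gl// hv// hw//; ring.
by rewrite wv meanZD// mv mw mulr0 addr0.
Qed.

(** The gradient form is only semidefinite, with the constants in its kernel. Adding the product of
    the means makes it definite; testing with 1 then shows that the solution has mean 0, so the
    added term disappears. *)
Lemma inv_lapP u : Defs.periodic u -> mean (interp T u) = 0 ->
  [/\ Vh T (inv_lap T u), mean (inv_lap T u) = 0
    & forall phi, Vh T phi -> grad_ip (inv_lap T u) phi = iph T u phi].
Proof.
move=> pu mu0; have [gl gs] := grad_ip_form.
have [|v Vv|v Vv hv] := @form_solve (fun u v => grad_ip u v + mean u * mean v)
    (fun r => iph T u (hat T r)).
- split=> [c a b w Va Vb Vw|a b Va Vb]; first last.
    by rewrite (gs a b Va Vb) [X in _ + X]mulrC.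
  rewrite (gl c a b w Va Vb Vw) (meanZD c Va Vb).
  move: (grad_ip a w) (grad_ip b w) (mean a) (mean b) (mean w) => g1 g2 m1 m2 m3.
  by ring.
- move=> h0; have g0 := grad_ip_ge0 v; have m0 : 0 <= mean v * mean v by rewrite -expr2 sqr_ge0.
  apply: grad0_mean0 => //; first by lra.
  by apply/eqP; rewrite -sqrf_eq0 expr2; apply/eqP; lra.
have {}hv phi : Vh T phi -> grad_ip v phi + mean v * mean phi = iph T u phi.
  by move=> Vp; rewrite hv// [RHS]iph_sum.
have mv : mean v = 0.
  have := hv _ (Vh_cst hT 1); rewrite grad_ip_cst add0r mean_cst mulr1 => ->.
  by rewrite -[RHS]mu0 /iph; congr (mean (interp T _)); apply/funext => x; rewrite mulr1.
have -> : inv_lap T u = v.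
  by apply: inv_lap_unique => // phi Vp; rewrite -hv// mv mul0r addr0.
by split=> // phi Vp; rewrite -hv// mv mul0r addr0.
Qed.

Lemma L2_projP u : bmeas u -> [/\ Vh T (L2_proj T u), mean (L2_proj T u) = mean u
  & mean (fun x => L2_proj T u x ^+ 2) <= mean (fun x => u x ^+ 2)].
Proof.
move=> bu; have bh r := hat_bmeas hT r.
have [v Vv hv] : exists2 v, Vh T v & forall phi, Vh T phi -> L2ip v phi = L2ip u phi.
  have [|v Vv hv] := @form_solve (@L2ip R d) (fun r => L2ip u (hat T r)) L2_form.
    by move=> v Vv v0; apply: Vh_L2_eq0.
  exists v => // phi Vp; rewrite hv//.
  have -> : L2ip u phi = mean (fun x => \sum_(r <- nodes T) phi r * (u x * hat T r x)).
    congr Rintegral; apply/funext => x; rewrite {1}(Vh_hat hT Vp) mulr_sumr.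
    by apply: eq_bigr => r _; rewrite mulrCA.
  rewrite mean_sum => [|r]; last by apply: bmeasZ; exact: bmeasM.
  by apply: eq_bigr => r _; rewrite meanZ//; exact: bmeasM.
have [w [Vw hw] ->] : exists2 w, Vh T w /\ (forall phi, Vh T phi -> L2ip w phi = L2ip u phi)
    & L2_proj T u = w.
  by rewrite /L2_proj; case: xgetP => [w _ ww|/(_ v)[]//]; exists w.
have bw := Vh_bmeas hT Vw; split=> //.
  have := hw _ (Vh_cst hT 1); rewrite /L2ip.
  rewrite (_ : (fun x => w x * cst 1 x) = w); last by apply/funext => x; rewrite /= mulr1.
  by rewrite (_ : (fun x => u x * cst 1 x) = u)//; apply/funext => x; rewrite /= mulr1.
have E : mean (fun x => w x ^+ 2) = mean (fun x => u x * w x).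
  by have := hw _ Vw; rewrite /L2ip; under eq_fun do rewrite -expr2.
have : 0 <= mean (fun x => (u x - w x) ^+ 2) by apply: mean_ge0 => x; exact: sqr_ge0.
have -> : (fun x => (u x - w x) ^+ 2) = (fun x => u x ^+ 2 + w x ^+ 2 - 2 * (u x * w x)).
  by apply/funext => x; ring.
rewrite meanB ?meanD ?meanZ -?E; [lra|bmeas_tac..].
Qed.

Lemma L2ipE u v : L2ip u v = mean (fun x => u x * v x).
Proof. by []. Qed.

(** The projection sees its argument only through integrals, so a datum bounded almost everywhere
    may be replaced by its truncation. *)
Lemma L2_proj_ae u v : {ae @cube_measure R d, forall x, u x = v x} -> L2_proj T u = L2_proj T v.
Proof.
move=> uv; have E phi : L2ip u phi = L2ip v phi.
  by apply: mean_ae_eq; apply: filterS uv => x ->.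
rewrite /L2_proj; congr (xget _ _); apply/seteqP; split=> w [Vw hw]; split=> // phi Vp.
  by rewrite -E hw.
by rewrite E hw.
Qed.

End discrete_operators.

(** * The scheme *)

Section regularised_potential.
Context {R : realType}.
Implicit Types (r s t x y delta : R).

Definition pos_part t : R := Num.max 0 t.

Lemma pos_part_ge0 t : 0 <= pos_part t. Proof. by rewrite le_max lexx. Qed.

Lemma pos_partE t : 0 <= t -> pos_part t = t. Proof. exact: max_r. Qed.

Lemma pos_part0 t : t <= 0 -> pos_part t = 0. Proof. exact: max_l. Qed.

Lemma pos_part_le s t : s <= t -> pos_part s <= pos_part t.
Proof. by move=> st; rewrite /pos_part ge_max !le_max lexx st !orbT. Qed.

Lemma derive_quadratic (f : R -> R) (x l C : R) :
  (forall t, `|t| <= 1 -> `|f (x + t) - f x - l * t| <= C * t ^+ 2) -> is_derive x (1 : R) f l.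
Proof.
move=> H.
have cv : t^-1 *: ((f \o shift x) (t *: (1 : R)) - f x) @[t --> (0 : R)^'] --> l.
  apply/cvgrPdist_le => e e0.
  pose C' := `|C| + 1; have C'0 : 0 < C' by rewrite ltr_wpDl.
  have r0 : 0 < Num.min 1 (e / C') by rewrite lt_min ltr01 divr_gt0.
  apply/nbhs_ballP; exists (Num.min 1 (e / C')) => //= t.
  rewrite /ball/= sub0r normrN lt_min => /andP[t1 te] t0.
  have := H t (ltW t1).
  rewrite /shift/= [t *: _]mulr1 (addrC t x).
  rewrite (_ : l - t^-1 *: (f (x + t) - f x) = - t^-1 * (f (x + t) - f x - l * t)); last first.
    rewrite (_ : t^-1 *: (f (x + t) - f x) = t^-1 * (f (x + t) - f x))//.
    by move: (f (x + t)) (f x) => a b; field.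
  move=> h1; rewrite normrM normrN normfV ler_pdivrMl ?normr_gt0// (le_trans h1)//.
  rewrite -(real_normK (num_real t)) expr2 mulrA mulrC ler_wpM2l//.
  apply: (@le_trans _ _ (C' * `|t|)); last by rewrite mulrC -ler_pdivlMr// ltW.
  by rewrite ler_wpM2r// /C' (le_trans (ler_norm C))// lerDl.
by apply: DeriveDef; [apply/cvg_ex; exists l|exact: cvg_lim cv].
Qed.

(** A second-order remainder that holds across the kink at 0, so that [f_] is found in one
    computation instead of branch by branch. *)
Lemma pos_cube_quadratic x t : `|t| <= 1 ->
  `|pos_part (x + t) ^+ 3 - pos_part x ^+ 3 - 3 * pos_part x ^+ 2 * t| <=
  (4 * `|x| + 1) * t ^+ 2.
Proof.
move=> t1.
have [x0|/ltW x0] := leP 0 x; have [y0|/ltW y0] := leP 0 (x + t).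
- rewrite !pos_partE// (_ : _ - _ = t ^+ 2 * (3 * x + t)); last by ring.
  rewrite normrM normrX real_normK ?num_real// mulrC ler_wpM2r ?sqr_ge0//.
  rewrite (le_trans (ler_normD _ _))// lerD// normrM !ger0_norm//.
  by rewrite ler_wpM2r// ler_nat.
- rewrite (pos_part0 y0) !pos_partE// expr0n/= sub0r.
  have t0 : t <= 0 by lra.
  have xt : x <= - t by lra.
  rewrite (ger0_norm x0) (_ : _ - _ = x ^+ 2 * (- x - 3 * t)); last by ring.
  have E : 0 <= - x - 3 * t by lra.
  rewrite ger0_norm ?mulr_ge0 ?sqr_ge0//.
  have : 0 <= x * (- t - x) by rewrite mulr_ge0//; lra.
  nra.
- rewrite (pos_part0 x0) !pos_partE// (_ : _ - _ = (x + t) ^+ 3); last by ring.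
  have yt : x + t <= t by lra.
  have t0 : 0 <= t by lra.
  rewrite ger0_norm ?exprn_ge0//.
  have h1 : (x + t) ^+ 3 <= t ^+ 3 by rewrite lerXn2r.
  have t2 : t <= 1 by move: t1; rewrite ger0_norm.
  have h2 : t ^+ 3 <= t ^+ 2 by rewrite exprS ler_piMl ?sqr_ge0.
  rewrite (le_trans h1)// (le_trans h2)// ler_peMl ?sqr_ge0//.
  by rewrite lerDr mulr_ge0.
- rewrite !pos_part0// !expr0n/= mulr0 mul0r !subr0 normr0.
  by rewrite mulr_ge0 ?sqr_ge0// addr_ge0// mulr_ge0.
Qed.

(* On both branches, t = |r| - 1 and the pieces of F_ are differences of cubes of positive parts. *)
Definition cube_diff delta t := (pos_part t ^+ 3 - pos_part (t - delta) ^+ 3) / (6 * delta ^+ 2).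

(** The derivative of [cube_diff] in [t]. *)
Definition sqr_diff delta t := (pos_part t ^+ 2 - pos_part (t - delta) ^+ 2) / (2 * delta ^+ 2).

Lemma F_cube_diff delta r : 0 < delta -> F_ delta r = cube_diff delta (`|r| - 1).
Proof.
move=> d0; rewrite /F_ /cube_diff; have dn : delta != 0 by rewrite gt_eqF.
case: ifPn => [r1|]; first by rewrite !pos_part0 ?expr0n/= ?subrr ?mul0r//; lra.
rewrite -ltNge => r1; case: ifPn => [r2|].
  by rewrite pos_partE ?(@pos_part0 (_ - delta)) ?expr0n/= ?subr0//; lra.
rewrite -leNgt => r2; rewrite !pos_partE; [by field|lra|lra].
Qed.

(** At most one summand is non-zero. The absolute value disappears, so its kink at 0 causes no
    trouble in the derivative. *)
Lemma F_split delta r : 0 < delta -> F_ delta r = cube_diff delta (r - 1) + cube_diff delta (- r - 1).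
Proof.
move=> d0; have z t : t <= 0 -> cube_diff delta t = 0.
  by move=> t0; rewrite /cube_diff !pos_part0 ?subrr ?mul0r//; lra.
rewrite F_cube_diff//; have [r0|/ltW r0] := leP 0 r.
  by rewrite ger0_norm// (z (- r - 1)) ?addr0//; lra.
by rewrite ler0_norm// (z (r - 1)) ?add0r//; lra.
Qed.

Lemma f_E delta r : 0 < delta -> f_ delta r = sqr_diff delta (r - 1) - sqr_diff delta (- r - 1).
Proof.
move=> d0; have dn : delta != 0 by rewrite gt_eqF.
rewrite /f_ derive1E; apply: derive_val.
pose c := (6 * delta ^+ 2)^-1.
have c0 : 0 < c by rewrite invr_gt0 mulr_gt0// exprn_gt0.
pose x1 := r - 1; pose x2 := r - 1 - delta; pose x3 := - r - 1; pose x4 := - r - 1 - delta.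
apply: (@derive_quadratic _ _ _ (c * ((4 * `|x1| + 1) + (4 * `|x2| + 1) + (4 * `|x3| + 1) + (4 * `|x4| + 1)))).
move=> t t1; have nt1 : `|- t| <= 1 by rewrite normrN.
have H1 := pos_cube_quadratic x1 t1; have H2 := pos_cube_quadratic x2 t1.
have H3 := pos_cube_quadratic x3 nt1; have H4 := pos_cube_quadratic x4 nt1.
rewrite !F_split// /cube_diff /sqr_diff -/x1 -/x2 -/x3 -/x4.
have -> : r + t - 1 = x1 + t by rewrite /x1; ring.
have -> : x1 + t - delta = x2 + t by rewrite /x1 /x2; ring.
have -> : - (r + t) - 1 = x3 + - t by rewrite /x3; ring.
have -> : x3 + - t - delta = x4 + - t by rewrite /x3 /x4; ring.
move: H1 H2 H3 H4; rewrite sqrrN.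
move: (pos_part (x1 + t)) (pos_part (x2 + t)) (pos_part (x3 + - t)) (pos_part (x4 + - t)).
move: (pos_part x1) (pos_part x2) (pos_part x3) (pos_part x4) => p1 p2 p3 p4 q1 q2 q3 q4.
set A1 := _ - _ - _ * t => H1; set A2 := _ - _ - _ * t => H2.
set A3 := _ - _ - _ * - t => H3; set A4 := _ - _ - _ * - t => H4.
have -> : (q1 ^+ 3 - q2 ^+ 3) / (6 * delta ^+ 2) + (q3 ^+ 3 - q4 ^+ 3) / (6 * delta ^+ 2) -
  ((p1 ^+ 3 - p2 ^+ 3) / (6 * delta ^+ 2) + (p3 ^+ 3 - p4 ^+ 3) / (6 * delta ^+ 2)) -
  ((p1 ^+ 2 - p2 ^+ 2) / (2 * delta ^+ 2) - (p3 ^+ 2 - p4 ^+ 2) / (2 * delta ^+ 2)) * t =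
  c * (A1 - A2 + (A3 - A4)) by rewrite /A1 /A2 /A3 /A4 /c; field.
rewrite normrM (gtr0_norm c0) -mulrA ler_pM2l//.
have h1 := ler_normB A1 A2; have h2 := ler_normB A3 A4; have h3 := ler_normD (A1 - A2) (A3 - A4).
move: H1 H2 H3 H4 h1 h2 h3.
move: (`|A1|) (`|A2|) (`|A3|) (`|A4|) (`|A1 - A2|) (`|A3 - A4|) => a1 a2 a3 a4 a5 a6.
rewrite !mulrDl; move: (`|A1 - A2 + (A3 - A4)|) => a7; lra.
Qed.

Lemma sqr_den_ge0 delta n : 0 < delta -> 0 <= n%:R * delta ^+ 2.
Proof. by move=> d0; rewrite mulr_ge0// exprn_ge0// ltW. Qed.

Lemma cube_diff_ge0 delta t : 0 < delta -> 0 <= cube_diff delta t.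
Proof.
move=> d0; rewrite divr_ge0 ?subr_ge0 ?sqr_den_ge0//.
by rewrite lerXn2r ?nnegrE ?pos_part_ge0// pos_part_le//; lra.
Qed.

Lemma sqr_diff_ge0 delta t : 0 < delta -> 0 <= sqr_diff delta t.
Proof.
move=> d0; rewrite divr_ge0 ?subr_ge0 ?sqr_den_ge0//.
by rewrite lerXn2r ?nnegrE ?pos_part_ge0// pos_part_le//; lra.
Qed.

Lemma sqr_diff_le delta s t : 0 < delta -> s <= t -> sqr_diff delta s <= sqr_diff delta t.
Proof.
move=> d0 st; rewrite ler_wpM2r ?invr_ge0 ?sqr_den_ge0//.
have [t0|/ltW t0] := leP t 0.
  by rewrite !pos_part0//; lra.
have [s0|/ltW s0] := leP s 0.
  rewrite (pos_part0 s0) (@pos_part0 (s - delta)); last by lra.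
  rewrite subrr subr_ge0 lerXn2r ?nnegrE ?pos_part_ge0// pos_part_le//; lra.
rewrite (pos_partE t0) (pos_partE s0).
have [td|/ltW td] := leP (t - delta) 0.
  rewrite (pos_part0 td) (@pos_part0 (s - delta)) ?expr0n/= ?subr0; last by lra.
  by rewrite lerXn2r.
rewrite (pos_partE td); have [sd|/ltW sd] := leP (s - delta) 0.
  by rewrite (pos_part0 sd) expr0n/= subr0; nra.
rewrite (pos_partE sd); nra.
Qed.

Lemma cube_diff_le delta t : 0 < delta -> 0 <= t -> cube_diff delta t <= t * sqr_diff delta t.
Proof.
move=> d0 t0; have dn : delta != 0 by rewrite gt_eqF.
rewrite /cube_diff /sqr_diff (pos_partE t0).
set q := pos_part _; have q0 : 0 <= q := pos_part_ge0 _.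
have qt : q <= t by rewrite /q -[leRHS](pos_partE t0) pos_part_le//; lra.
rewrite -subr_ge0 [X in 0 <= X](_ : _ = (t - q) * (2 * t * (t + q) - q * q) / (6 * delta ^+ 2)); last by field.
by rewrite divr_ge0 ?sqr_den_ge0// mulr_ge0; nra.
Qed.

Lemma sqr_diff0 delta t : 0 < delta -> t <= 0 -> sqr_diff delta t = 0.
Proof. by move=> d0 t0; rewrite /sqr_diff !pos_part0 ?subrr ?mul0r//; lra. Qed.

Lemma cube_diff0 delta t : 0 < delta -> t <= 0 -> cube_diff delta t = 0.
Proof. by move=> d0 t0; rewrite /cube_diff !pos_part0 ?subrr ?mul0r//; lra. Qed.

Lemma F_ge0 delta r : 0 < delta -> 0 <= F_ delta r.
Proof. by move=> d0; rewrite F_cube_diff// cube_diff_ge0. Qed.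

(** The tangent inequality of a convex function that vanishes at [m]. Outside the interval from -1
    to 1, the distance from [r] to [m] is at least [|r| - 1], and [cube_diff_le] does the rest. *)
Lemma F_le_f delta r m : 0 < delta -> `|m| <= 1 -> F_ delta r <= f_ delta r * (r - m).
Proof.
move=> d0; rewrite ler_norml => /andP[m1 m2]; rewrite F_split// f_E//.
have [r1|/ltW r1] := leP r 1; last first.
  rewrite (@cube_diff0 _ (- r - 1)) ?(@sqr_diff0 _ (- r - 1)) ?addr0 ?subr0//; [|lra..].
  have r0 : 0 <= r - 1 by lra.
  rewrite (le_trans (cube_diff_le d0 r0))// mulrC ler_wpM2l ?sqr_diff_ge0//; lra.
rewrite (@cube_diff0 _ (r - 1)) ?(@sqr_diff0 _ (r - 1)) ?add0r ?sub0r//; [|lra..].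
have [r2|/ltW r2] := leP (- r - 1) 0; first by rewrite cube_diff0// sqr_diff0// oppr0 mul0r.
rewrite (le_trans (cube_diff_le d0 r2))// mulNr -mulrN mulrC ler_wpM2l ?sqr_diff_ge0//; lra.
Qed.

Lemma f_monotone delta r s : 0 < delta -> 0 <= (f_ delta r - f_ delta s) * (r - s).
Proof.
move=> d0; wlog rs : r s / r <= s => [H|].
  have [/H//|/ltW sr] := leP r s.
  by have := H s r sr; rewrite -(opprB (f_ delta r)) -(opprB r) mulrNN.
apply: mulr_le0; rewrite subr_le0// !f_E//.
by rewrite lerB ?sqr_diff_le//; lra.
Qed.

Lemma F_lower delta r : 0 < delta -> delta <= 1 / 8 -> 2 * r ^+ 2 - 5 <= F_ delta r.
Proof.
move=> d0 d8; have dn : delta != 0 by rewrite gt_eqF.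
rewrite F_cube_diff// -(real_normK (num_real r)); have := normr_ge0 r; move: (`|r|) => a a0.
(* [9 / 8] bounds [1 + delta]: up to it the left side is negative, beyond it only the quadratic
   branch occurs. *)
have [a1|/ltW a1] := leP a (9 / 8).
  by apply: (@le_trans _ _ 0); [nra|exact: cube_diff_ge0].
rewrite /cube_diff !pos_partE; [|lra..].
rewrite (_ : _ / _ = (a - 1 - delta / 2) ^+ 2 / (2 * delta) + delta / 24); last by field.
(* For [delta <= 1 / 8] the leading coefficient [1 / (2 * delta)] is at least 4, which exceeds the
   coefficient 2 on the left; the constant 5 pays for the shift of the parabola. *)
apply: (@le_trans _ _ (4 * (a - 1 - delta / 2) ^+ 2)).
  have h : 0 <= a - 1 - 1 / 16 by lra.
  have : (a - 1 - 1 / 16) ^+ 2 <= (a - 1 - delta / 2) ^+ 2 by rewrite lerXn2r ?nnegrE//; lra.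
  have := sqr_ge0 (a - 17 / 8); rewrite !expr2; nra.
rewrite -[leLHS]addr0 lerD//; last by lra.
rewrite mulrC ler_wpM2l ?sqr_ge0// -[leLHS]invrK lef_pV2 ?posrE ?invr_gt0 ?mulr_gt0//; lra.
Qed.

End regularised_potential.

Lemma quad_discr {R : realFieldType} (a b c : R) :
  0 <= a -> 0 <= c -> (forall s t, 0 <= s ^+ 2 * a + 2 * s * t * b + t ^+ 2 * c) -> b ^+ 2 <= a * c.
Proof.
move=> a0 c0 H; have [a_eq|a_neq] := eqVneq a 0.
  suff -> : b = 0 by rewrite expr0n mulr_ge0// a_eq.
  apply/eqP/negPn/negP => b0.
  have := H (- (c + 1) / (2 * b)) 1; rewrite a_eq mulr0 add0r expr1n mul1r mulr1.
  rewrite (_ : 2 * (- (c + 1) / (2 * b)) * b = - (c + 1)); last by field.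
  by lra.
have a_gt0 : 0 < a by rewrite lt_neqAle eq_sym a_neq.
have := H (- b) a.
rewrite (_ : _ + _ = a * (a * c - b ^+ 2)); last by ring.
by rewrite pmulr_rge0// subr_ge0.
Qed.

Section lumped_product.
Context {R : realType} {d : nat}.
Variables (h : R) (T : seq (simplex R d)).
Hypothesis hT : torus_partition h T.
Hypothesis d_gt0 : (0 < d)%N.
Implicit Types (K : simplex R d) (x y : 'rV[R]_d) (u v w phi : 'rV[R]_d -> R).
Local Notation gr := (gr T).

Lemma iph_linear (c : R) u v w : Defs.periodic u -> Defs.periodic v -> Defs.periodic w ->
  iph T (fun x => c * u x + v x) w = c * iph T u w + iph T v w.
Proof.
move=> pu pv pw; have pl : Defs.periodic (fun x => c * u x + v x) by move=> x z; rewrite pu pv.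
rewrite !(iphE hT)// mulr_sumr -big_split/=; apply: eq_bigr => r _.
move: (wt T r) (u r) (v r) (w r) => a b e f; ring.
Qed.

Lemma iphC u v : iph T u v = iph T v u.
Proof. by rewrite /iph; under eq_fun do rewrite mulrC. Qed.

Lemma iph_ge0 u : Defs.periodic u -> 0 <= iph T u u.
Proof.
move=> pu; rewrite (iphE hT)//; apply: sumr_ge0 => r _.
by rewrite mulr_ge0 ?(wt_ge0 hT)// -expr2 sqr_ge0.
Qed.

Lemma iph_cst u c : Vh T u -> iph T u (cst c) = c * mean u.
Proof.
move=> Vu; rewrite (iphE hT (Vh_periodic Vu))// (mean_Vh hT Vu) mulr_sumr.
by apply: eq_bigr => r _; move: (wt T r) (u r) => a b /=; ring.
Qed.

Lemma iph_cauchy u v : Defs.periodic u -> Defs.periodic v ->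
  iph T u v ^+ 2 <= iph T u u * iph T v v.
Proof.
move=> pu pv; apply: quad_discr; rewrite ?iph_ge0// => s t.
have pw : Defs.periodic (fun x => s * u x + t * v x) by move=> x z; rewrite pu pv.
have := iph_ge0 pw; congr (0 <= _); rewrite !(iphE hT)// !mulr_sumr -!big_split/=.
apply: eq_bigr => r _; move: (wt T r) (u r) (v r) => a b e; ring.
Qed.

(** Pointwise Jensen: the values of the hat functions at a point are weights with sum 1, so the
    square of the interpolated value is at most the interpolated square. *)
Lemma L2_le_lump v : Vh T v -> mean (fun x => v x ^+ 2) <= iph T v v.
Proof.
move=> Vv; rewrite (iphE hT)//; try exact: (Vh_periodic Vv).
have bh r := hat_bmeas hT r.
apply: (@le_trans _ _ (mean (fun x => \sum_(r <- nodes T) v r ^+ 2 * hat T r x))); last first.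
  rewrite mean_sum => [|r]; last exact: bmeasZ.
  by apply: ler_sum => r _; rewrite meanZ// mulrC expr2.
apply: mean_le.
- by apply: bmeasX; exact: (Vh_bmeas hT Vv).
- by apply: bmeas_sum => r; exact: bmeasZ.
move=> x; have h1 := hat_sum hT x; set m := v x.
have h2 : m = \sum_(r <- nodes T) v r * hat T r x by rewrite /m {1}(Vh_hat hT Vv).
have : 0 <= \sum_(r <- nodes T) (v r - m) ^+ 2 * hat T r x.
  by apply: sumr_ge0 => r _; rewrite mulr_ge0 ?sqr_ge0 ?(hat_ge0 hT).
have -> : \sum_(r <- nodes T) (v r - m) ^+ 2 * hat T r x =
    \sum_(r <- nodes T) v r ^+ 2 * hat T r x - 2 * m * (\sum_(r <- nodes T) v r * hat T r x)
    + m ^+ 2 * \sum_(r <- nodes T) hat T r x.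
  rewrite !mulr_sumr -sumrB -big_split/=; apply: eq_bigr => r _; ring.
by rewrite h1 -h2; move: (\sum_(r <- nodes T) _) => S; rewrite !expr2; lra.
Qed.

Lemma iph_sub u v m : Vh T u -> mean u = m -> Vh T v ->
  iph T (fun x => u x - m) v = iph T u v - m * mean v.
Proof.
move=> Vu mu Vv.
have -> : (fun x => u x - m) = (fun x => - m * cst 1 x + u x).
  by apply/funext => x; rewrite mulr1 addrC.
rewrite iph_linear//; [|exact: (Vh_periodic Vu)|exact: (Vh_periodic Vv)].
by rewrite iphC iph_cst// mul1r mulNr addrC.
Qed.

End lumped_product.

(* Unification would otherwise compare distinct discrete inner products by unfolding integrals. *)
#[global] Opaque mean L2ip grad_ip iph inv_lap interp.

Section one_step.
Context {R : realType} {d : nat}.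
Variables (h : R) (T : seq (simplex R d)).
Hypothesis hT : torus_partition h T.
Hypothesis d_gt0 : (0 < d)%N.
Implicit Types (K : simplex R d) (x y : 'rV[R]_d) (u v w phi U W Uo : 'rV[R]_d -> R).
Local Notation gr := (gr T).
Variables (sigma : R -> R) (lam : int -> R) (g : int -> 'rV[R]_d -> R) (Z : {fset int}).
Variable (Ms : R).
Hypothesis sigma_le : forall t, `|sigma t| <= Ms.
Hypothesis g_periodic : forall k, Defs.periodic (g k).

Definition noise_coef Uo phi (k : int) (i : 'I_d) : R :=
  L2ip (partial i (interp T (fun x => sigma (Uo x) * lam k * g k x))) phi.

Definition noise (db : int -> 'I_d -> R) Uo phi : R :=
  \sum_(i < d) \sum_(k <- Z) noise_coef Uo phi k i * db k i.

Definition field (db : int -> 'I_d -> R) (i : 'I_d) x : R := \sum_(k <- Z) db k i * lam k * g k x.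

(** Bounds the squared dual norm of the noise functional with respect to the gradient norm. It does
    not involve the previous solution, because [sigma] is replaced by its bound [Ms]. *)
Definition noise_size (db : int -> 'I_d -> R) : R :=
  Ms ^+ 2 * \sum_i \sum_(r <- nodes T) wt T r * field db i r ^+ 2.

Lemma noise_size_ge0 db : 0 <= noise_size db.
Proof.
rewrite mulr_ge0 ?sqr_ge0// sumr_ge0// => i _; rewrite sumr_ge0// => r _.
by rewrite mulr_ge0 ?sqr_ge0// (wt_ge0 hT).
Qed.

Lemma coef_periodic Uo k : Defs.periodic Uo -> Defs.periodic (fun x => sigma (Uo x) * lam k * g k x).
Proof. by move=> pU x z; rewrite pU g_periodic. Qed.

(** Integration by parts moves the derivative onto the test function, so the old solution and the
    noise functions enter through nodal values only. *)
Lemma noise_coefE Uo phi k i : Defs.periodic Uo -> Vh T phi ->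
  noise_coef Uo phi k i =
  - \sum_(r <- nodes T) sigma (Uo r) * lam k * g k r * mean (fun x => gr i phi x * hat T r x).
Proof.
move=> pU Vphi; have [Vi _] := interpP hT (@coef_periodic Uo k pU).
rewrite /noise_coef (L2ip_partialE hT d_gt0)// (gr_ibp hT d_gt0)//; congr (- _).
have bg := gr_bmeas hT i phi; have bh r := hat_bmeas hT r.
transitivity (mean (fun x => \sum_(r <- nodes T) (sigma (Uo r) * lam k * g k r) * (gr i phi x * hat T r x))).
  congr mean; apply/funext => x; rewrite (interp_hat hT); last exact: coef_periodic.
  by rewrite mulr_sumr; apply: eq_bigr => r _; rewrite mulrCA.
rewrite mean_sum => [|r]; last by apply: bmeasZ; apply: bmeasM.
by apply: eq_bigr => r _; rewrite meanZ//; apply: bmeasM.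
Qed.

Lemma noiseE db Uo phi : Defs.periodic Uo -> Vh T phi ->
  noise db Uo phi = - \sum_i mean (fun x => gr i phi x * (\sum_(r <- nodes T)
    sigma (Uo r) * field db i r * hat T r x)).
Proof.
move=> pU Vphi; rewrite /noise -sumrN; apply: eq_bigr => i _.
have bg := gr_bmeas hT i phi; have bh r := hat_bmeas hT r.
have -> : (fun x => gr i phi x * (\sum_(r <- nodes T) sigma (Uo r) * field db i r * hat T r x)) =
   (fun x => \sum_(r <- nodes T) (sigma (Uo r) * field db i r) * (gr i phi x * hat T r x)).
  by apply/funext => x; rewrite mulr_sumr; apply: eq_bigr => r _; rewrite mulrCA.
rewrite mean_sum => [|r]; last by apply: bmeasZ; apply: bmeasM.
under eq_bigr do rewrite noise_coefE// mulNr mulr_suml.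
rewrite sumrN exchange_big/=; congr (- _); apply: eq_bigr => r _.
rewrite meanZ; last exact: bmeasM.
rewrite /field mulr_sumr mulr_suml; apply: eq_bigr => k _.
move: (mean _) (sigma (Uo r)) (lam k) (g k r) (db k i) => a b c e f; ring.
Qed.

(** Cauchy-Schwarz after the integration by parts: no derivative falls on the old solution, and the
    factor [q i] lies in [Vh], so its L2 norm is bounded by the lumped one, that is, by nodal
    values. *)
Lemma noise_sqr_le db Uo phi : Defs.periodic Uo -> Vh T phi ->
  noise db Uo phi ^+ 2 <= noise_size db * grad_ip phi phi.
Proof.
move=> pU Vphi; rewrite noiseE// sqrrN.
pose q i x := \sum_(r <- nodes T) sigma (Uo r) * field db i r * hat T r x.
have bh r := hat_bmeas hT r.
have Vq i : Vh T (q i) by apply: (Vh_sum hT) => r; apply: (VhZ hT); exact: (hat_Vh hT).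
have bq i : bmeas (q i) := Vh_bmeas hT (Vq i).
have bg i : bmeas (gr i phi) := gr_bmeas hT i phi.
apply: (@le_trans _ _ ((\sum_i mean (fun x => q i x ^+ 2)) * grad_ip phi phi)).
  rewrite mulrC (grad_ip_sqr hT d_gt0 Vphi); apply: quad_discr.
  - by apply: sumr_ge0 => i _; apply: mean_ge0 => x; exact: sqr_ge0.
  - by apply: sumr_ge0 => i _; apply: mean_ge0 => x; exact: sqr_ge0.
  move=> s t; rewrite !mulr_sumr -!big_split/=; apply: sumr_ge0 => i _.
  have bi := bq i; have bj := bg i.
  have : 0 <= mean (fun x => (s * gr i phi x + t * q i x) ^+ 2).
    by apply: mean_ge0 => x; exact: sqr_ge0.
  have -> : (fun x => (s * gr i phi x + t * q i x) ^+ 2) = (fun x => s ^+ 2 * gr i phi x ^+ 2 +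
     2 * s * t * (gr i phi x * q i x) + t ^+ 2 * q i x ^+ 2) by apply/funext => x; ring.
  by rewrite meanD ?meanD ?meanZ; [|bmeas_tac..].
rewrite ler_wpM2r ?grad_ip_ge0// /noise_size mulr_sumr; apply: ler_sum => i _.
rewrite (le_trans (L2_le_lump hT (Vq i)))// (iphE hT)//; try exact: (Vh_periodic (Vq i)).
rewrite mulr_sumr big_seq [leRHS]big_seq; apply: ler_sum => r rN.
have -> : q i r = sigma (Uo r) * field db i r.
  rewrite /q (bigD1_seq r) ?undup_uniq//= (hat_node hT)// eqxx mulr1 big_seq_cond big1 ?addr0//.
  by move=> s /andP[sN sr]; rewrite (hat_node hT)// eq_sym (negbTE sr) mulr0.
rewrite [leRHS]mulrCA ler_wpM2l ?(wt_ge0 hT)// -expr2 exprMn ler_wpM2r ?sqr_ge0//.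
rewrite -(real_normK (num_real (sigma _))) lerXn2r ?nnegrE//.
by rewrite (le_trans (normr_ge0 _) (sigma_le 0)).
Qed.

Lemma noise_linear db Uo c u v : Defs.periodic Uo -> Vh T u -> Vh T v ->
  noise db Uo (fun x => c * u x + v x) = c * noise db Uo u + noise db Uo v.
Proof.
move=> pU Vu Vv; have bu := Vh_bmeas hT Vu; have bv := Vh_bmeas hT Vv.
rewrite /noise mulr_sumr -big_split/=; apply: eq_bigr => i _.
rewrite mulr_sumr -big_split/=; apply: eq_bigr => k _; rewrite mulrA -mulrDl; congr (_ * _).
have [Vi _] := interpP hT (@coef_periodic Uo k pU).
have bg := gr_bmeas hT i (interp T (fun x => sigma (Uo x) * lam k * g k x)).
rewrite /noise_coef !(L2ip_partialE hT d_gt0)//.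
rewrite -meanZ; last exact: bmeasM.
rewrite -meanD; [|by apply: bmeasZ; apply: bmeasM|exact: bmeasM].
by congr mean; apply/funext => x; rewrite mulrDr mulrCA.
Qed.

Lemma noise_cst db Uo c : Defs.periodic Uo -> noise db Uo (cst c) = 0.
Proof.
move=> pU; have V1 := Vh_cst hT c; apply/eqP; rewrite -sqrf_eq0 -normr_le0 normrX.
rewrite real_normK ?num_real//.
by have := noise_sqr_le db pU V1; rewrite grad_ip_cst mulr0.
Qed.

End one_step.

Lemma le_quarter {R : realFieldType} (q r n : R) : 0 <= q -> 0 <= r -> n ^+ 2 <= r * q ->
  n <= q / 4 + r.
Proof.
move=> q0 r0 hn; rewrite leNgt; apply/negP => hlt.
have : (q / 4 + r) ^+ 2 < n ^+ 2.
  by rewrite ltrXn2r// ?nnegrE ?addr_ge0 ?divr_ge0// (le_trans _ (ltW hlt))// addr_ge0// divr_ge0.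
have := sqr_ge0 (q / 4 - r); have : (q / 4 + r) ^+ 2 = (q / 4 - r) ^+ 2 + r * q by field.
lra.
Qed.

(** Half of [k * A] comes with the wrong sign from the explicit concave term and another half is
    wanted on the left. Both are absorbed by half of [k * D], because
    [D >= Fm >= 2 * u2 - 5 >= 2 * A - 5]; hence the source [5 / 2 * k]. The noise [n2] costs one
    half of the numerical dissipation [q / 2]. *)
Lemma energy_arith {R : realFieldType} (k Fm n1 n2 rr D X A Ao dd u2 zz zoz zozo q G : R) :
  zz - zoz + (G + k * (D - X)) = n1 + n2 -> q = zz - 2 * zoz + zozo -> dd = A - 2 * X + Ao ->
  A <= u2 -> Fm <= D -> - 5 <= Fm - 2 * u2 -> n2 <= q / 4 + rr -> 0 <= k ->
  zz / 2 + k / 2 * A + q / 4 + G + k / 2 * dd + k / 2 * D <=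
  zozo / 2 + k / 2 * Ao + 5 / 2 * k + rr + n1.
Proof.
move=> e1 e3 e4 e5 d1 d2 nb k0.
have : 0 <= k * (D / 2 + 5 / 2 - A) by rewrite mulr_ge0//; lra.
rewrite e4; nra.
Qed.

Section scheme_energy.
Context {R : realType} {d : nat}.
Variables (h : R) (T : seq (simplex R d)).
Hypothesis hT : torus_partition h T.
Hypothesis d_gt0 : (0 < d)%N.
Implicit Types (u v w phi U W Uo : 'rV[R]_d -> R).

Definition invl u m : 'rV[R]_d -> R := inv_lap T (fun x => u x - m).

Lemma sub_mean_periodic u m : Vh T u -> Defs.periodic (fun x => u x - m).
Proof. by move=> /Vh_periodic pu x z; rewrite pu. Qed.

Lemma VhBc u m : Vh T u -> Vh T (fun x => u x - m).
Proof. by move=> Vu; apply: (VhB hT Vu (Vh_cst hT m)). Qed.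

Lemma mean_sub u m : Vh T u -> mean (fun x => u x - m) = mean u - m.
Proof. by move=> Vu; rewrite meanB ?mean_cst//; [exact: (Vh_bmeas hT)|exact: bmeas_cst]. Qed.

Lemma invlP u m : Vh T u -> mean u = m ->
  [/\ Vh T (invl u m), mean (invl u m) = 0
    & forall phi, Vh T phi -> grad_ip (invl u m) phi = iph T (fun x => u x - m) phi].
Proof.
move=> Vu mu; apply: (inv_lapP hT d_gt0); first exact: sub_mean_periodic.
by rewrite (interp_Vh hT (VhBc m Vu)) mean_sub// mu subrr.
Qed.

Variables (eps tau delta : R) (sigma : R -> R) (lam : int -> R).
Variables (g : int -> 'rV[R]_d -> R) (Z : {fset int}) (Ms : R).
Hypotheses (eps0 : 0 < eps) (tau0 : 0 < tau) (delta0 : 0 < delta) (delta8 : delta <= 1 / 8).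
Hypothesis sigma_le : forall t, `|sigma t| <= Ms.
Hypothesis g_periodic : forall k, Defs.periodic (g k).
Variables (m : R).
Hypothesis m1 : `|m| <= 1.

Lemma comp_periodic (f : R -> R) u : Defs.periodic u -> Defs.periodic (f \o u).
Proof. by move=> pu x z /=; rewrite pu. Qed.

Lemma iph_F_ge0 U : Vh T U -> 0 <= iph T (F_ delta \o U) (cst 1).
Proof.
move=> /Vh_periodic pU; rewrite (iphE hT)//; last exact: comp_periodic.
by apply: sumr_ge0 => r _; rewrite mulr_ge0 ?(wt_ge0 hT)// mulr1 F_ge0.
Qed.

Lemma iph_F_le_f U : Vh T U ->
  iph T (F_ delta \o U) (cst 1) <= iph T (f_ delta \o U) (fun x => U x - m).
Proof.
move=> VU; have pU := Vh_periodic VU.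
rewrite !(iphE hT)//; try exact: comp_periodic; last exact: sub_mean_periodic.
by apply: ler_sum => r _; rewrite ler_wpM2l ?(wt_ge0 hT)// mulr1 F_le_f.
Qed.

Lemma iph_F_lower U : Vh T U -> - 5 <= iph T (F_ delta \o U) (cst 1) - 2 * iph T U U.
Proof.
move=> VU; have pU := Vh_periodic VU.
rewrite !(iphE hT)//; last exact: comp_periodic.
have -> : - 5 = \sum_(r <- nodes T) wt T r * - 5 :> R by rewrite -mulr_suml (wt_sum hT) mul1r.
rewrite !mulr_sumr -sumrB; apply: ler_sum => r _.
have := F_lower (U r) delta0 delta8; have := wt_ge0 hT r; rewrite /= mulr1.
move: (wt T r) (U r) => w t; move: (F_ delta t) => f w0 h1.
rewrite -subr_ge0 [X in 0 <= X](_ : _ = w * (f - (2 * t ^+ 2 - 5))); last by ring.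
by rewrite mulr_ge0// subr_ge0.
Qed.

Variable db : int -> 'I_d -> R.
Local Notation step := (scheme_step eps tau delta sigma lam g T Z db).
Local Notation N := (noise T sigma lam g Z db).
Local Notation sq u := (iph T u u).

Lemma scheme_mean Uo U W : Vh T Uo -> Vh T U -> Vh T W -> step Uo U W -> mean U = mean Uo.
Proof.
move=> Vo VU VW [e1 _]; have V1 := Vh_cst hT 1; have := e1 _ V1.
have := noise_cst hT d_gt0 lam Z sigma_le g_periodic db 1 (Vh_periodic Vo).
rewrite /noise /noise_coef => -> ; rewrite grad_ip_cst mulr0 addr0.
rewrite (iph_cst hT); last exact: (VhB hT).
rewrite mul1r meanB; [|exact: (Vh_bmeas hT)..].
by move=> /eqP; rewrite subr_eq0 => /eqP.
Qed.

(** The noise tested with [z] splits: against the old potential [zo] it stays, linear in the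
    increments with previsible coefficients; against the increment [dz] it is absorbed by part of
    the dissipation of [dz], at the price of [noise_size]. *)
Lemma energy_step Uo U W : Vh T Uo -> Vh T U -> Vh T W -> mean Uo = m -> step Uo U W ->
  let z := invl U m in let zo := invl Uo m in
  let U' := fun x => U x - m in let Uo' := fun x => Uo x - m in
  let dU := fun x => U x - Uo x in let dz := fun x => -1 * zo x + z x in
  (grad_ip z z / 2 + tau / (2 * eps) * sq U' + grad_ip dz dz / 4 + tau * eps * grad_ip U U
   + tau / (2 * eps) * sq dU + tau / (2 * eps) * iph T (f_ delta \o U) U'
  <= grad_ip zo zo / 2 + tau / (2 * eps) * sq Uo' + 5 / 2 * (tau / eps)
   + noise_size T lam g Z Ms db + N Uo zo : Prop).
Proof.
move=> Vo VU VW mo st z zo U' Uo' dU dz.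
have mU : mean U = m by rewrite (scheme_mean Vo VU VW st).
have [e1 e2] := st.
have [Vz mz hz] := invlP VU mU; have [Vzo mzo hzo] := invlP Vo mo.
rewrite -/z in Vz mz hz; rewrite -/zo in Vzo mzo hzo.
clearbody z zo.
have [gl gs] := grad_ip_form hT d_gt0.
have Vdz : Vh T dz by apply: (VhD hT) => //; exact: (VhZ hT).
have VU' : Vh T U' := VhBc m VU; have VUo' : Vh T Uo' := VhBc m Vo.
have pU := Vh_periodic VU; have pUo := Vh_periodic Vo.
have pU' := Vh_periodic VU'; have pUo' := Vh_periodic VUo'; have pz := Vh_periodic Vz.
have pfU : Defs.periodic (f_ delta \o U) by exact: comp_periodic.
have dUE : dU = fun x => -1 * Uo' x + U' x by apply/funext => x; rewrite /dU /Uo' /U'; ring.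
have mU' : mean U' = 0 by rewrite mean_sub// mU subrr.
have E1 : grad_ip z z - grad_ip zo z + tau * iph T W U' = N Uo zo + N Uo dz.
  have := e1 _ Vz; rewrite -/(N Uo z) -[fun x => U x - Uo x]/dU dUE (iph_linear hT)//.
  rewrite -(hz _ Vz) -(hzo _ Vz) (gs W z VW Vz) (hz _ VW) (iphC T _ W).
  have -> : N Uo z = N Uo zo + N Uo dz.
    rewrite (noise_linear hT d_gt0)//; move: (N Uo zo) (N Uo z) => a b; ring.
  move: (grad_ip z z) (grad_ip zo z) (iph T W U') (N Uo zo) (N Uo dz) => a b c e f; lra.
have E2 : iph T W U' = eps * grad_ip U U + eps^-1 * (iph T (f_ delta \o U) U' - iph T Uo' U').
  have Ea : grad_ip U U' = grad_ip U U.
    have U'E : U' = fun x => 1 * U x + cst (- m) x by apply/funext => x; rewrite mul1r.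
    have Vc := Vh_cst hT (- m).
    have g1 := gl 1 U (cst (- m)) U VU Vc VU.
    rewrite (gs U U' VU VU') U'E g1 mul1r (gs (cst (- m)) U Vc VU) grad_ip_cst.
    exact: addr0.
  have Eb : iph T (fun x => f_ delta (U x) - Uo x) U' = iph T (f_ delta \o U) U' - iph T Uo' U'.
    have fE : (fun x => f_ delta (U x) - Uo x) = (fun x => -1 * Uo x + (f_ delta \o U) x).
      by apply/funext => x; rewrite /= mulN1r addrC.
    have oE : iph T Uo' U' = iph T Uo U' by rewrite (iph_sub hT Vo mo VU') mU' mulr0 subr0.
    by rewrite fE (iph_linear hT (-1) pUo pfU pU') oE mulN1r addrC.
  by have e2' := e2 _ VU'; rewrite -[LHS]e2' Ea Eb.
have E3 : grad_ip dz dz = grad_ip z z - 2 * grad_ip zo z + grad_ip zo zo.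
  have a1 : grad_ip dz dz = -1 * grad_ip zo dz + grad_ip z dz := gl (-1) zo z dz Vzo Vz Vdz.
  have a2 : grad_ip zo dz = -1 * grad_ip zo zo + grad_ip z zo.
    by rewrite (gs zo dz Vzo Vdz); exact: (gl (-1) zo z zo Vzo Vz Vzo).
  have a3 : grad_ip z dz = -1 * grad_ip zo z + grad_ip z z.
    by rewrite (gs z dz Vz Vdz); exact: (gl (-1) zo z z Vzo Vz Vz).
  rewrite a1 a2 a3 (gs z zo Vz Vzo).
  move: (grad_ip z z) (grad_ip zo z) (grad_ip zo zo) => a b c; ring.
have E4 : sq dU = sq U' - 2 * iph T Uo' U' + sq Uo'.
  pose dL x := -1 * Uo' x + U' x.
  have pd : Defs.periodic dL by move=> x w; rewrite /dL pU' pUo'.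
  have a1 : iph T dL dL = -1 * iph T Uo' dL + iph T U' dL := iph_linear hT (-1) pUo' pU' pd.
  have a2 : iph T Uo' dL = -1 * iph T Uo' Uo' + iph T U' Uo'.
    by rewrite (iphC T Uo' dL); exact: (iph_linear hT (-1) pUo' pU' pUo').
  have a3 : iph T U' dL = -1 * iph T Uo' U' + iph T U' U'.
    by rewrite (iphC T U' dL); exact: (iph_linear hT (-1) pUo' pU' pU').
  rewrite dUE -/dL a1 a2 a3 (iphC T U' Uo').
  move: (iph T Uo' U') (sq U') (sq Uo') => a b c; ring.
have E5 : sq U' <= sq U.
  have -> : sq U' = sq U - m ^+ 2.
    rewrite {1}/U' (iph_sub hT VU mU VU') mU' mulr0 subr0 iphC {1}/U' (iph_sub hT VU mU VU) mU.
    by rewrite expr2.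
  by rewrite lerBlDr lerDl sqr_ge0.
have D1 := iph_F_le_f VU; have D2 := iph_F_lower VU.
have NB : N Uo dz <= grad_ip dz dz / 4 + noise_size T lam g Z Ms db.
  apply: le_quarter; [exact: grad_ip_ge0|exact: (noise_size_ge0 hT)|].
  exact: (noise_sqr_le hT d_gt0 lam Z sigma_le g_periodic db pUo Vdz).
have k0 : 0 <= tau / eps by rewrite divr_ge0// ltW.
have kE : tau / (2 * eps) = tau / eps / 2 by rewrite invfM mulrA mulrAC.
have E1' : grad_ip z z - grad_ip zo z + (tau * eps * grad_ip U U
    + tau / eps * (iph T (f_ delta \o U) U' - iph T Uo' U')) = N Uo zo + N Uo dz.
  by rewrite -E1 E2 [tau * (_ + _)]mulrDr !mulrA.
rewrite kE; exact: (energy_arith E1' E3 E4 E5 D1 D2 NB k0).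
Qed.

End scheme_energy.

(** McShane's extension, the infimum over [p] in [S] of [p.2 + L * l1 (y - p.1)]. The set [S] of
    pairs of argument and value is a graph by the Lipschitz hypothesis itself. *)
Lemma lipschitz_extension {R : realType} {n : nat} (S : set ('rV[R]_n * R)) (L : R) : 0 <= L ->
  (forall p q, S p -> S q -> `|p.2 - q.2| <= L * l1 (p.1 - q.1)) ->
  exists2 f : 'rV[R]_n -> R, continuous f & forall p, S p -> f p.1 = p.2.
Proof.
move=> L0 lipS; have [[p0 Sp0]|nS] := pselect (S !=set0); last first.
  exists (cst 0); first by move=> x; exact: cst_continuous.
  by move=> p Sp; exfalso; apply: nS; exists p.
have tri x y : l1 (x + y) <= l1 x + l1 y.
  by rewrite /l1 -big_split; apply: ler_sum => i _; rewrite mxE ler_normD.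
have sym (x y : 'rV[R]_n) : l1 (x - y) = l1 (y - x).
  by rewrite /l1; apply: eq_bigr => i _; rewrite !mxE distrC.
pose V y := [set p.2 + L * l1 (y - p.1) | p in S].
have Vlb y p : S p -> lbound (V y) (p.2 - L * l1 (y - p.1)).
  move=> Sp _ [q Sq <-]; have := lipS _ _ Sp Sq; rewrite ler_norml => /andP[_ h1].
  have h2 : l1 (p.1 - q.1) <= l1 (y - p.1) + l1 (y - q.1).
    rewrite (sym y p.1) (_ : p.1 - q.1 = (p.1 - y) + (y - q.1)) ?tri//.
    by rewrite addrA subrK.
  have := ler_wpM2l L0 h2; rewrite mulrDr; lra.
have Vinf y : has_inf (V y).
  by split; [exists (p0.2 + L * l1 (y - p0.1)); exists p0|exists (p0.2 - L * l1 (y - p0.1)); exact: Vlb].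
pose f y := inf (V y).
have fle y p : S p -> f y <= p.2 + L * l1 (y - p.1).
  by move=> Sp; apply: ge_inf; [case: (Vinf y)|exists p].
have flip x y : f x <= f y + L * l1 (x - y).
  rewrite -lerBlDr; apply: lb_le_inf; first by case: (Vinf y).
  move=> _ [p Sp <-]; rewrite lerBlDr (le_trans (fle x p Sp))// -addrA lerD2l -mulrDr ler_wpM2l//.
  by rewrite [leRHS]addrC (_ : x - p.1 = (x - y) + (y - p.1)) ?tri// addrA subrK.
exists f => [|p Sp].
  apply: (@lip_at_continuous R n L) => // x; exists 1 => // y _.
  rewrite ler_norml; apply/andP; split; last by have := flip y x; lra.
  by have := flip x y; rewrite sym; lra.
apply/eqP; rewrite eq_le; apply/andP; split.
  by have := fle p.1 p Sp; rewrite subrr /l1 big1 ?mulr0 ?addr0// => i _; rewrite mxE normr0.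
have := lb_le_inf (Vinf p.1).1 (Vlb p.1 p Sp).
by rewrite subrr /l1 big1 ?mulr0 ?subr0// => i _; rewrite mxE normr0.
Qed.

(** The cross term [gwz] of the first equation cancels against [iwe] of the second, monotonicity
    discards [idf], and Young's inequality with the weights [1 / 2] and [eps ^+ 2 / 2] lets the left
    side absorb the data terms. *)
Lemma lipschitz_arith {R : realFieldType} (eps tau D C1 C2 gz ge gwz idf ioe iwe ioz iez nn Sz Se : R) :
  0 < eps -> 0 < tau ->
  iez + tau * gwz = nn -> eps * ge + eps^-1 * (idf - ioe) = iwe -> gwz = iwe -> iez = gz - ioz ->
  0 <= idf -> `|nn| <= D * Sz -> `|ioz| <= D * Sz -> `|ioe| <= D * Se ->
  D * Sz <= 1 / 2 * gz + C1 * D ^+ 2 -> D * Se <= eps ^+ 2 / 2 * ge + C2 * D ^+ 2 -> 0 <= gz ->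
  ge <= 2 / (tau * eps) * (2 * C1 + tau / eps * C2) * D ^+ 2.
Proof.
move=> eps0 tau0 e1 e2 e3 e4 f0 /ler_normlP[_ n1] /ler_normlP[_ n2] /ler_normlP[_ n3] y1 y2 g0.
have te : 0 < tau * eps by rewrite mulr_gt0.
have k0 : 0 < tau / eps by rewrite divr_gt0.
have en : eps != 0 by rewrite gt_eqF.
have tn : tau != 0 by rewrite gt_eqF.
have H1 : gz + tau * eps * ge + tau / eps * idf = nn + ioz + tau / eps * ioe.
  rewrite -e1 e3 e4 -e2; field => //.
have H2 : tau / eps * ioe <= tau / eps * (eps ^+ 2 / 2 * ge + C2 * D ^+ 2).
  by rewrite ler_pM2l// (le_trans n3).
have H3 : tau / eps * (eps ^+ 2 / 2 * ge + C2 * D ^+ 2) =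
   tau * eps * ge / 2 + tau / eps * C2 * D ^+ 2 by field.
have H4 : 0 <= tau / eps * idf by rewrite mulr_ge0// ltW.
have H5 : tau * eps * ge <= 2 * (2 * C1 + tau / eps * C2) * D ^+ 2.
  rewrite H3 in H2; move: H1 H2 H4 n1 n2 y1.
  move: (tau * eps * ge) (tau / eps * idf) (tau / eps * ioe) (tau / eps * C2) (D * Sz) => a b c e f.
  move: (D ^+ 2) => D2 h1 h2 h4 n1' n2' y1'.
  rewrite [leRHS](_ : _ = 2 * (2 * (C1 * D2)) + 2 * (e * D2)); last by ring.
  by move: (C1 * D2) (e * D2) h2 y1' => p q h2 y1'; lra.
rewrite -(ler_pM2l te) (le_trans H5)// le_eqVlt; apply/orP; left; apply/eqP.
by field; rewrite en tn.
Qed.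

Lemma young_arith {R : realFieldType} (a b D : R) : 0 < a -> 0 <= b -> 0 <= D ->
  D * b <= a * b ^+ 2 + D ^+ 2 / a.
Proof.
move=> a0 b0 D0; have an : a != 0 by rewrite gt_eqF.
have -> : a * b ^+ 2 + D ^+ 2 / a = (a * b - D) ^+ 2 / a + 2 * (D * b) by field.
have h1 : 0 <= (a * b - D) ^+ 2 / a by rewrite divr_ge0 ?sqr_ge0// ltW.
by have := mulr_ge0 D0 b0; lra.
Qed.

(** * One step of the scheme as a continuous function of finitely many data *)

Section step_lipschitz.
Context {R : realType} {d : nat}.
Variables (h : R) (T : seq (simplex R d)).
Hypothesis hT : torus_partition h T.
Hypothesis d_gt0 : (0 < d)%N.
Implicit Types (u v w phi U W Uo : 'rV[R]_d -> R).

(** The constant depends on the mesh through the nodal weights. This is harmless: the estimate only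
    serves the continuity of the solution map. *)
Lemma node_sqr_le : exists2 c : R, 0 <= c & forall v r, Vh T v -> mean v = 0 -> r \in nodes T ->
  v r ^+ 2 <= c * grad_ip v v.
Proof.
pose k : R := 4 ^+ d.+1 * d%:R.
have k0 : 0 <= k by rewrite mulr_ge0 ?exprn_ge0.
exists (\sum_(r <- nodes T) k / wt T r).
  by apply: sumr_ge0 => r _; rewrite divr_ge0 ?(wt_ge0 hT).
move=> v r Vv mv rN; have w0 := wt_gt0 hT rN.
apply: (@le_trans _ _ (k / wt T r * grad_ip v v)); last first.
  rewrite ler_wpM2r ?grad_ip_ge0//.
  apply: (@ler_sum_mem R _ (nodes T) (fun r => k / wt T r)) => // s.
  by rewrite divr_ge0 ?(wt_ge0 hT).
rewrite mulrAC ler_pdivlMr// mulrC.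
have h1 : wt T r * v r ^+ 2 <= iph T v v.
  rewrite (iphE hT); [|exact: (Vh_periodic Vv)..].
  rewrite (bigD1_seq r) ?undup_uniq//= expr2 lerDl sumr_ge0// => s _.
  by rewrite mulr_ge0 ?(wt_ge0 hT)// -expr2 sqr_ge0.
rewrite (le_trans h1)// (le_trans (lump_le_L2 hT d_gt0 Vv))// /k -mulrA ler_wpM2l ?exprn_ge0//.
have := poincare hT d_gt0 Vv; rewrite mv.
by under eq_fun do rewrite subr0.
Qed.

Lemma sum_node_young (kap : R) : 0 < kap -> exists2 C : R, 0 <= C &
  forall v D, Vh T v -> mean v = 0 -> 0 <= D ->
    D * \sum_(r <- nodes T) `|v r| <= kap * grad_ip v v + C * D ^+ 2.
Proof.
move=> kap0; have [c c0 hc] := node_sqr_le.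
pose n : R := (size (nodes T))%:R; have n0 : 0 <= n by rewrite ler0n.
(* This Young weight keeps the sum [n * (a * c)] over all nodes below [kap]. *)
pose a := kap / (n * c + 1).
have nc : 0 < n * c + 1 by rewrite ltr_wpDl// mulr_ge0.
have a0 : 0 < a by rewrite divr_gt0.
exists (n / a); first by rewrite divr_ge0// ltW.
move=> v D Vv mv D0; have g0 := grad_ip_ge0 v.
apply: (@le_trans _ _ (\sum_(r <- nodes T) (a * c * grad_ip v v + D ^+ 2 / a))).
  rewrite mulr_sumr big_seq [leRHS]big_seq; apply: ler_sum => r rN.
  have h1 := hc v r Vv mv rN.
  have h2 : a * v r ^+ 2 <= a * c * grad_ip v v by rewrite -mulrA ler_wpM2l// ltW.
  apply: (@le_trans _ _ (a * v r ^+ 2 + D ^+ 2 / a)); last by rewrite lerD2r.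
  rewrite -(real_normK (num_real (v r))); move: (`|v r|) (normr_ge0 (v r)) => b b0.
  exact: young_arith.
rewrite big_const_seq count_predT iter_addr addr0 -[leLHS]mulr_natl -/n mulrDr lerD//.
  rewrite mulrA ler_wpM2r// /a (_ : n * (_ * c) = kap * (n * c / (n * c + 1))).
    by rewrite ler_piMr ?(ltW kap0)// ler_pdivrMr// mul1r lerDl.
  by field; rewrite gt_eqF.
by rewrite mulrCA mulrC.
Qed.

Variables (eps tau delta : R) (sigma : R -> R) (lam : int -> R).
Variables (g : int -> 'rV[R]_d -> R) (Z : {fset int}) (Ms : R).
Hypotheses (eps0 : 0 < eps) (tau0 : 0 < tau) (delta0 : 0 < delta).
Hypothesis sigma_le : forall t, `|sigma t| <= Ms.
Hypothesis g_periodic : forall k, Defs.periodic (g k).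
Variables (m : R).
Local Notation step db := (scheme_step eps tau delta sigma lam g T Z db).
Local Notation N := (noise T sigma lam g Z).

Lemma noise_hat db Uo phi : Defs.periodic Uo -> Vh T phi ->
  N db Uo phi = \sum_(r <- nodes T) phi r * N db Uo (hat T r).
Proof.
move=> pU Vphi; rewrite {1}(Vh_hat hT Vphi).
have Vhat r := hat_Vh hT r.
elim: (nodes T) => [|r s IH].
  rewrite big_nil; under eq_fun do rewrite big_nil.
  exact: (noise_cst hT d_gt0 lam Z sigma_le g_periodic db 0 pU).
rewrite big_cons -IH; under eq_fun do rewrite big_cons.
have Vs : Vh T (fun x => \sum_(j <- s) phi j * hat T j x).
  by apply: (Vh_sum hT) => j; apply: (VhZ hT).
exact: (noise_linear hT d_gt0 sigma lam Z g_periodic db (phi r) pU (Vhat r) Vs).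
Qed.

(** The difference of two solutions is tested with its inverse Laplacian and with itself, where the
    monotonicity of [f_] gives the right sign. Besides the old nodal values, only the noise tested
    with hat functions enters. *)
Lemma step_lipschitz : exists2 L : R, 0 <= L &
  forall db Uo U W db' Uo' U' W' D,
    Vh T Uo -> Vh T U -> Vh T W -> mean Uo = m -> step db Uo U W ->
    Vh T Uo' -> Vh T U' -> Vh T W' -> mean Uo' = m -> step db' Uo' U' W' ->
    0 <= D ->
    (forall r, r \in nodes T -> `|Uo r - Uo' r| <= D /\
       `|N db Uo (hat T r) - N db' Uo' (hat T r)| <= D) ->
    forall r, r \in nodes T -> `|U r - U' r| <= L * D.
Proof.
have [c c0 hc] := node_sqr_le.
have [C1 C10 hC1] := @sum_node_young (1 / 2) ltac:(lra).
have te : 0 < tau * eps by rewrite mulr_gt0.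
have kap0 : 0 < eps ^+ 2 / 2 by rewrite divr_gt0// exprn_gt0.
have [C2 C20 hC2] := sum_node_young kap0.
pose B := 2 / (tau * eps) * (2 * C1 + tau / eps * C2).
have B0 : 0 <= B.
  apply: mulr_ge0; first by rewrite divr_ge0// ltW.
  apply: addr_ge0; first by rewrite mulr_ge0.
  by rewrite mulr_ge0// divr_ge0// ltW.
exists (Num.sqrt (c * B)); first exact: sqrtr_ge0.
move=> db Uo U W db' Uo' U' W' D Vo VU VW mo st Vo' VU' VW' mo' st' D0 hD r rN.
have mU := scheme_mean hT d_gt0 sigma_le g_periodic Vo VU VW st.
have mU' := scheme_mean hT d_gt0 sigma_le g_periodic Vo' VU' VW' st'.
pose e x := -1 * U' x + U x; pose eo x := -1 * Uo' x + Uo x; pose w x := -1 * W' x + W x.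
have Ve : Vh T e by apply: (VhD hT) => //; exact: (VhZ hT).
have Veo : Vh T eo by apply: (VhD hT) => //; exact: (VhZ hT).
have Vw : Vh T w by apply: (VhD hT) => //; exact: (VhZ hT).
have me : mean e = 0 by rewrite /e (meanZD hT)// mU mU' mo mo' mulN1r addNr.
have [Vz mz hz] := invlP hT d_gt0 Ve me.
have [gl gs] := grad_ip_form hT d_gt0.
set z := invl T e 0 in Vz mz hz; clearbody z.
have {}hz phi : Vh T phi -> grad_ip z phi = iph T e phi.
  by move=> Vp; rewrite hz//; congr (iph T _ _); apply/funext => x; rewrite subr0.
have pU := Vh_periodic VU; have pU' := Vh_periodic VU'; have pe := Vh_periodic Ve.
have peo := Vh_periodic Veo; have pz := Vh_periodic Vz.
have pUo := Vh_periodic Vo; have pUo' := Vh_periodic Vo'.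
have pf : Defs.periodic (f_ delta \o U) by exact: comp_periodic.
have pf' : Defs.periodic (f_ delta \o U') by exact: comp_periodic.
have [e1 e2] := st; have [e1' e2'] := st'.
pose df x := -1 * (f_ delta \o U') x + (f_ delta \o U) x.
have pdf : Defs.periodic df by move=> x y; rewrite /df pf pf'.
have E1 : iph T (fun x => -1 * eo x + e x) z + tau * grad_ip w z = N db Uo z - N db' Uo' z.
  have a1 := e1 z Vz; have a2 := e1' z Vz; rewrite -/(N db Uo z) in a1; rewrite -/(N db' Uo' z) in a2.
  have b1 : iph T (fun x => -1 * eo x + e x) z =
      -1 * iph T (fun x => U' x - Uo' x) z + iph T (fun x => U x - Uo x) z.
    rewrite -(iph_linear hT); [|by move=> x y; rewrite pU' pUo'|by move=> x y; rewrite pU pUo|exact: pz].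
    by congr (iph T _ _); apply/funext => x; rewrite /eo /e; ring.
  have b2 : grad_ip w z = -1 * grad_ip W' z + grad_ip W z := gl (-1) W' W z VW' VW Vz.
  rewrite b1 b2 -a1 -a2.
  move: (iph T (fun x => U' x - Uo' x) z) (iph T (fun x => U x - Uo x) z) (grad_ip W' z) (grad_ip W z).
  by move=> q1 q2 q3 q4; ring.
have E2 : eps * grad_ip e e + eps^-1 * (iph T df e - iph T eo e) = iph T w e.
  have a1 := e2 e Ve; have a2 := e2' e Ve.
  have b1 : iph T w e = -1 * iph T W' e + iph T W e.
    exact: (iph_linear hT (-1) (Vh_periodic VW') (Vh_periodic VW) pe).
  have b2 : grad_ip e e = -1 * grad_ip U' e + grad_ip U e := gl (-1) U' U e VU' VU Ve.
  have b3 : iph T df e - iph T eo e =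
     -1 * iph T (fun x => f_ delta (U' x) - Uo' x) e + iph T (fun x => f_ delta (U x) - Uo x) e.
    rewrite -(iph_linear hT); [|by move=> x y; rewrite pU' pUo'|by move=> x y; rewrite pU pUo|exact: pe].
    have -> : (fun x => -1 * (f_ delta (U' x) - Uo' x) + (f_ delta (U x) - Uo x)) =
       (fun x => -1 * eo x + df x) by apply/funext => x; rewrite /eo /df /=; ring.
    by rewrite (iph_linear hT (-1) peo pdf pe) mulN1r addrC.
  rewrite b3 b1 b2 -a1 -a2.
  move: (iph T (fun x => f_ delta (U' x) - Uo' x) e) (iph T (fun x => f_ delta (U x) - Uo x) e).
  by move: (grad_ip U' e) (grad_ip U e) => q1 q2 q3 q4; ring.
have E3 : grad_ip w z = iph T w e by rewrite (gs w z Vw Vz) (hz w Vw) iphC.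
have E4 : iph T (fun x => -1 * eo x + e x) z = grad_ip z z - iph T eo z.
  by rewrite (iph_linear hT (-1) peo pe pz) (hz z Vz) mulN1r addrC.
have F0 : 0 <= iph T df e.
  rewrite (iphE hT pdf pe); apply: sumr_ge0 => s _; rewrite mulr_ge0 ?(wt_ge0 hT)//.
  have := f_monotone (U s) (U' s) delta0; rewrite /df /e /= => h1.
  by rewrite (_ : _ * _ = (f_ delta (U s) - f_ delta (U' s)) * (U s - U' s)) //; ring.
have wt1 s : wt T s <= 1 \/ s \notin nodes T.
  have [sN|] := boolP (s \in nodes T); [left|by right].
  rewrite -(wt_sum hT); apply: (@ler_sum_mem R _ (nodes T) (wt T)) => // ?; exact: (wt_ge0 hT).
have ipb v : Vh T v -> `|iph T eo v| <= D * \sum_(r <- nodes T) `|v r|.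
  move=> Vv; rewrite (iphE hT peo (Vh_periodic Vv)) (le_trans (ler_norm_sum _ _ _))// mulr_sumr.
  rewrite big_seq [leRHS]big_seq; apply: ler_sum => s sN.
  have [w1|] := wt1 s; last by rewrite sN.
  rewrite normrM (ger0_norm (wt_ge0 hT s)) -[leRHS]mul1r ler_pM ?(wt_ge0 hT)// normrM ler_wpM2r//.
  by have [+ _] := hD s sN; rewrite /eo mulN1r addrC.
have nb : `|N db Uo z - N db' Uo' z| <= D * \sum_(r <- nodes T) `|z r|.
  rewrite (noise_hat db pUo Vz) (noise_hat db' pUo' Vz) -sumrB (le_trans (ler_norm_sum _ _ _))//.
  rewrite mulr_sumr big_seq [leRHS]big_seq; apply: ler_sum => s sN.
  by rewrite -mulrBr normrM mulrC ler_wpM2r//; have [] := hD s sN.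
have y1 := hC1 z D Vz mz D0; have y2 := hC2 e D Ve me D0.
have i1 := ipb z Vz; have i2 := ipb e Ve.
have ge : grad_ip e e <= B * D ^+ 2.
  exact: (lipschitz_arith eps0 tau0 E1 E2 E3 E4 F0 nb i1 i2 y1 y2 (grad_ip_ge0 z)).
have er : U r - U' r = e r by rewrite /e mulN1r addrC.
have DE : D = Num.sqrt (D ^+ 2) by rewrite sqrtr_sqr ger0_norm.
have eE : `|e r| = Num.sqrt (e r ^+ 2) by rewrite sqrtr_sqr.
have cB : 0 <= c * B by rewrite mulr_ge0.
rewrite er [X in _ <= _ * X]DE -(sqrtrM _ cB) eE; apply: ler_wsqrtr; rewrite (le_trans (hc e r Ve me rN))// -mulrA ler_wpM2l//.
Qed.

(** Everything that one step depends on, as a vector of finite length, so that a new nodal value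
    becomes a function on a Euclidean space. *)
Definition step_data (db : int -> 'I_d -> R) Uo : 'rV[R]_(size (nodes T) + size (nodes T)) :=
  row_mx (\row_i Uo (nth 0 (nodes T) i)) (\row_i N db Uo (hat T (nth 0 (nodes T) i))).

Lemma step_data_l db Uo i : step_data db Uo ord0 (lshift _ i) = Uo (nth 0 (nodes T) i).
Proof. by rewrite /step_data row_mxEl mxE. Qed.

Lemma step_data_r db Uo i :
  step_data db Uo ord0 (rshift _ i) = N db Uo (hat T (nth 0 (nodes T) i)).
Proof. by rewrite /step_data row_mxEr mxE. Qed.

(** The Lipschitz estimate also gives uniqueness, so a nodal value is a function on the set of data
    for which a solution exists. Its continuous extension to all data is measurable, and so is the
    solution as a function of the increments. *)
Lemma step_function : exists2 Phi : 'rV[R]_d -> 'rV[R]_(size (nodes T) + size (nodes T)) -> R,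
  forall r, continuous (Phi r) &
  forall db Uo U W r, r \in nodes T -> Vh T Uo -> Vh T U -> Vh T W -> mean Uo = m ->
    step db Uo U W -> U r = Phi r (step_data db Uo).
Proof.
have [L L0 hL] := step_lipschitz.
have subE k (A B : 'rV[R]_k) j : (A - B) ord0 j = A ord0 j - B ord0 j by rewrite !mxE.
suff /choice[Phi hPhi] : forall r, exists f : 'rV[R]_(size (nodes T) + size (nodes T)) -> R,
    continuous f /\ forall db Uo U W, r \in nodes T -> Vh T Uo -> Vh T U -> Vh T W -> mean Uo = m ->
    step db Uo U W -> U r = f (step_data db Uo).
  by exists Phi => [r|db Uo U W r rN Vo VU VW mo st]; [have [] := hPhi r|
    have [_ H] := hPhi r; exact: H st].
move=> r; have [rN|rN] := boolP (r \in nodes T); last first.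
  by exists (cst 0); split=> // x; exact: cst_continuous.
pose S : set ('rV[R]_(size (nodes T) + size (nodes T)) * R) :=
  [set p | exists db Uo U W, [/\ Vh T Uo, Vh T U, Vh T W, mean Uo = m & step db Uo U W] /\
    p = (step_data db Uo, U r)].
have [|f cf hf] := @lipschitz_extension R _ S L L0.
  move=> _ _ [db [Uo [U [W [[Vo VU VW mo st] ->]]]]] [db' [Uo' [U' [W' [[Vo' VU' VW' mo' st'] ->]]]]].
  apply: (hL db Uo U W db' Uo' U' W') => //; first exact: l1_ge0.
  move=> s sN; have iN : (index s (nodes T) < size (nodes T))%N by rewrite index_mem.
  pose i := Ordinal iN; have si : s = nth 0 (nodes T) i by rewrite nth_index.
  split.
    have := l1_coord (step_data db Uo - step_data db' Uo') (lshift _ i).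
    by rewrite subE !step_data_l -si.
  have := l1_coord (step_data db Uo - step_data db' Uo') (rshift _ i).
  by rewrite subE !step_data_r -si.
exists f; split=> // db Uo U W _ Vo VU VW mo st.
by rewrite (hf (step_data db Uo, U r))//; exists db, Uo, U, W.
Qed.

End step_lipschitz.

(** * Bounds on the coefficients and on the initial datum *)

Section problem_data.
Context {R : realType} {d : nat}.
Local Notation mu := (@cube_measure R d).

Lemma C10_bounded (s : R -> R) : in_C10 s -> exists2 M : R, 0 <= M & forall t, `|s t| <= M.
Proof.
move=> [ds _ s0].
have cs : continuous s by move=> x; exact/differentiable_continuous/derivable1_diffP.
have cns : {within `[(-1 : R), 1], continuous (fun t => `|s t|)}.
  apply: continuous_subspaceT => x; apply: continuous_comp; [exact: cs|exact: norm_continuous].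
have le11 : (-1 : R) <= 1 by lra.
have [c _ hc] := EVT_max le11 cns.
exists `|s c| => // t; have [t1|t1] := boolP (t \in `[(-1 : R), 1]); first exact: hc.
rewrite s0 ?normr0//; move: t1; rewrite in_itv/= negb_and -!ltNge.
by rewrite ler_normr => /orP[] h; apply/orP; [right|left]; lra.
Qed.

Lemma C10_continuous (s : R -> R) : in_C10 s -> continuous s.
Proof. by move=> [ds _ _] x; exact/differentiable_continuous/derivable1_diffP. Qed.

Lemma smooth_continuous (u : 'rV[R]_d -> R) : smooth u -> continuous u.
Proof. by move=> /(_ [::]) []. Qed.

(** An essential bound of a continuous periodic function holds at every point, so this norm controls
    the values at the nodes, which form a null set. *)
Lemma W1oo_ge (u : 'rV[R]_d -> R) x : continuous u -> Defs.periodic u ->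
  (`|u x|%:E <= W1oo_norm u)%E.
Proof.
move=> cu pu; rewrite /W1oo_norm le_max; apply/orP; left.
rewrite unlock /= ifT; last by rewrite [X in (_ < X)%E]probability_setT lte01.
set E := ess_sup _ _.
have hE := ess_sup_ge mu (abse \o (EFin \o u)); rewrite -/E in hE.
have [E0|] := leP E (`|u x|%:E); last exact: ltW.
have : (0 <= E)%E.
  by apply: (ess_sup_gee); [rewrite [X in (_ < X)%E]probability_setT lte01|by apply: aeW => y; exact: abse_ge0].
case: E hE E0 => [r|//|//] hE _ r0.
rewrite lee_fin; apply: (@periodic_ae_bound R d (fun y => `|u y|) r).
- by move=> y; apply: (@continuous_comp _ _ _ u (fun t => `|t|)); [exact: cu|exact: norm_continuous].
- by move=> y z; rewrite pu.
- by apply: filterS hE => y; rewrite /= lee_fin.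
Qed.

(** Per unit of time this bounds the variance of the noise field at a point, uniformly in the
    truncation [Z] and hence in [h]. *)
Lemma coefficient_bound (lam : int -> R) (g : int -> 'rV[R]_d -> R) :
  (forall k, smooth (g k) /\ Defs.periodic (g k)) ->
  (\esum_(k in [set: int])
     ((lam k ^+ 2)%:E * (W1oo_norm (g k) ^+ 2 + H2_norm_sq (g k))) < +oo)%E ->
  exists2 B : R, 0 <= B & forall (Z : {fset int}) x, \sum_(k <- Z) (lam k * g k x) ^+ 2 <= B.
Proof.
move=> hg; set a := fun k : int => _ => hsum.
have W0 (u : 'rV[R]_d -> R) : (0 <= W1oo_norm u)%E.
  by rewrite /W1oo_norm le_max Lnorm_ge0.
have H0 (u : 'rV[R]_d -> R) : (0 <= H2_norm_sq u)%E.
  rewrite /H2_norm_sq !adde_ge0 ?sume_ge0// => *; rewrite ?sume_ge0// => *;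
  by rewrite expe_ge0// Lnorm_ge0.
have a0 k : (0 <= a k)%E.
  by rewrite /a mule_ge0 ?lee_fin ?sqr_ge0// adde_ge0// expe_ge0.
have S0 : (0 <= \esum_(k in [set: int]) a k)%E by apply: esum_ge0.
have Sfin : (\esum_(k in [set: int]) a k)%E \is a fin_num by rewrite ge0_fin_numE.
exists (fine (\esum_(k in [set: int]) a k)%E); first exact: fine_ge0.
move=> Z x; rewrite -lee_fin fineK// -sumEFin.
apply: (@le_trans _ _ (\sum_(k <- Z) a k)%E).
  apply: lee_sum => k _; rewrite /a exprMn EFinM lee_wpmul2l ?lee_fin ?sqr_ge0//.
  apply: (@le_trans _ _ (W1oo_norm (g k) ^+ 2)%E); last by rewrite leeDl.
  have [sg pg] := hg k; have := W1oo_ge x (smooth_continuous sg) pg.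
  rewrite -(real_normK (num_real (g k x))) EFin_expe => h1.
  by rewrite !expe2 lee_pmul// lee_fin.
apply: esum_ge; exists [set` Z]; first by split; [exact: finite_fset|].
by rewrite -fsbig_seq ?fset_uniq.
Qed.

End problem_data.

Section initial_data.
Context {R : realType} {d : nat}.
Variables (h : R) (T : seq (simplex R d)).
Hypothesis hT : torus_partition h T.
Hypothesis d_gt0 : (0 < d)%N.
Implicit Types (u v w phi U W Uo : 'rV[R]_d -> R).

Lemma norm_star_sub U m : Vh T U -> mean U = m ->
  norm_star T (fun x => U x - m) ^+ 2 = grad_ip (invl T U m) (invl T U m).
Proof.
move=> VU mU; have m0 : mean (fun x => U x - m) = 0 by rewrite (mean_sub hT)// mU subrr.
rewrite /norm_star m0 expr0n addr0 sqrtr_sqr real_normK ?num_real// grad_norm_sqr.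
by rewrite (_ : (fun x => U x - m - 0) = fun x => U x - m)//; apply/funext => x; rewrite subr0.
Qed.

Lemma norm_star_diff U Uo m : Vh T U -> Vh T Uo -> mean U = m -> mean Uo = m ->
  norm_star T (fun x => U x - Uo x) ^+ 2 =
  grad_ip (fun x => -1 * invl T Uo m x + invl T U m x) (fun x => -1 * invl T Uo m x + invl T U m x).
Proof.
move=> VU Vo mU mo.
have [Vz mz hz] := invlP hT d_gt0 VU mU; have [Vzo mzo hzo] := invlP hT d_gt0 Vo mo.
have m0 : mean (fun x => U x - Uo x) = 0.
  by rewrite meanB ?mU ?mo ?subrr//; exact: (Vh_bmeas hT).
rewrite /norm_star m0 expr0n addr0 sqrtr_sqr real_normK ?num_real// grad_norm_sqr.
suff -> : inv_lap T (fun x => U x - Uo x - 0) = (fun x => -1 * invl T Uo m x + invl T U m x) by [].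
have [gl gs] := grad_ip_form hT d_gt0.
apply: (inv_lap_unique hT d_gt0).
- by apply: (VhD hT) => //; exact: (VhZ hT).
- by rewrite (meanZD hT)// mz mzo mulr0 addr0.
move=> phi Vp; rewrite (gl (-1) _ _ phi Vzo Vz Vp) hz// hzo//.
rewrite -(iph_linear hT); [|exact: (sub_mean_periodic m Vo)|exact: (sub_mean_periodic m VU)|exact: (Vh_periodic Vp)].
by congr (iph T _ _); apply/funext => x; ring.
Qed.

Lemma normh_sqr U : Defs.periodic U -> normh T U ^+ 2 = iph T U U.
Proof. by move=> pU; rewrite /normh sqr_sqrtr// (iph_ge0 hT). Qed.

Lemma initial_bounds u0 : in_L2 u0 -> {ae @cube_measure R d, forall x, `|u0 x| <= 1} ->
  let U0 := L2_proj T u0 in let m := mean u0 in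
  [/\ Vh T U0, mean U0 = m,
    iph T (fun x => U0 x - m) (fun x => U0 x - m) <= 4 ^+ d.+1
    & grad_ip (invl T U0 m) (invl T U0 m) <= (4 ^+ d.+1) ^+ 2 * d%:R].
Proof.
move=> [mu0 _] u01 U0 m.
(* The truncation is bounded everywhere and agrees with [u0] almost everywhere, so it has the same
   mean and the same projection. *)
pose u x := Num.max (-1) (Num.min 1 (u0 x)).
have u1 x : `|u x| <= 1.
  by rewrite ler_norml /u le_max lexx/= ge_max ge_min lexx; lra.
have bu : bmeas u.
  apply/bmeasP; split; last by exists 1.
  by apply: measurable_maxr => //; apply: measurable_minr.
have uE : {ae @cube_measure R d, forall x, u0 x = u x}.
  apply: filterS u01 => x; rewrite ler_norml => /andP[h1 h2].
  by rewrite /u min_r// max_r.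
have mE : mean u = m by apply/esym/mean_ae_eq.
have UE : U0 = L2_proj T u by exact: L2_proj_ae.
have [V0 m0 n0] := L2_projP hT bu; rewrite -UE mE in V0 m0 n0.
have VU' := VhBc hT m V0; have mU' : mean (fun x => U0 x - m) = 0.
  by rewrite (mean_sub hT)// m0 subrr.
have k0 : (0 : R) <= 4 ^+ d.+1 by rewrite exprn_ge0.
have a1 : iph T (fun x => U0 x - m) (fun x => U0 x - m) <= 4 ^+ d.+1.
  apply: (@le_trans _ _ (iph T U0 U0)).
    rewrite (iph_sub hT V0 m0 VU') mU' mulr0 subr0 iphC (iph_sub hT V0 m0 V0) m0.
    by rewrite lerBlDr lerDl -expr2 sqr_ge0.
  rewrite (le_trans (lump_le_L2 hT d_gt0 V0))// -[leRHS]mulr1 ler_wpM2l// (le_trans n0)//.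
  rewrite -[leRHS](@mean_cst R d); apply: mean_le; [exact: bmeasX|exact: bmeas_cst|].
  by move=> x; rewrite -(real_normK (num_real (u x))) expr_le1.
split=> //.
have [Vz mz hz] := invlP hT d_gt0 V0 m0; set z := invl T U0 m in Vz mz hz *; clearbody z.
have g0 := grad_ip_ge0 z.
(* Duality: testing [z] with itself, Cauchy-Schwarz and Poincare bound the square of [grad_ip z z]
   by a multiple of [grad_ip z z], which is then divided out. *)
have c1 : grad_ip z z ^+ 2 <= 4 ^+ d.+1 * iph T z z.
  rewrite {1}hz//; apply: le_trans (iph_cauchy hT (Vh_periodic VU') (Vh_periodic Vz)) _.
  by rewrite ler_wpM2r// (iph_ge0 hT)//; exact: (Vh_periodic Vz).
have c2 : iph T z z <= 4 ^+ d.+1 * (d%:R * grad_ip z z).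
  rewrite (le_trans (lump_le_L2 hT d_gt0 Vz))// ler_wpM2l//.
  by have := poincare hT d_gt0 Vz; rewrite mz; under eq_fun do rewrite subr0.
have c3 : grad_ip z z * grad_ip z z <= (4 ^+ d.+1) ^+ 2 * d%:R * grad_ip z z.
  rewrite -expr2 (le_trans c1)// expr2 -!mulrA ler_wpM2l// (le_trans c2)//.
have [->|gn] := eqVneq (grad_ip z z) 0; first by rewrite mulr_ge0// exprn_ge0.
by rewrite -(ler_pM2r (_ : 0 < grad_ip z z)) // lt_neqAle eq_sym gn.
Qed.

End initial_data.

(** * Independence and normal laws *)

Section independence.
Context {dO : measure_display} {Omega : measurableType dO} {R : realType}.
Variable P : probability Omega R.

(** For fixed [C] both sides are finite measures in [E] that agree on a generator stable under
    intersection. *)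
Lemma independent_g_sigma (G : set (set Omega)) (X : Omega -> R) :
  setI_closed G -> G setT -> G `<=` measurable -> measurable_fun setT X ->
  (forall E C, G E -> measurable C ->
     P (E `&` X @^-1` C) = (P E * P (X @^-1` C))%E) ->
  forall E C, <<s G >> E -> measurable C ->
     P (E `&` X @^-1` C) = (P E * P (X @^-1` C))%E.
Proof.
move=> GI GT Gm mX hG E C GE mC.
have mXC : measurable (X @^-1` C) by rewrite -[X in measurable X]setTI; exact: mX.
have p0 : 0 <= fine (P (X @^-1` C)) by apply: fine_ge0; exact: measure_ge0.
have pE : P (X @^-1` C) = (fine (P (X @^-1` C)))%:E by rewrite fineK// fin_num_measure.
pose m1 : {measure set Omega -> \bar R} := mrestr P mXC.
pose m2 : {measure set Omega -> \bar R} := mscale (NngNum p0) P.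
have -> : P (E `&` X @^-1` C) = m1 E by [].
have -> : (P E * P (X @^-1` C))%E = m2 E by rewrite pE muleC.
apply: (@g_sigma_algebra_measure_unique _ _ _ G Gm (fun=> setT)) => //.
- by rewrite bigcup_const.
- by move=> A GA; apply: (etrans (hG _ _ GA mC)); rewrite pE muleC.
- have : (P (setT `&` X @^-1` C) < +oo)%E.
    by rewrite setTI (le_lt_trans (probability_le1 _ mXC))// ltry.
  by move=> + _; exact.
Qed.

(** Independence makes the joint law of [X] and of the sample point, observed through the
    sigma-algebra of [G], a product measure; Tonelli then factors the integral. *)
Lemma independent_integralM (G : set (set Omega)) (X : Omega -> R)
    (Y : g_sigma_algebraType G -> R) (f : R -> R) :
  setI_closed G -> G setT -> G `<=` measurable -> measurable_fun setT X ->
  (forall E C, G E -> measurable C ->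
     P (E `&` X @^-1` C) = (P E * P (X @^-1` C))%E) ->
  measurable_fun setT Y -> (forall w, 0 <= Y w) ->
  measurable_fun setT f -> (forall x, 0 <= f x) ->
  (\int[P]_w (Y w * f (X w))%:E =
   (\int[P]_w (Y w)%:E) * (\int[P]_w (f (X w))%:E))%E.
Proof.
move=> GI GT Gm mX hG mY Y0 mf f0.
pose T1 := g_sigma_algebraType G.
have mid : measurable_fun setT (id : Omega -> T1).
  move=> _ A mA; rewrite setTI; apply: (smallest_sub _ Gm mA).
  exact: sigma_algebra_measurable.
have mX' : measurable_fun setT (X : Omega -> measurableTypeR R) by [].
have mphi : measurable_fun (setT : set Omega)
    (fun w => (w : T1, X w : measurableTypeR R)).
  exact: measurable_fun_pair.
pose iM : {mfun Omega >-> T1} := HB.pack (id : Omega -> T1)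
  (isMeasurableFun.Build _ _ _ _ _ mid).
pose XM : {mfun Omega >-> measurableTypeR R} := HB.pack (X : Omega -> measurableTypeR R)
  (isMeasurableFun.Build _ _ _ _ _ mX').
pose pM : {mfun Omega >-> (T1 * measurableTypeR R)%type} :=
  HB.pack (fun w => (w : T1, X w : measurableTypeR R))
  (isMeasurableFun.Build _ _ _ _ _ mphi).
pose m1 : probability T1 R := distribution P iM.
pose m2 : probability (measurableTypeR R) R := distribution P XM.
pose m' : {measure set (T1 * measurableTypeR R) -> \bar R} := distribution P pM.
have mYf : measurable_fun setT (fun p : T1 * measurableTypeR R => (Y p.1 * f p.2)%:E).
  apply/measurable_EFinP; apply: measurable_funM.
    by apply: measurableT_comp => //; exact: measurable_fst.
  by apply: measurableT_comp => //; exact: measurable_snd.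
have Yf0 p : (0 <= (Y p.1 * f p.2)%:E)%E by rewrite lee_fin mulr_ge0.
transitivity (\int[m']_p (Y p.1 * f p.2)%:E)%E.
  by rewrite [RHS]ge0_integral_distribution.
transitivity (\int[m1 \x m2]_p (Y p.1 * f p.2)%:E)%E.
  apply: eq_measure_integral => A mA _; apply/esym.
  apply: (@product_measure_unique _ _ _ _ _ m1 m2 m') => // B C mB mC.
  exact: (independent_g_sigma GI GT Gm mX hG mB mC).
rewrite fubini_tonelli1// /fubini_F.
have -> : (\int[P]_w (Y w)%:E = \int[m1]_w (Y w)%:E)%E.
  by rewrite [RHS]ge0_integral_distribution//; exact/measurable_EFinP.
have -> : (\int[P]_w (f (X w))%:E = \int[m2]_x (f x)%:E)%E.
  by rewrite [RHS]ge0_integral_distribution//; exact/measurable_EFinP.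
rewrite -ge0_integralZr//; last 3 first.
- exact/measurable_EFinP.
- by move=> y _; rewrite lee_fin.
- by apply: integral_ge0 => y _; rewrite lee_fin.
apply: eq_integral => y _ /=.
rewrite -ge0_integralZl//=.
- exact/measurable_EFinP.
- by move=> x _; rewrite lee_fin.
- by rewrite lee_fin.
Qed.

End independence.

Lemma ge0_integral_density d (T : measurableType d) (R : realType)
    (mu nu : {measure set T -> \bar R}) (p : T -> R) (f : T -> \bar R) :
  measurable_fun setT p -> (forall x, 0 <= p x) ->
  (forall A, measurable A -> nu A = \int[mu]_(x in A) (p x)%:E)%E ->
  measurable_fun setT f -> (forall x, 0 <= f x)%E ->
  (\int[nu]_x f x = \int[mu]_x (f x * (p x)%:E))%E.
Proof.
move=> mp p0 nuE mf f0.
pose h := nnsfun_approx measurableT mf.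
have hf x : f x = limn (fun n => (h n x)%:E).
  by apply/esym/cvg_lim => //; exact: cvg_nnsfun_approx.
have sf n : (\int[nu]_x (h n x)%:E = \int[mu]_x ((h n x)%:E * (p x)%:E))%E.
  under [LHS]eq_integral do rewrite fimfunE -fsumEFin//.
  rewrite [LHS]ge0_integral_fsum//; last 2 first.
    - by move=> r; exact/measurable_EFinP/measurableT_comp.
    - by move=> r x _; rewrite EFinM nnfun_muleindic_ge0.
  under [RHS]eq_integral.
    move=> x _; rewrite fimfunE -fsumEFin// muleC ge0_mule_fsumr; last first.
      by move=> r; rewrite EFinM nnfun_muleindic_ge0.
    over.
  rewrite [RHS]ge0_integral_fsum//; last 2 first.
    - move=> r; apply/measurable_EFinP; apply: measurable_funM => //.
      exact: measurableT_comp.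
    - by move=> r x _; rewrite EFinM mule_ge0 ?nnfun_muleindic_ge0// lee_fin.
  apply: eq_fsbigr => r; rewrite inE => -[y _ <-].
  rewrite integralZl_indic_nnsfun// integral_indic// setIT nuE//.
  under [RHS]eq_integral do rewrite EFinM muleCA.
  rewrite ge0_integralZl//; last 3 first.
  - apply/measurable_EFinP; apply: measurable_funM => //.
  - by move=> x _; rewrite -EFinM lee_fin mulr_ge0.
  - by rewrite lee_fin.
  congr (_ * _)%E; rewrite integral_mkcond; apply: eq_integral => x _.
  rewrite patchE indicE; case: ifPn => _; first by rewrite mule1.
  by rewrite mule0.
transitivity (limn (fun n => \int[nu]_x (h n x)%:E)%E).
  rewrite -monotone_convergence//=.
  - by apply: eq_integral => x _; exact: hf.
  - by move=> n; exact/measurable_EFinP.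
  - by move=> n x _; rewrite lee_fin.
  - by move=> x _ a b ab; rewrite lee_fin; exact/lefP/nd_nnsfun_approx.
transitivity (limn (fun n => \int[mu]_x ((h n x)%:E * (p x)%:E))%E).
  by congr (limn _); apply/funext => n; exact: sf.
rewrite -monotone_convergence//=.
- apply: eq_integral => x _; apply: cvg_lim => //; apply: cvgeZr => //.
  exact: cvg_nnsfun_approx.
- by move=> n; apply/measurable_EFinP; exact: measurable_funM.
- by move=> n x _; rewrite -EFinM lee_fin mulr_ge0.
- move=> x _ a b ab; rewrite -!EFinM lee_fin; apply: ler_wpM2r => //.
  exact/lefP/nd_nnsfun_approx.
Qed.

Section centered_normal.
Context {R : realType}.
Variable s : R.
Hypothesis s_gt0 : 0 < s.
Let s0 : s != 0 := lt0r_neq0 s_gt0.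
Local Notation lam := (@lebesgue_measure R).

Let integral_normal (f : R -> R) : measurable_fun setT f -> (forall x, 0 <= f x) ->
  (\int[normal_prob 0 s]_x (f x)%:E = \int[lam]_x ((f x)%:E * (normal_pdf 0 s x)%:E))%E.
Proof.
move=> mf f0; apply: (@ge0_integral_density _ _ _ lam (normal_prob 0 s)) => //.
- exact: measurable_normal_pdf.
- by move=> x; exact: normal_pdf_ge0.
- exact/measurable_EFinP.
Qed.

Lemma normal_mgf (c : R) :
  (\int[normal_prob 0 s]_x (expR (c * x))%:E = (expR (c ^+ 2 * s ^+ 2 / 2))%:E)%E.
Proof.
have mexp : measurable_fun setT (fun x : R => expR (c * x)).
  by apply: measurableT_comp => //; exact: measurable_funM.
rewrite integral_normal//.
(* Completing the square turns the tilted density into the normal density with mean [c * s ^+ 2]. *)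
transitivity (\int[lam]_x ((expR (c ^+ 2 * s ^+ 2 / 2))%:E *
                           (normal_pdf (c * s ^+ 2) s x)%:E))%E.
  apply: eq_integral => x _; rewrite -!EFinM; congr EFin.
  rewrite !normal_pdfE// /normal_fun mulrCA [RHS]mulrCA; congr (_ * _).
  rewrite -!expRD; congr expR; field; exact: s0.
rewrite ge0_integralZl//.
- by rewrite integral_normal_pdf mule1.
- by apply/measurable_EFinP; exact: measurable_normal_pdf.
- by move=> x _; rewrite lee_fin normal_pdf_ge0.
Qed.

Lemma normal_symmetric (f : R -> R) : measurable_fun setT f -> (forall x, 0 <= f x) ->
  (\int[normal_prob 0 s]_x (f (- x))%:E = \int[normal_prob 0 s]_x (f x)%:E)%E.
Proof.
move=> mf f0.
pose opp (x : measurableTypeR R) : measurableTypeR R := - x.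
have mN : measurable_fun setT opp by exact: oppr_measurable.
have mfN : measurable_fun setT (fun x : R => f (- x)) by exact: (measurableT_comp mf).
rewrite !integral_normal//.
have mfp : measurable_fun setT (fun x : measurableTypeR R =>
    ((f x)%:E * (normal_pdf 0 s x)%:E)%E).
  by apply/measurable_EFinP; apply: measurable_funM => //; exact: measurable_normal_pdf.
transitivity (\int[pushforward lam opp]_x
    ((f x)%:E * (normal_pdf 0 s x)%:E))%E.
  rewrite (ge0_integral_pushforward mN)//; last first.
    by move=> x _; rewrite -EFinM lee_fin mulr_ge0// normal_pdf_ge0.
  rewrite preimage_setT; apply: eq_integral => x _ /=.
  by rewrite !normal_pdfE// /normal_fun !subr0 sqrrN.
pose NM : {mfun measurableTypeR R >-> measurableTypeR R} :=
  HB.pack opp (isMeasurableFun.Build _ _ _ _ _ mN).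
pose q' : {measure set (measurableTypeR R) -> \bar R} := pushforward lam NM.
pose q := q' mN.
by apply: (@eq_measure_integral _ _ _ _ _ q) => A mA _; exact: lebesgue_measureN.
Qed.

End centered_normal.

Lemma measurable_sum_mem d (T : measurableType d) (R : realType) (I : eqType)
    (s : seq I) (h : I -> T -> R) :
  (forall i, i \in s -> measurable_fun setT (h i)) ->
  measurable_fun setT (fun x => \sum_(i <- s) h i x).
Proof.
elim: s => [|a s IH] hm.
  by rewrite (_ : (fun x => _) = cst 0)//; apply/funext => x; rewrite big_nil.
under eq_fun do rewrite big_cons.
apply: measurable_funD; first by apply: hm; rewrite mem_head.
by apply: IH => i si; apply: hm; rewrite inE si orbT.
Qed.

Section generated_past.
Context {dO : measure_display} {Omega : measurableType dO} {R : realType}.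

Lemma measurable_fun_finer (G H : set (set Omega)) (Y : Omega -> R) :
  G `<=` <<s H >> ->
  measurable_fun (setT : set (g_sigma_algebraType G)) Y ->
  measurable_fun (setT : set (g_sigma_algebraType H)) Y.
Proof.
move=> GH mY _ C mC; rewrite setTI.
have : <<s G >> (Y @^-1` C) by rewrite -[X in <<s _ >> X]setTI; exact: mY.
by apply: smallest_sub => //; exact: smallest_sigma_algebra.
Qed.

Lemma measurable_fun_generated (G : set (set Omega)) (Y : Omega -> R) :
  G `<=` measurable -> measurable_fun (setT : set (g_sigma_algebraType G)) Y ->
  measurable_fun setT Y.
Proof.
move=> GH mY _ C mC; rewrite setTI.
have : <<s G >> (Y @^-1` C) by rewrite -[X in <<s _ >> X]setTI; exact: mY.
by apply: smallest_sub => //; exact: sigma_algebra_measurable.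
Qed.

End generated_past.

Section increments.
Context {dO : measure_display} {Omega : measurableType dO} {R : realType}.
Variable P : probability Omega R.
Variable F : R -> set (set Omega).
Hypothesis usualF : filtration_usual P F.
Context {I : eqType}.
Variable B : I -> R -> Omega -> R.
Hypothesis BM : forall a, brownian_motion P F (B a).
Hypothesis indB : independent_processes P B.
Variable tau : R.
Hypothesis tau_gt0 : 0 < tau.
Variable s : seq I.
Hypothesis us : uniq s.

Definition incr (n : nat) (a : I) (w : Omega) : R :=
  B a (n.+1%:R * tau) w - B a (n%:R * tau) w.

Let grid_ge0 (n : nat) : 0 <= n%:R * tau.
Proof. by rewrite mulr_ge0// ltW. Qed.

Let grid_lt (n : nat) : n%:R * tau < n.+1%:R * tau.
Proof. by rewrite ltr_pM2r// ltr_nat. Qed.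

Let sF n : sigma_algebra setT (F (n%:R * tau)).
Proof. by case: usualF => /(_ _ (grid_ge0 n))[]. Qed.

Let process_meas a : sigma_process (B a) `<=` measurable.
Proof.
apply: smallest_sub; first exact: sigma_algebra_measurable.
move=> _ [t [C [t0 mC ->]]].
have [_ + _ _ _] := BM a => /(_ t t0 C mC).
by case: usualF => /(_ _ t0)[_ + _ _ _] => h /h.
Qed.

Let process_setT a : sigma_process (B a) setT.
Proof.
have [h0 hC _] := @smallest_sigma_algebra _ setT
  [set E | exists t (A : set R), [/\ 0 <= t, measurable A & E = B a t @^-1` A]].
by have := hC _ h0; rewrite setD0.
Qed.

Let F_setT n : F (n%:R * tau) setT.
Proof. by have [h0 hC _] := sF n; have := hC _ h0; rewrite setD0. Qed.

Let process_setI a C D : sigma_process (B a) C -> sigma_process (B a) D ->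
  sigma_process (B a) (C `&` D).
Proof. exact: (@measurableI _ (g_sigma_algebraType _)). Qed.

Let F_setI n C D : F (n%:R * tau) C -> F (n%:R * tau) D -> F (n%:R * tau) (C `&` D).
Proof.
have e : F (n%:R * tau) = <<s F (n%:R * tau) >> by rewrite sigma_algebra_id.
rewrite e; exact: (@measurableI _ (g_sigma_algebraType _)).
Qed.

Let incr_process n a C : measurable C -> sigma_process (B a) (incr n a @^-1` C).
Proof.
move=> mC; rewrite -[X in sigma_process _ X]setTI.
pose G := [set E | exists t (A : set R), [/\ 0 <= t, measurable A & E = B a t @^-1` A]].
have mB (j : nat) :
    measurable_fun (setT : set (g_sigma_algebraType G)) (B a (j%:R * tau)).
  move=> _ D mD; rewrite setTI; apply: sub_sigma_algebra.
  by exists (j%:R * tau), D; split.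
exact: (measurable_funB (mB n.+1) (mB n)).
Qed.

Let incr_F j n a C : (j < n)%N -> measurable C -> F (n%:R * tau) (incr j a @^-1` C).
Proof.
move=> jn mC; rewrite -[X in F _ X]setTI.
have e : F (n%:R * tau) = <<s F (n%:R * tau) >> by rewrite sigma_algebra_id.
have mB (k : nat) : (k <= n)%N -> measurable_fun
    (setT : set (g_sigma_algebraType (F (n%:R * tau)))) (B a (k%:R * tau)).
  move=> kn _ D mD; rewrite setTI; apply: sub_sigma_algebra.
  have [_ hB _ _ _] := BM a; have [_ hm _ _] := usualF.
  apply: (hm (k%:R * tau)) => //; first by rewrite ler_pM2r// ler_nat.
  exact: hB.
rewrite e; exact: (measurable_funB (mB _ jn) (mB _ (ltnW jn))).
Qed.

(* Events generated by the path of the a-th process up to time n * tau and by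
   the complete paths of the other ones; the n-th increment of the a-th process
   is independent of them, although the filtration itself need not be generated
   by the processes. *)
Definition mix_gen (n : nat) (a : I) : set (set Omega) :=
  [set E | exists A : I -> set Omega,
    [/\ forall b, sigma_process (B b) (A b), F (n%:R * tau) (A a)
      & E = \bigcap_(b in [set` s]) A b]].

(** This family is not closed under intersection, so independence is proved on [mix_gen], whose
    generated sigma-algebra contains it. *)
Definition past_gen (n : nat) : set (set Omega) :=
  [set E | exists j b (C : set R),
    [/\ (j < n)%N, b \in s, measurable C & E = incr j b @^-1` C]].

Let mix_setI n a : setI_closed (mix_gen n a).
Proof.
move=> _ _ [A [hA hF ->]] [A' [hA' hF' ->]].
exists (fun b => A b `&` A' b); split; last by rewrite bigcapI.
- by move=> b; exact: process_setI.
- exact: F_setI.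
Qed.

Let mix_setT n a : mix_gen n a setT.
Proof.
exists (fun=> setT); split; first by move=> b; exact: process_setT.
  exact: F_setT.
by apply/seteqP; split.
Qed.

Let mix_meas n a : mix_gen n a `<=` measurable.
Proof.
move=> _ [A [hA hF ->]]; apply: fin_bigcap_measurable; first exact: finite_seq.
move=> b _; exact: process_meas (hA b).
Qed.

Lemma measurable_incr n a : measurable_fun setT (incr n a).
Proof. by move=> _ C mC; rewrite setTI; apply: process_meas; exact: incr_process. Qed.

Let incr_mix n a E C : a \in s -> mix_gen n a E -> measurable C ->
  P (E `&` incr n a @^-1` C) = (P E * P (incr n a @^-1` C))%E.
Proof.
move=> as_ [A [hA hF ->]] mC.
pose A' b := if b == a then A a `&` incr n a @^-1` C else A b.
have -> : \bigcap_(b in [set` s]) A b `&` incr n a @^-1` C =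
          \bigcap_(b in [set` s]) A' b.
  apply/seteqP; split=> w.
    move=> [h hw] b bs; rewrite /A'; case: eqP => [e|_]; last exact: h.
    by split=> //; exact: h.
  move=> h; split.
    move=> b bs; have := h b bs; rewrite /A'; case: eqP => [->|_] //.
    by case.
  by have := h a as_; rewrite /A' eqxx => -[].
rewrite !indB//; last first.
  move=> b bs; rewrite /A'; case: eqP => [->|_]; last exact: hA.
  by apply: process_setI; [exact: hA|exact: incr_process].
rewrite (bigD1_seq a)//= [in RHS](bigD1_seq a)//= {1}/A' eqxx.
have [_ _ _ hind _] := BM a.
have -> : P (A a `&` incr n a @^-1` C) = (P (A a) * P (incr n a @^-1` C))%E.
  by apply: (hind _ _ (grid_ge0 n) (grid_lt n)).
rewrite -muleA [RHS]muleAC -muleA; congr (_ * (_ * _))%E.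
by apply: eq_bigr => b ba; rewrite /A' (negbTE ba).
Qed.

Let single_mix n a b D : b \in s -> sigma_process (B b) D ->
  (b = a -> F (n%:R * tau) D) -> mix_gen n a D.
Proof.
move=> bs hD hF; exists (fun c => if c == b then D else setT); split.
- by move=> c; case: eqP => [->|].
- by case: eqP => [e|]; [exact/hF/esym|move=> _; exact: F_setT].
- apply/seteqP; split=> w.
    by move=> Dw c _; case: ifP.
  by move=> /(_ b bs); rewrite eqxx.
Qed.

Local Notation past n := (g_sigma_algebraType (past_gen n)).

Lemma past_mix n a : past_gen n `<=` <<s mix_gen n a >>.
Proof.
move=> _ [j [b [C [jn bs mC ->]]]]; apply: sub_sigma_algebra.
apply: (single_mix bs); first exact: incr_process.
by move=> _; exact: incr_F.
Qed.

Lemma incr_other_mix n a b : b \in s -> b != a ->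
  measurable_fun (setT : set (g_sigma_algebraType (mix_gen n a))) (incr n b).
Proof.
move=> bs ba _ C mC; rewrite setTI; apply: sub_sigma_algebra.
apply: (single_mix bs); first exact: incr_process.
by move=> e; rewrite e eqxx in ba.
Qed.

Lemma past_measurable n (Y : Omega -> R) :
  measurable_fun (setT : set (past n)) Y -> measurable_fun setT Y.
Proof.
apply: measurable_fun_generated => _ [j [b [C [jn bs mC ->]]]].
by apply: process_meas; exact: incr_process.
Qed.

Lemma past_monotone n m (Y : Omega -> R) : (n <= m)%N ->
  measurable_fun (setT : set (past n)) Y -> measurable_fun (setT : set (past m)) Y.
Proof.
move=> nm; apply: measurable_fun_finer => _ [j [b [C [jn bs mC ->]]]].
apply: sub_sigma_algebra; exists j, b, C; split=> //; exact: leq_trans nm.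
Qed.

Lemma incr_past j n b : (j < n)%N -> b \in s ->
  measurable_fun (setT : set (past n)) (incr j b).
Proof.
by move=> jn bs _ C mC; rewrite setTI; apply: sub_sigma_algebra; exists j, b, C.
Qed.

Lemma incr_law n a (f : R -> R) : measurable_fun setT f -> (forall x, 0 <= f x) ->
  (\int[P]_w (f (incr n a w))%:E = \int[normal_prob 0 (Num.sqrt tau)]_x (f x)%:E)%E.
Proof.
move=> mf f0.
have mX : measurable_fun setT (incr n a : Omega -> measurableTypeR R).
  exact: measurable_incr.
pose XM : {mfun Omega >-> measurableTypeR R} :=
  HB.pack (incr n a : Omega -> measurableTypeR R) (isMeasurableFun.Build _ _ _ _ _ mX).
transitivity (\int[distribution P XM]_x (f x)%:E)%E.
  by rewrite ge0_integral_distribution//; exact/measurable_EFinP.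
apply: eq_measure_integral => A mA _.
have [_ _ + _ _] := BM a => /(_ _ _ (grid_ge0 n) (grid_lt n) A mA).
have -> : n.+1%:R * tau - n%:R * tau = tau by rewrite -natr1 mulrDl mul1r addrAC subrr add0r.
exact.
Qed.

Lemma mix_integralM n a (Y : Omega -> R) (f : R -> R) : a \in s ->
  measurable_fun (setT : set (g_sigma_algebraType (mix_gen n a))) Y ->
  (forall w, 0 <= Y w) -> measurable_fun setT f -> (forall x, 0 <= f x) ->
  (\int[P]_w (Y w * f (incr n a w))%:E =
   (\int[P]_w (Y w)%:E) * (\int[normal_prob 0 (Num.sqrt tau)]_x (f x)%:E))%E.
Proof.
move=> as_ mY Y0 mf f0; rewrite -(incr_law n a)//.
apply: (independent_integralM (@mix_setI n a) (mix_setT n a) (@mix_meas n a)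
  (measurable_incr n a)) => //.
by move=> E C hE mC; exact: incr_mix.
Qed.

(** The increments are peeled off one at a time: those of the other processes at the same step are
    measurable for [mix_gen n a], so the [a]-th one alone is integrated against its Gaussian law. *)
Lemma past_integral_exp n (Y : Omega -> R) (c : I -> R) (s' : seq I) : uniq s' ->
  {subset s' <= s} -> measurable_fun (setT : set (past n)) Y -> (forall w, 0 <= Y w) ->
  (\int[P]_w (Y w * expR (\sum_(b <- s') c b * incr n b w))%:E =
   (\int[P]_w (Y w)%:E) * (expR (tau / 2 * \sum_(b <- s') c b ^+ 2))%:E)%E.
Proof.
move=> us' ss' mY Y0; elim: s' us' ss' => [|a s' IH] /=.
  move=> _ _; under eq_integral do rewrite big_nil expR0 mulr1.
  by rewrite big_nil mulr0 expR0 mule1.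
move=> /andP[as' us'] ss'.
have as_ : a \in s by apply: ss'; rewrite mem_head.
have ss'' : {subset s' <= s} by move=> b bs; apply: ss'; rewrite inE bs orbT.
under eq_integral => w _.
  rewrite big_cons (addrC (_ * _)) expRD mulrA; over.
rewrite /= (@mix_integralM n a (fun w => Y w * expR (\sum_(b <- s') c b * incr n b w))
  (fun x => expR (c a * x)))//.
- rewrite IH// normal_mgf ?sqrtr_gt0// sqr_sqrtr ?ltW// -muleA -EFinM -expRD.
  by rewrite big_cons; congr (_ * (expR _)%:E)%E; field.
- apply: measurable_funM.
    exact: (measurable_fun_finer (@past_mix n a)).
  apply: measurableT_comp => //.
  apply: measurable_sum_mem => b bs'.
  apply: measurable_funM => //; apply: incr_other_mix; first exact: ss''.
  by apply: contraNneq as' => <-.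
- by move=> w; rewrite mulr_ge0// expR_ge0.
- by apply: measurableT_comp => //; exact: measurable_funM.
Qed.

End increments.

(** * Moments of martingale transforms *)

Section power_inequalities.
Context {R : realType}.

Lemma pow_tangent (x m : R) L : 0 <= x -> 0 <= m ->
  m ^+ L.+1 + L.+1%:R * m ^+ L * (x - m) <= x ^+ L.+1.
Proof.
move=> x0 m0; elim: L => [|L IH]; first by rewrite !expr1 expr0 mulr1 mul1r addrC subrK.
have h := ler_wpM2l x0 IH.
rewrite [leRHS]exprS; apply: le_trans h.
rewrite -subr_ge0; have -> : x * (m ^+ L.+1 + L.+1%:R * m ^+ L * (x - m)) -
  (m ^+ L.+2 + L.+2%:R * m ^+ L.+1 * (x - m)) = m ^+ L * L.+1%:R * (x - m) ^+ 2.
  rewrite -[L.+2%:R]natr1 !exprS; move: (m ^+ L) (L.+1%:R : R) => a b; ring.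
by rewrite mulr_ge0 ?sqr_ge0// mulr_ge0// exprn_ge0.
Qed.

Lemma jensen_pow (J : Type) (js : seq J) (p y : J -> R) L :
  (forall j, 0 <= p j) -> (forall j, 0 <= y j) -> \sum_(j <- js) p j = 1 ->
  (\sum_(j <- js) p j * y j) ^+ L.+1 <= \sum_(j <- js) p j * y j ^+ L.+1.
Proof.
move=> p0 y0 p1; set m := \sum_(j <- js) p j * y j.
have m0 : 0 <= m by apply: sumr_ge0 => j _; rewrite mulr_ge0.
have <- : \sum_(j <- js) p j * (m ^+ L.+1 + L.+1%:R * m ^+ L * (y j - m)) = m ^+ L.+1.
  have e j : p j * (m ^+ L.+1 + L.+1%:R * m ^+ L * (y j - m)) =
      p j * (m ^+ L.+1 - L.+1%:R * m ^+ L * m) + p j * y j * (L.+1%:R * m ^+ L) by ring.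
  rewrite (eq_bigr _ (fun j _ => e j)) big_split/= -!mulr_suml p1 -/m mul1r.
  by rewrite (mulrC m) subrK.
by apply: ler_sum => j _; apply: ler_wpM2l => //; exact: pow_tangent.
Qed.

Lemma pow_le_exp (u : R) n : 0 <= u -> u ^+ n <= n%:R ^+ n * expR u.
Proof.
case: n => [|n] u0; first by rewrite !expr0 mul1r -expR0 ler_expR.
have n0 : 0 < (n.+1%:R : R) by rewrite ltr0n.
have -> : u ^+ n.+1 = n.+1%:R ^+ n.+1 * (u / n.+1%:R) ^+ n.+1.
  by rewrite -exprMn mulrC divfK// gt_eqF.
apply: ler_wpM2l; first by rewrite exprn_ge0.
have -> : expR u = expR (u / n.+1%:R) ^+ n.+1.
  by rewrite -expRM_natl mulrC divfK// gt_eqF.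
have h : u / n.+1%:R <= expR (u / n.+1%:R).
  by apply: le_trans (expR_ge1Dx _); rewrite lerDr.
by rewrite lerXn2r// nnegrE ?expR_ge0// divr_ge0// ltW.
Qed.

Definition cosh_const (k : R) (L : nat) : R :=
  (1 + k) ^+ L * ((L * 2)%N%:R ^+ (L * 2) * expR 1).

Lemma cosh_const_ge0 k L : 0 <= k -> 0 <= cosh_const k L.
Proof.
by move=> k0; rewrite /cosh_const !mulr_ge0 ?expR_ge0 ?exprn_ge0// addr_ge0.
Qed.

(** Reduces polynomial moments to exponential ones, which are explicit for Gaussians. Two
    exponentials replace that of the absolute value, so that only exponentials of linear functions
    of the increments have to be integrated. *)
Lemma pow_le_cosh (k x : R) L : 0 <= k ->
  (1 + k * x ^+ 2) ^+ L <= cosh_const k L * (expR x + expR (- x)).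
Proof.
move=> k0; have x0 := normr_ge0 x.
have h1 : 1 + k * x ^+ 2 <= (1 + k) * (1 + `|x|) ^+ 2.
  rewrite -[x ^+ 2]real_normK ?num_real//; move: x0; move: `|x| => t t0.
  have h : 0 <= t * (1 + k) by rewrite mulr_ge0// addr_ge0.
  have h' : 0 <= t ^+ 2 by exact: sqr_ge0.
  rewrite -subr_ge0.
  have -> : (1 + k) * (1 + t) ^+ 2 - (1 + k * t ^+ 2) =
    k + t ^+ 2 + (t * (1 + k)) *+ 2 by ring.
  by rewrite !addr_ge0.
have h2 : expR `|x| <= expR x + expR (- x).
  case: (lerP 0 x) => hx; first by rewrite ger0_norm// lerDl expR_ge0.
  by rewrite ltr0_norm// lerDr expR_ge0.
apply: (@le_trans _ _ (((1 + k) * (1 + `|x|) ^+ 2) ^+ L)).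
  rewrite lerXn2r// nnegrE.
    by rewrite addr_ge0// mulr_ge0// sqr_ge0.
  by rewrite mulr_ge0 ?sqr_ge0// addr_ge0.
rewrite exprMn -exprM /cosh_const -!mulrA; apply: ler_wpM2l.
  by rewrite exprn_ge0// addr_ge0.
rewrite mulnC; apply: le_trans (pow_le_exp _ _) _; first by rewrite addr_ge0.
rewrite ler_wpM2l ?exprn_ge0// expRD.
by rewrite ler_wpM2l ?expR_ge0.
Qed.

End power_inequalities.

Section expectation.
Context {dO : measure_display} {Omega : measurableType dO} {R : realType}.
Variable P : probability Omega R.

Definition Ex (f : Omega -> R) : \bar R := (\int[P]_w (f w)%:E)%E.

Lemma Ex_ge0 f : (forall w, 0 <= f w) -> (0 <= Ex f)%E.
Proof. by move=> f0; apply: integral_ge0 => w _; rewrite lee_fin. Qed.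

Lemma Ex_le f g : (forall w, 0 <= f w) -> (forall w, f w <= g w) -> (Ex f <= Ex g)%E.
Proof.
move=> f0 fg; apply: ge0_le_integral_ae.
- by move=> w; rewrite lee_fin.
- by move=> w; rewrite lee_fin (le_trans (f0 w)).
- by apply: aeW => w; rewrite lee_fin.
Qed.

Lemma ExD (f g : Omega -> R) : measurable_fun setT f -> measurable_fun setT g ->
  (forall w, 0 <= f w) -> (forall w, 0 <= g w) ->
  Ex (fun w => f w + g w) = (Ex f + Ex g)%E.
Proof.
move=> mf mg f0 g0; rewrite /Ex -ge0_integralD//.
- by move=> w _; rewrite lee_fin.
- exact/measurable_EFinP.
- by move=> w _; rewrite lee_fin.
- exact/measurable_EFinP.
Qed.

Lemma ExZ (c : R) (f : Omega -> R) : measurable_fun setT f -> 0 <= c -> (forall w, 0 <= f w) ->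
  Ex (fun w => c * f w) = (c%:E * Ex f)%E.
Proof.
move=> mf c0 f0; rewrite /Ex -ge0_integralZl//.
- exact/measurable_EFinP.
- by move=> w _; rewrite lee_fin.
Qed.

Lemma Ex_cst c : Ex (fun=> c) = c%:E.
Proof.
rewrite /Ex integral_cst// -[RHS]mule1; congr (_ * _)%E; exact: probability_setT.
Qed.

Lemma Ex_sum (J : eqType) (js : seq J) (f : J -> Omega -> R) :
  (forall j, measurable_fun setT (f j)) -> (forall j w, 0 <= f j w) ->
  Ex (fun w => \sum_(j <- js) f j w) = (\sum_(j <- js) Ex (f j))%E.
Proof.
move=> mf f0; elim: js => [|a js IH].
  rewrite big_nil (_ : (fun w => _) = fun=> 0) ?Ex_cst//.
  by apply/funext => w; rewrite big_nil.
rewrite big_cons -IH -ExD//; last by move=> w; rewrite sumr_ge0.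
- by congr Ex; apply/funext => w; rewrite big_cons.
- by apply: measurable_sum_mem => j _.
Qed.

End expectation.

Section martingale_increments.
Context {dO : measure_display} {Omega : measurableType dO} {R : realType}.
Variable P : probability Omega R.
Variable F : R -> set (set Omega).
Hypothesis usualF : filtration_usual P F.
Context {I : eqType}.
Variable B : I -> R -> Omega -> R.
Hypothesis BM : forall a, brownian_motion P F (B a).
Hypothesis indB : independent_processes P B.
Variable tau : R.
Hypothesis tau_gt0 : 0 < tau.
Variable s : seq I.
Hypothesis us : uniq s.
Local Notation xi := (incr B tau).
Local Notation past n := (g_sigma_algebraType (past_gen B tau s n)).
Local Notation Ex := (Ex P).

Let pos (x : R) := Num.max 0 x.
Let mpos : measurable_fun setT pos. Proof. exact: measurable_maxr. Qed.
Let mneg : measurable_fun setT (fun x : R => pos (- x)).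
Proof. exact: (measurableT_comp mpos). Qed.
Let mxi n a : measurable_fun setT (xi n a).
Proof. exact: (measurable_incr usualF BM). Qed.
Let pos_ge0 x : 0 <= pos x. Proof. by rewrite /pos le_max lexx. Qed.
Let posB x : x = pos x - pos (- x).
Proof. by rewrite /pos; case: (lerP 0 x) => h; [rewrite max_l; lra|rewrite max_r; lra]. Qed.
Let norm_pos x : `|x| = pos x + pos (- x).
Proof.
rewrite /pos; case: (lerP 0 x) => h; first by rewrite max_l ?ger0_norm; lra.
by rewrite ltr0_norm ?max_r; lra.
Qed.

Let mu_pos := (\int[normal_prob 0 (Num.sqrt tau)]_x (pos x)%:E)%E.

Let mu_pos_fin : mu_pos \is a fin_num.
Proof.
rewrite ge0_fin_numE; last by apply: integral_ge0 => x _; rewrite lee_fin.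
apply: (@le_lt_trans _ _ (\int[normal_prob 0 (Num.sqrt tau)]_x (expR (1 * x))%:E)%E).
  apply: ge0_le_integral_ae => [x|x|]; rewrite ?lee_fin ?expR_ge0//.
  apply: aeW => x; rewrite lee_fin mul1r /pos; case: (lerP 0 x) => h.
    by apply: le_trans (expR_ge1Dx _); rewrite lerDr.
  exact: expR_ge0.
by rewrite normal_mgf ?sqrtr_gt0// ltry.
Qed.

Let mix_pos n a (Y : Omega -> R) (f : R -> R) : a \in s ->
  measurable_fun (setT : set (past n)) Y -> (forall w, 0 <= Y w) ->
  f = pos \/ f = (fun x => pos (- x)) ->
  Ex (fun w => Y w * f (xi n a w)) = (Ex Y * mu_pos)%E.
Proof.
move=> as_ mY Y0 hf.
have mf : measurable_fun setT f by case: hf => ->; [exact: mpos|exact: mneg].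
have f0 x : 0 <= f x by case: hf => ->; exact: pos_ge0.
rewrite /Ex (mix_integralM usualF BM indB tau_gt0 us as_)//; last first.
  exact: (measurable_fun_finer (@past_mix _ _ _ _ _ usualF _ _ BM _ tau_gt0 s n a)).
congr (_ * _)%E; case: hf => -> //; apply: normal_symmetric => //.
by rewrite sqrtr_gt0.
Qed.

(** The sum has no sign, and [X] and [Y] need not be integrable. Each product of a coefficient and
    an increment is written as [A - A'] with non-negative parts of equal finite expectation, by
    independence and the symmetry of the Gaussian law; [A'] is moved to the right and the two
    expectations cancel. *)
Lemma martingale_increments_le (C : nat -> I -> Omega -> R) (l : seq (nat * I))
    (X Y : Omega -> R) :
  (forall p : nat * I, p \in l -> [/\ p.2 \in s,
      measurable_fun (setT : set (past p.1)) (C p.1 p.2)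
    & (Ex (fun w => `|C p.1 p.2 w|%R) < +oo)%E]) ->
  measurable_fun setT X -> measurable_fun setT Y ->
  (forall w, 0 <= X w) -> (forall w, 0 <= Y w) ->
  (forall w, X w + \sum_(p <- l) C p.1 p.2 w * xi p.1 p.2 w <= Y w) ->
  (Ex X <= Ex Y)%E.
Proof.
elim: l X Y => [|[n a] l IH] X Y hC mX mY X0 Y0 XY.
  by apply: Ex_le => // w; have := XY w; rewrite big_nil addr0.
have /= [as_ mC fC] := hC _ (mem_head _ _).
set c := C n a in mC fC.
have mcp : measurable_fun (setT : set (past n)) (fun w => pos (c w)).
  exact: (measurableT_comp mpos).
have mcn : measurable_fun (setT : set (past n)) (fun w => pos (- c w)).
  exact: (measurableT_comp mneg).
have pm := past_measurable usualF BM tau_gt0.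
have mx := mxi n a.
have fin (f : Omega -> R) : (forall w, 0 <= f w) -> (forall w, f w <= `|c w|) ->
    Ex f \is a fin_num.
  move=> f0 fc; rewrite ge0_fin_numE; last exact: Ex_ge0.
  by apply: le_lt_trans fC; exact: Ex_le.
have fp : Ex (fun w => pos (c w)) \is a fin_num.
  by apply: fin => w //; rewrite norm_pos lerDl.
have fn : Ex (fun w => pos (- c w)) \is a fin_num.
  by apply: fin => w //; rewrite norm_pos lerDr.
pose A w := pos (c w) * pos (xi n a w) + pos (- c w) * pos (- xi n a w).
pose A' w := pos (c w) * pos (- xi n a w) + pos (- c w) * pos (xi n a w).
have mpp (f g : R -> R) : measurable_fun setT f -> measurable_fun setT g ->
    measurable_fun setT (fun w => f (c w) * g (xi n a w)).
  move=> mf mg; apply: measurable_funM; last exact: (measurableT_comp mg).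
  by apply: (measurableT_comp mf); exact: pm mC.
have mA : measurable_fun setT A.
  by apply: measurable_funD; [exact: mpp mpos mpos|exact: mpp mneg mneg].
have mA' : measurable_fun setT A'.
  by apply: measurable_funD; [exact: mpp mpos mneg|exact: mpp mneg mpos].
have A0 w : 0 <= A w by rewrite addr_ge0 ?mulr_ge0.
have A'0 w : 0 <= A' w by rewrite addr_ge0 ?mulr_ge0.
have AE : Ex A = (Ex (fun w => pos (c w)) * mu_pos + Ex (fun w => pos (- c w)) * mu_pos)%E.
  rewrite /A ExD//; first last.
  - by move=> w; rewrite mulr_ge0.
  - by move=> w; rewrite mulr_ge0.
  - exact: mpp mneg mneg.
  - exact: mpp mpos mpos.
  rewrite (@mix_pos n a _ pos as_ mcp)//; last by left.
  by rewrite (@mix_pos n a _ (fun x => pos (- x)) as_ mcn)//; right.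
have A'E : Ex A' = (Ex (fun w => pos (c w)) * mu_pos + Ex (fun w => pos (- c w)) * mu_pos)%E.
  rewrite /A' ExD//; first last.
  - by move=> w; rewrite mulr_ge0.
  - by move=> w; rewrite mulr_ge0.
  - exact: mpp mneg mpos.
  - exact: mpp mpos mneg.
  rewrite (@mix_pos n a _ (fun x => pos (- x)) as_ mcp)//; last by right.
  by rewrite (@mix_pos n a _ pos as_ mcn)//; left.
have : (Ex (fun w => X w + A w)%R <= Ex (fun w => Y w + A' w)%R)%E.
  apply: IH.
  - by move=> p pl; apply: hC; rewrite inE pl orbT.
  - exact: measurable_funD.
  - exact: measurable_funD.
  - by move=> w; rewrite addr_ge0.
  - by move=> w; rewrite addr_ge0.
  - move=> w; have := XY w; rewrite big_cons /= -/c.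
    have -> : c w * xi n a w = A w - A' w.
      by rewrite {1}(posB (c w)) {1}(posB (xi n a w)) /A /A'; ring.
    move: (\sum_(p <- l) _) (A w) (A' w) => u v v' h; lra.
have AE' : Ex A' = Ex A by rewrite AE A'E.
have fA : Ex A \is a fin_num by rewrite AE fin_numD !fin_numM.
rewrite (ExD P mX mA X0 A0) (ExD P mY mA' Y0 A'0) AE'.
by rewrite leeD2rE.
Qed.

Variables (J : eqType) (js : seq J) (p : J -> R) (al : J -> I -> R) (k Bd : R).
Hypothesis p_ge0 : forall j, 0 <= p j.
Hypothesis p_sum : \sum_(j <- js) p j = 1.
Hypothesis k_ge0 : 0 <= k.
Hypothesis al_le : forall j, \sum_(a <- s) al j a ^+ 2 <= Bd.

(** Division by [tau] leaves a weighted mean of squares of Gaussians whose variance does not depend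
    on the time step, so its moments are uniform in [tau]. *)
Definition noise_intensity (n : nat) (w : Omega) : R :=
  k * \sum_(j <- js) p j * (\sum_(a <- s) al j a * xi n a w) ^+ 2 / tau.

Local Notation rho := noise_intensity.

Lemma rho_ge0 n w : 0 <= rho n w.
Proof.
rewrite mulr_ge0// sumr_ge0// => j _; rewrite divr_ge0 ?(ltW tau_gt0)//.
by rewrite mulr_ge0// sqr_ge0.
Qed.

Definition rho_const (L : nat) : R := cosh_const k L.+1 * (expR (Bd / 2) *+ 2).

Lemma rho_const_ge0 L : 0 <= rho_const L.
Proof. by rewrite mulr_ge0 ?cosh_const_ge0// mulrn_wge0// expR_ge0. Qed.

Lemma measurable_rho n : measurable_fun setT (rho n).
Proof.
apply: measurable_funM => //; apply: measurable_sum_mem => j _.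
apply: measurable_funM => //; apply: measurable_funM => //.
apply: measurable_funX; apply: measurable_sum_mem => a _.
by apply: measurable_funM => //; exact: mxi.
Qed.

(** Jensen over the weights [p] reduces the power to a single Gaussian per index, with variance at
    most [Bd]; [pow_le_cosh] and the Laplace transform finish. The arbitrary past-measurable factor
    [Y] makes this a bound on conditional moments. *)
Lemma Ex_past_rho n L (Y : Omega -> R) :
  measurable_fun (setT : set (past n)) Y -> (forall w, 0 <= Y w) ->
  (Ex (fun w => Y w * (1 + rho n w) ^+ L.+1)%R <= (rho_const L)%:E * Ex Y)%E.
Proof.
move=> mY Y0; have pm := past_measurable usualF BM tau_gt0.
pose x (b : bool) j w := \sum_(a <- s) ((-1) ^+ b * al j a / Num.sqrt tau) * xi n a w.
have mx b j : measurable_fun setT (x b j).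
  apply: measurable_sum_mem => a _.
  by apply: measurable_funM; [exact: measurable_cst|exact: mxi].
pose Z b j w := Y w * expR (x b j w).
have mZ b j : measurable_fun setT (Z b j).
  by apply: measurable_funM; [exact: pm mY|exact: measurableT_comp].
have Z0 b j w : 0 <= Z b j w by rewrite mulr_ge0// expR_ge0.
have stau : 0 < Num.sqrt tau by rewrite sqrtr_gt0.
have ZE b j : (Ex (Z b j) <= Ex Y * (expR (Bd / 2))%:E)%E.
  rewrite /Ex /Z /x (past_integral_exp usualF BM indB tau_gt0 us)//.
  apply: lee_wpmul2l; first exact: Ex_ge0.
  rewrite lee_fin ler_expR.
  have -> : \sum_(a <- s) ((-1) ^+ b * al j a / Num.sqrt tau) ^+ 2 =
            tau^-1 * \sum_(a <- s) al j a ^+ 2.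
    rewrite mulr_sumr; apply: eq_bigr => a _.
    by rewrite !exprMn sqrr_sign mul1r exprVn sqr_sqrtr ?ltW// mulrC.
  rewrite mulrA (_ : tau / 2 * tau^-1 = 2^-1); last first.
    by rewrite mulrAC divff ?gt_eqF// mul1r.
  by rewrite mulrC ler_wpM2r.
have pt w : Y w * (1 + rho n w) ^+ L.+1 <=
    \sum_(j <- js) (p j * cosh_const k L.+1) * (Z false j w + Z true j w).
  have -> : 1 + rho n w = \sum_(j <- js) p j * (1 + k * (x false j w) ^+ 2).
    rewrite /rho mulr_sumr -{1}p_sum -big_split/=; apply: eq_bigr => j _.
    rewrite mulrDr mulr1; congr (_ + _).
    have -> : x false j w = (\sum_(a <- s) al j a * xi n a w) / Num.sqrt tau.
      by rewrite mulr_suml; apply: eq_bigr => a _; rewrite expr0 mul1r mulrAC.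
    rewrite exprMn exprVn sqr_sqrtr ?ltW//.
    by move: (_ ^+ 2) (tau^-1) => u v; ring.
  apply: (@le_trans _ _ (Y w * \sum_(j <- js) p j * (1 + k * x false j w ^+ 2) ^+ L.+1)).
    apply: ler_wpM2l => //; apply: jensen_pow => // j.
    by rewrite addr_ge0// mulr_ge0// sqr_ge0.
  rewrite mulr_sumr; apply: ler_sum => j _.
  rewrite /Z -mulrDr mulrCA -mulrA; apply: ler_wpM2l => //.
  rewrite [leRHS]mulrCA; apply: ler_wpM2l => //.
  have -> : x true j w = - x false j w.
    rewrite /x -sumrN; apply: eq_bigr => a _.
    by rewrite expr1 expr0 mul1r mulN1r !mulNr.
  exact: pow_le_cosh.
have Yr0 w : 0 <= Y w * (1 + rho n w) ^+ L.+1.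
  by rewrite mulr_ge0// exprn_ge0// addr_ge0// rho_ge0.
apply: (le_trans (Ex_le P Yr0 pt)).
have K0 := cosh_const_ge0 L.+1 k_ge0.
rewrite /rho_const; move: (cosh_const k L.+1) K0 => K K0.
rewrite Ex_sum; last 2 first.
- by move=> j; apply: measurable_funM => //; exact: measurable_funD.
- by move=> j w; rewrite mulr_ge0 ?addr_ge0// mulr_ge0.
apply: (@le_trans _ _ (\sum_(j <- js) (p j * (K * (expR (Bd / 2) *+ 2)))%:E * Ex Y)%E).
  apply: lee_sum => j _.
  rewrite ExZ ?mulr_ge0//; last 2 first.
  - exact: measurable_funD.
  - by move=> w; rewrite addr_ge0.
  rewrite ExD// mulrA [in leRHS]EFinM -muleA.
  apply: lee_wpmul2l; first by rewrite lee_fin mulr_ge0.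
  rewrite muleC mulr2n EFinD ge0_muleDr ?lee_fin ?expR_ge0//.
  exact: leeD.
rewrite -ge0_sume_distrl; last first.
  by move=> j _; rewrite lee_fin mulr_ge0// mulr_ge0// mulrn_wge0// expR_ge0.
by rewrite sumEFin -mulr_suml p_sum mul1r.
Qed.

End martingale_increments.

(** * Gronwall and Doob estimates *)

Section one_step.
Context {R : realType}.

(** A second-order Taylor bound that remains valid down to [y = -1], since the relative increment of
    a non-negative process can be that low. *)
Lemma binomial_remainder (y : R) q : -1 <= y ->
  (1 + y) ^+ q <= 1 + q%:R * y + q%:R ^+ 2 * y ^+ 2 * (1 + `|y|) ^+ q.
Proof.
move=> y1; elim: q => [|q IH]; first by rewrite !expr0 expr0n/= !mul0r !addr0.
have y0 : 0 <= 1 + y by rewrite -lerBlDl sub0r.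
rewrite exprS; apply: le_trans (ler_wpM2l y0 IH) _.
have a1 : 1 <= (1 + `|y|) ^+ q by rewrite exprn_ege1// lerDl.
have ny := ler_norm y; have n0 := normr_ge0 y.
have y2 : 0 <= y ^+ 2 by exact: sqr_ge0.
have qn : 0 <= q%:R :> R by [].
rewrite [(1 + `|y|) ^+ q.+1]exprS -natr1; move: ((1 + `|y|) ^+ q) a1 => A A1.
have A0 : 0 <= A by apply: le_trans A1.
have h1 : 0 <= y ^+ 2 * (A * (`|y| - y)) by rewrite mulr_ge0// mulr_ge0// subr_ge0.
move: h1 ny n0; move: (`|y|) => t h1 ny n0.
have h2 : 0 <= y ^+ 2 * (A * (1 + t) - 1).
  rewrite mulr_ge0// subr_ge0 (le_trans A1)// ler_peMr//; lra.
have h3 : 0 <= y ^+ 2 * (A * (1 + t)) by rewrite mulr_ge0// mulr_ge0//; lra.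
have q2 : 0 <= q%:R ^+ 2 :> R by exact: sqr_ge0.
move: qn q2 y2; move: (q%:R : R) => n qn q2 y2.
rewrite -subr_ge0 (_ : _ - _ = n ^+ 2 * (y ^+ 2 * (A * (t - y)))
  + n * (y ^+ 2 * (A * (1 + t) - 1)) + (1 + n) * (y ^+ 2 * (A * (1 + t)))); last by ring.
by rewrite !addr_ge0// mulr_ge0// addr_ge0.
Qed.

Definition step_const (K T : R) (q : nat) : R :=
  q.+1%:R * (K + 1) +
  q.+1%:R ^+ 2 * (3 * (K ^+ 2 * T + T + 2)) * (2 + K * T + 3 * T) ^+ q.+1.

Lemma step_const_ge0 K T q : 0 <= K -> 0 <= T -> 0 <= step_const K T q.
Proof.
move=> K0 T0; rewrite addr_ge0//; first by rewrite mulr_ge0// addr_ge0.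
rewrite mulr_ge0//; last by rewrite exprn_ge0// !addr_ge0 ?mulr_ge0.
by rewrite mulr_ge0 ?sqr_ge0// mulr_ge0// !addr_ge0// mulr_ge0// sqr_ge0.
Qed.

(** Division by [v] isolates the relative increment [u + z]. Since [v >= 1], the drift [u] is of
    order [tau] and [z ^+ 2 <= 2 * tau * rho]; only the first-order term in [b] is larger, and it is
    kept exactly. The exponent [q.+3] collects two powers of [1 + rho] from the square and [q.+1]
    from the remainder factor. *)
Lemma power_step (K T tau rho v v' b : R) q : 0 <= K -> 0 < tau -> tau <= T ->
  0 <= rho -> 1 <= v -> 0 <= v' -> b ^+ 2 <= 2 * tau * rho * v ->
  v' = v + K * tau + tau * rho + b ->
  v' ^+ q.+1 <= v ^+ q.+1 + q.+1%:R * v ^+ q * b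
                + tau * step_const K T q * (v ^+ q.+1 * (1 + rho) ^+ q.+3).
Proof.
move=> K0 tau0 tT r0 v1 v'0 hb v'E.
have v0 : 0 < v by apply: lt_le_trans v1.
pose z := b / v; pose u := (K * tau + tau * rho) / v.
have bE : b = v * z by rewrite /z mulrC divfK// gt_eqF.
have uE : K * tau + tau * rho = v * u by rewrite [v * u]mulrC /u divfK// gt_eqF.
have K2 : 0 <= K * tau by rewrite mulr_ge0// ltW.
have T2 : 0 <= tau * rho by rewrite mulr_ge0// ltW.
have u0 : 0 <= u by rewrite divr_ge0 ?addr_ge0// ltW.
have u1 : u <= K * tau + tau * rho.
  by rewrite uE ler_peMl.
have z2 : z ^+ 2 <= 2 * tau * rho.
  have : v * (v * z ^+ 2) <= v * (2 * tau * rho).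
    by move: hb; rewrite bE exprMn mulrA -expr2 [leRHS]mulrC.
  rewrite ler_pM2l// => h; apply: le_trans h.
  by rewrite ler_peMl// sqr_ge0.
pose y := u + z.
have v'y : v' = v * (1 + y).
  by rewrite v'E -addrA -addrA [K * tau + _]addrA uE bE /y; ring.
have y1 : -1 <= y.
  by rewrite -subr_ge0 opprK addrC -(pmulr_rge0 _ v0) -v'y.
have := binomial_remainder q.+1 y1; rewrite -/(1 + y).
have r1 : 1 <= (1 + rho) ^+ q.+3 by rewrite exprn_ege1// lerDl.
have T0 : 0 <= T by apply: le_trans tT; exact: ltW.
have y2 : y ^+ 2 <= tau * (3 * (K ^+ 2 * T + T + 2)) * (1 + rho) ^+ 2.
  have e1 : y ^+ 2 <= 3 * ((K * tau) ^+ 2 + (tau * rho) ^+ 2 + z ^+ 2).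
    apply: (@le_trans _ _ ((K * tau + tau * rho + `|z|) ^+ 2)).
      rewrite -[y ^+ 2]real_normK ?num_real// lerXn2r ?nnegrE//; first by rewrite !addr_ge0.
      by apply: le_trans (ler_normD _ _) _; rewrite (ger0_norm u0) lerD2r.
    rewrite -[z ^+ 2]real_normK ?num_real//.
    move: (K * tau) (tau * rho) (`|z|) => a c e.
    rewrite -subr_ge0 (_ : _ - _ = (a - c) ^+ 2 + (a - e) ^+ 2 + (c - e) ^+ 2); last by ring.
    by rewrite !addr_ge0// sqr_ge0.
  apply: (le_trans e1).
  have t1 : tau * tau <= T * tau by rewrite ler_pM2r.
  have t2 : tau * tau * (K ^+ 2) <= T * tau * (K ^+ 2) by rewrite ler_wpM2r ?sqr_ge0.
  have t3 : tau * tau * (rho ^+ 2) <= T * tau * (rho ^+ 2) by rewrite ler_wpM2r ?sqr_ge0.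
  have g1 : 0 <= T * tau by rewrite mulr_ge0// ltW.
  have g2 : 0 <= T * tau * K ^+ 2 by rewrite mulr_ge0// sqr_ge0.
  have g3 : 0 <= T * tau * K ^+ 2 * rho by rewrite mulr_ge0.
  have g4 : 0 <= T * tau * K ^+ 2 * rho ^+ 2 by rewrite mulr_ge0// sqr_ge0.
  have g5 : 0 <= T * tau * rho by rewrite mulr_ge0.
  have g6 : 0 <= tau * rho ^+ 2 by rewrite mulr_ge0 ?sqr_ge0// ltW.
  rewrite (_ : (K * tau) ^+ 2 = tau * tau * K ^+ 2); last by ring.
  rewrite (_ : (tau * rho) ^+ 2 = tau * tau * rho ^+ 2); last by ring.
  rewrite (_ : tau * (3 * (K ^+ 2 * T + T + 2)) * (1 + rho) ^+ 2 =
    3 * (T * tau * K ^+ 2 + (T * tau * K ^+ 2 * rho) *+ 2 + T * tau * K ^+ 2 * rho ^+ 2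
     + T * tau + (T * tau * rho) *+ 2 + T * tau * rho ^+ 2
     + 2 * tau + 4 * (tau * rho) + 2 * (tau * rho ^+ 2))); last by ring.
  move: t2 t3 g1 g2 g3 g4 g5 g6 z2 T2.
  rewrite -[2 * tau * rho]mulrA.
  move: (T * tau * K ^+ 2 * rho) (T * tau * K ^+ 2 * rho ^+ 2) (T * tau * K ^+ 2)
    (T * tau * rho ^+ 2) (T * tau * rho) (tau * rho ^+ 2) (tau * rho) (T * tau)
    (tau * tau * K ^+ 2) (tau * tau * rho ^+ 2) (z ^+ 2).
  clear - tau0; move=> *; lra.
have ay : 1 + `|y| <= (2 + K * T + 3 * T) * (1 + rho).
  have e1 : `|y| <= K * tau + tau * rho + `|z|.
    by apply: le_trans (ler_normD _ _) _; rewrite (ger0_norm u0) lerD2r.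
  have e2 : `|z| <= 1 + z ^+ 2.
    rewrite -[z ^+ 2]real_normK ?num_real//; move: (`|z|) => a.
    by have := sqr_ge0 (a - 2^-1); rewrite -subr_ge0 => h; have := sqr_ge0 a; nra.
  have g1 : 0 <= K * T by rewrite mulr_ge0.
  have g2 : 0 <= K * T * rho by rewrite mulr_ge0.
  have g3 : tau * rho <= T * rho by rewrite ler_wpM2r.
  have g4 : K * tau <= K * T by rewrite ler_wpM2l.
  have -> : (2 + K * T + 3 * T) * (1 + rho) =
     2 + 2 * rho + K * T + K * T * rho + 3 * T + 3 * (T * rho) by ring.
  move: z2; rewrite -mulrA => z2.
  move: e1 e2 g1 g2 g3 g4 z2 r0 T0.
  move: (`|y|) (`|z|) (z ^+ 2) (K * T) (K * T * rho) (T * rho) (tau * rho) (K * tau).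
  clear; move=> *; lra.
have pay : (1 + `|y|) ^+ q.+1 <= (2 + K * T + 3 * T) ^+ q.+1 * (1 + rho) ^+ q.+1.
  rewrite -exprMn lerXn2r// nnegrE ?addr_ge0//.
  by apply: le_trans ay; rewrite addr_ge0.
have p12 : y ^+ 2 * (1 + `|y|) ^+ q.+1 <=
    tau * (3 * (K ^+ 2 * T + T + 2)) * (2 + K * T + 3 * T) ^+ q.+1 * (1 + rho) ^+ q.+3.
  have -> : tau * (3 * (K ^+ 2 * T + T + 2)) * (2 + K * T + 3 * T) ^+ q.+1 * (1 + rho) ^+ q.+3
    = (tau * (3 * (K ^+ 2 * T + T + 2)) * (1 + rho) ^+ 2) *
      ((2 + K * T + 3 * T) ^+ q.+1 * (1 + rho) ^+ q.+1).
    rewrite [(1 + rho) ^+ q.+3](_ : _ = (1 + rho) ^+ 2 * (1 + rho) ^+ q.+1); last by rewrite -exprD.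
    move: ((1 + rho) ^+ q.+1) ((1 + rho) ^+ 2) ((2 + K * T + 3 * T) ^+ q.+1) => a c e; ring.
  by apply: ler_pM => //; rewrite ?sqr_ge0 ?exprn_ge0 ?addr_ge0.
have p3 : q.+1%:R * y <= q.+1%:R * z + tau * (q.+1%:R * (K + 1)) * (1 + rho) ^+ q.+3.
  have hK : K + rho <= (K + 1) * (1 + rho) ^+ q.+3.
    apply: (@le_trans _ _ ((K + 1) * (1 + rho))).
      have := mulr_ge0 K0 r0; rewrite mulrDr mulr1 mulrDl mul1r; lra.
    by apply: ler_wpM2l; [exact: addr_ge0|rewrite ler_eXnr// lerDl].
  rewrite /y mulrDr addrC lerD2l (mulrC tau) -!mulrA; apply: ler_wpM2l => //.
  apply: (le_trans u1); rewrite (mulrC K) -mulrDr.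
  rewrite mulrCA; apply: ler_wpM2l => //; exact: ltW.
move=> hy.
have : (1 + y) ^+ q.+1 <= 1 + q.+1%:R * z + tau * step_const K T q * (1 + rho) ^+ q.+3.
  apply: (le_trans hy).
  have p4 := ler_wpM2l (sqr_ge0 (q.+1%:R : R)) p12.
  rewrite /step_const.
  have -> : q.+1%:R ^+ 2 * y ^+ 2 * (1 + `|y|) ^+ q.+1 =
            q.+1%:R ^+ 2 * (y ^+ 2 * (1 + `|y|) ^+ q.+1) by rewrite mulrA.
  move: p3 p4.
  move: (q.+1%:R : R) => m.
  move: (y ^+ 2 * _) ((1 + rho) ^+ q.+3) ((2 + K * T + 3 * T) ^+ q.+1)
    (3 * (K ^+ 2 * T + T + 2)) => a c e f p3 p4.
  have -> : tau * (m * (K + 1) + m ^+ 2 * f * e) * c =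
    tau * (m * (K + 1)) * c + m ^+ 2 * (tau * f * e * c) by ring.
  by rewrite -addrA -addrA lerD2l addrA lerD.
move/(ler_wpM2l (exprn_ge0 q.+1 (ltW v0))); rewrite -exprMn -v'y => h.
apply: (le_trans h); rewrite bE exprS.
move: (v ^+ q) (q.+1%:R : R) ((1 + rho) ^+ q.+3) (step_const _ _ _) => a m c e.
by rewrite le_eqVlt; apply/orP; left; apply/eqP; ring.
Qed.

End one_step.

Section energy_moments.
Context {dO : measure_display} {Omega : measurableType dO} {R : realType}.
Variable P : probability Omega R.
Variable F : R -> set (set Omega).
Hypothesis usualF : filtration_usual P F.
Context {I : eqType}.
Variable B : I -> R -> Omega -> R.
Hypothesis BM : forall a, brownian_motion P F (B a).
Hypothesis indB : independent_processes P B.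
Variable tau : R.
Hypothesis tau_gt0 : 0 < tau.
Variable s : seq I.
Hypothesis us : uniq s.
Variables (J : eqType) (js : seq J) (p : J -> R) (al : J -> I -> R) (k Bd : R).
Hypothesis p_ge0 : forall j, 0 <= p j.
Hypothesis p_sum : \sum_(j <- js) p j = 1.
Hypothesis k_ge0 : 0 <= k.
Hypothesis al_le : forall j, \sum_(a <- s) al j a ^+ 2 <= Bd.
Local Notation xi := (incr B tau).
Local Notation past n := (g_sigma_algebraType (past_gen B tau s n)).
Local Notation Ex f := (Ex P f%R).
Local Notation rho := (noise_intensity B tau s js p al k).

Variables (K T kappa v0 : R) (v : nat -> Omega -> R) (c : nat -> I -> Omega -> R).
Hypothesis K_ge0 : 0 <= K.
Hypothesis tau_le : tau <= T.
Hypothesis kappa_ge0 : 0 <= kappa.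
Hypothesis v_past : forall n, measurable_fun (setT : set (past n)) (v n).
Hypothesis v_ge1 : forall n w, 1 <= v n w.
Hypothesis c_past : forall n a, a \in s ->
  measurable_fun (setT : set (past n)) (c n a).
Hypothesis c_le : forall n a w, a \in s -> c n a w ^+ 2 <= kappa * v n w.
Hypothesis v_start : forall w, v 0 w = v0.
Hypothesis b_sqr : forall n w,
  (\sum_(a <- s) c n a w * xi n a w) ^+ 2 <= 2 * tau * rho n w * v n w.
Hypothesis v_step : forall n w,
  v n.+1 w = v n w + K * tau + tau * rho n w + \sum_(a <- s) c n a w * xi n a w.

Let v_ge0 n w : 0 <= v n w. Proof. exact: le_trans (v_ge1 n w). Qed.
Let pm := past_measurable usualF BM tau_gt0.

Let pow_past n q : measurable_fun (setT : set (past n)) (fun w => v n w ^+ q).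
Proof. by apply: measurable_funX; exact: v_past. Qed.

Definition moment_rate (q : nat) : R := step_const K T q * rho_const k Bd q.+2.

Let rate_ge0 q : 0 <= moment_rate q.
Proof.
rewrite mulr_ge0 ?rho_const_ge0// step_const_ge0//.
by apply: le_trans tau_le; exact: ltW.
Qed.

Let c_norm n a w q : a \in s ->
  `|q.+1%:R * v n w ^+ q * c n a w| <= q.+1%:R * (1 + kappa) * v n w ^+ q.+1.
Proof.
move=> as_; rewrite !normrM ger0_norm// (ger0_norm (exprn_ge0 _ (v_ge0 n w))).
rewrite exprSr -!mulrA ler_wpM2l// [leRHS]mulrCA ler_wpM2l ?exprn_ge0//.
have h := c_le n w as_; have h1 := v_ge1 n w.
have : `|c n a w| <= 1 + c n a w ^+ 2.
  rewrite -[_ ^+ 2]real_normK ?num_real//; move: (`|_|) => t.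
  by have := sqr_ge0 (t - 2^-1); have := sqr_ge0 t; nra.
by move: h h1; move: (`|_|) (_ ^+ 2) (v n w) => t t2 u; rewrite mulrDl mul1r; lra.
Qed.

(** Discrete Gronwall: the term linear in the increments drops out by [martingale_increments_le],
    and the power of [1 + rho] is integrated conditionally on the past, which leaves the factor
    [1 + moment_rate q * tau] per step. *)
Lemma moment_bound q n :
  (Ex (fun w => v n w ^+ q.+1) <=
   (v0 ^+ q.+1 * expR (moment_rate q * (n%:R * tau)))%:E)%E.
Proof.
have v00 : 0 <= v0 by rewrite -(v_start point).
elim: n => [|n IH].
  rewrite mul0r mulr0 expR0 mulr1 -(Ex_cst P); apply: Ex_le => w; rewrite v_start//.
  exact: exprn_ge0.
have mY : measurable_fun setT (fun w => v n w ^+ q.+1).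
  by apply: pm; exact: pow_past.
have mr : measurable_fun setT (fun w => v n w ^+ q.+1 * (1 + rho n w) ^+ q.+3).
  apply: measurable_funM => //; apply: measurable_funX; apply: measurable_funD => //.
  exact: (measurable_rho usualF BM).
have r0 w : 0 <= rho n w by exact: rho_ge0.
have vr0 w : 0 <= v n w ^+ q.+1 * (1 + rho n w) ^+ q.+3.
  by rewrite mulr_ge0 ?exprn_ge0// addr_ge0.
have sc0 : 0 <= step_const K T q.
  by apply: step_const_ge0 => //; apply: le_trans tau_le; exact: ltW.
apply: (@le_trans _ _ (Ex (fun w => v n w ^+ q.+1 +
    tau * step_const K T q * (v n w ^+ q.+1 * (1 + rho n w) ^+ q.+3)))).
  apply: (@martingale_increments_le _ _ _ P F usualF _ B BM indB tau tau_gt0 s us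
    (fun n a w => - (q.+1%:R * v n w ^+ q * c n a w)) [seq (n, a) | a <- s]).
  - move=> _ /mapP[a as_ ->] /=; split => //.
      apply: measurableT_comp => //; apply: measurable_funM; last exact: c_past.
      by apply: measurable_funM => //; exact: pow_past.
    (* The induction hypothesis provides the integrability of the coefficients; [kappa] serves this
       purpose and does not enter the rate. *)
    apply: (@le_lt_trans _ _ (Ex (fun w => q.+1%:R * (1 + kappa) * v n w ^+ q.+1))).
      by apply: Ex_le => w; rewrite normrN ?normr_ge0// c_norm.
    rewrite ExZ ?mulr_ge0 ?addr_ge0//; last by move=> w; exact: exprn_ge0.
    apply: (@le_lt_trans _ _ ((q.+1%:R * (1 + kappa))%:E *
      (v0 ^+ q.+1 * expR (moment_rate q * (n%:R * tau)))%:E)%E).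
      by apply: lee_wpmul2l => //; rewrite lee_fin mulr_ge0// addr_ge0.
    by rewrite -EFinM ltry.
  - by apply: pm; exact: pow_past.
  - by apply: measurable_funD => //; apply: measurable_funM.
  - by move=> w; exact: exprn_ge0.
  - by move=> w; rewrite addr_ge0 ?exprn_ge0// mulr_ge0// mulr_ge0// ltW.
  - move=> w; rewrite big_map/=.
    have -> : \sum_(a <- s) - (q.+1%:R * v n w ^+ q * c n a w) * xi n a w =
        - (q.+1%:R * v n w ^+ q * \sum_(a <- s) c n a w * xi n a w).
      by rewrite mulr_sumr -sumrN; apply: eq_bigr => a _; rewrite mulNr mulrA.
    rewrite lerBlDr addrAC.
    by apply: power_step => //; exact: v_step.
have ts0 : 0 <= tau * step_const K T q by rewrite mulr_ge0// ltW.
rewrite ExD//; last 3 first.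
- by apply: measurable_funM.
- by move=> w; exact: exprn_ge0.
- by move=> w; rewrite mulr_ge0.
rewrite ExZ//.
have h : (Ex (fun w => v n w ^+ q.+1 * (1 + rho n w) ^+ q.+3) <=
    (rho_const k Bd q.+2)%:E * Ex (fun w => v n w ^+ q.+1))%E.
  apply: (@Ex_past_rho _ _ _ P F usualF _ B BM indB tau tau_gt0 s us J js p al k Bd
    p_ge0 p_sum k_ge0 al_le n q.+2 (fun w => v n w ^+ q.+1)) => [|w].
    exact: pow_past.
  exact: exprn_ge0.
apply: (@le_trans _ _ ((1 + moment_rate q * tau)%:E * Ex (fun w => v n w ^+ q.+1))%E).
  have rt0 : (0 <= (moment_rate q * tau)%:E)%E by rewrite lee_fin mulr_ge0// ltW.
  rewrite EFinD ge0_muleDl ?lee01// mul1e leeD2l//.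
  apply: (le_trans (lee_wpmul2l _ h)); first by rewrite lee_fin.
  have -> : moment_rate q * tau = tau * step_const K T q * rho_const k Bd q.+2.
    by rewrite /moment_rate mulrC mulrA.
  by rewrite muleA -EFinM lexx.
apply: (le_trans (lee_wpmul2l _ IH)).
  by rewrite lee_fin addr_ge0// mulr_ge0// ltW.
rewrite -EFinM lee_fin mulrCA; apply: ler_wpM2l; first exact: exprn_ge0.
rewrite -natr1 [(_ + 1) * tau]mulrDl mul1r mulrDr expRD mulrC; apply: ler_wpM2l; first exact: expR_ge0.
exact: expR_ge1Dx.
Qed.

Fixpoint running_max (q n : nat) (w : Omega) : R :=
  if n is n'.+1 then Num.max (running_max q n' w) (v n w ^+ q) else v 0 w ^+ q.

Lemma running_max_ge q n j w : (j <= n)%N -> v j w ^+ q <= running_max q n w.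
Proof.
elim: n => [|n IH]; first by rewrite leqn0 => /eqP ->.
rewrite leq_eqVlt => /orP[/eqP ->|]; first by rewrite /= le_max lexx orbT.
by rewrite ltnS => /IH h; rewrite /= le_max h.
Qed.

Let max_ge0 q n w : 0 <= running_max q n w.
Proof. by apply: le_trans (running_max_ge q w (leqnn n)); exact: exprn_ge0. Qed.

Lemma running_max_past q n : measurable_fun (setT : set (past n)) (running_max q n).
Proof.
elim: n => [|n IH] /=; first exact: pow_past.
by apply: measurable_maxr; [exact: past_monotone IH|exact: pow_past].
Qed.

(** A crude bound, needed only to know that the maximum is square integrable before it may appear in
    the coefficients of a martingale transform. *)
Let max_sqr_le q n w : running_max q n w ^+ 2 <= \sum_(j <- iota 0 n.+1) v j w ^+ (q * 2).
Proof.
elim: n => [|n IH]; first by rewrite big_seq1 exprM.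
rewrite -[n.+2]addn1 iotaD big_cat/= big_seq1 add0n.
have h : 0 <= \sum_(j <- iota 0 n.+1) v j w ^+ (q * 2).
  by apply: sumr_ge0 => j _; exact: exprn_ge0.
case: (leP (running_max q n w) (v n.+1 w ^+ q)) => hm.
  by rewrite -exprM lerDr.
by apply: (le_trans IH); rewrite lerDl exprn_ge0.
Qed.

(* Pathwise form of Doob's L2 inequality: the maximal process integrates the
   increments of the process itself. *)
Let pathwise_doob q n w :
  running_max q n w ^+ 2 / 2 + \sum_(j <- iota 0 n)
    running_max q j w * (v j.+1 w ^+ q - v j w ^+ q) <= running_max q n w * v n w ^+ q.
Proof.
elim: n => [|n IH].
  rewrite big_nil addr0 /=; have := sqr_ge0 (v 0 w ^+ q).
  by rewrite expr2; move: (_ * _) => t; lra.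
have -> : iota 0 n.+1 = iota 0 n ++ [:: n] by rewrite -addn1 iotaD.
rewrite big_cat/= big_seq1.
move: IH; move: (\sum_(_ <- _) _) => S.
have := max_ge0 q n w.
move: (running_max q n w) (v n w ^+ q) (v n.+1 w ^+ q) => M a b M0 IH.
rewrite !mulrBr.
case: (leP M b) => Mb.
  have h := sqr_ge0 (M - b).
  have e : (M - b) ^+ 2 = M ^+ 2 + b ^+ 2 - (M * b) *+ 2 by ring.
  rewrite e in h; rewrite -[b * b]expr2.
  by move: h IH; move: (M ^+ 2) (b ^+ 2) (M * b) (M * a) => t1 t2 t3 t4; lra.
by move: IH; move: (M ^+ 2) (M * b) (M * a) => t1 t2 t3; lra.
Qed.

(** By convexity and the non-negative drift, the increments of the power [q.+1] are bounded below by
    their martingale part. With [M * a <= M ^+ 2 / 4 + a ^+ 2], a quarter of the squared maximum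
    survives in the pathwise inequality, hence the factor 4. *)
Lemma maximal_bound q N : N%:R * tau <= T ->
  (Ex (fun w => running_max q.+1 N w ^+ 2) <=
   (4 * (v0 ^+ (q.+1 * 2) * expR (moment_rate (q * 2).+1 * T)))%:E)%E.
Proof.
move=> NT.
have v00 : 0 <= v0 by rewrite -(v_start point).
have mb n := moment_bound (q * 2).+1 n.
have mmax n : measurable_fun setT (running_max q.+1 n) by apply: pm; exact: running_max_past.
have fin_max n : (Ex (fun w => running_max q.+1 n w ^+ 2) < +oo)%E.
  apply: (@le_lt_trans _ _ (Ex (fun w => \sum_(j <- iota 0 n.+1) v j w ^+ (q.+1 * 2)))).
    by apply: Ex_le => w; [exact: sqr_ge0|exact: max_sqr_le].
  rewrite Ex_sum; last 2 first.
  - by move=> j; apply: pm; exact: pow_past.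
  - by move=> j w; exact: exprn_ge0.
  apply: (@le_lt_trans _ _ (\sum_(j <- iota 0 n.+1)
     (v0 ^+ (q * 2).+2 * expR (moment_rate (q * 2).+1 * (j%:R * tau)))%:E)%E).
    by apply: lee_sum => j _; exact: mb.
  by rewrite sumEFin ltry.
have : (Ex (fun w => 4^-1 * running_max q.+1 N w ^+ 2) <= Ex (fun w => v N w ^+ (q * 2).+2))%E.
  apply: (@martingale_increments_le _ _ _ P F usualF _ B BM indB tau tau_gt0 s us
    (fun n a w => running_max q.+1 n w * (q.+1%:R * v n w ^+ q * c n a w))
    [seq (n, a) | n <- iota 0 N, a <- s]).
  - move=> _ /allpairsP[[n a] /= [_ as_ ->]] /=; split => //.
      apply: measurable_funM; first exact: running_max_past.
      apply: measurable_funM; last exact: c_past.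
      by apply: measurable_funM => //; exact: pow_past.
    apply: (@le_lt_trans _ _ (Ex (fun w => q.+1%:R * (1 + kappa) * running_max q.+1 n w ^+ 2))).
      apply: Ex_le => w; first exact: normr_ge0.
      rewrite normrM (ger0_norm (max_ge0 _ _ _)).
      apply: (le_trans (ler_wpM2l (max_ge0 _ _ _) (c_norm n w q as_))).
      rewrite mulrCA; apply: ler_wpM2l; first by rewrite mulr_ge0// addr_ge0.
      by rewrite expr2; apply: ler_wpM2l => //; exact: running_max_ge.
    rewrite ExZ ?mulr_ge0 ?addr_ge0//; last 2 first.
    - exact: measurable_funX.
    - by move=> w; exact: sqr_ge0.
    have fn : Ex (fun w => running_max q.+1 n w ^+ 2) \is a fin_num.
      by rewrite ge0_fin_numE//; apply: Ex_ge0 => w; exact: sqr_ge0.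
    by rewrite -(fineK fn) -EFinM ltry.
  - by apply: measurable_funM => //; exact: measurable_funX.
  - by apply: pm; exact: pow_past.
  - by move=> w; rewrite mulr_ge0// sqr_ge0.
  - by move=> w; exact: exprn_ge0.
  move=> w; rewrite big_allpairs/=.
  have h := pathwise_doob q.+1 N w.
  have hs : \sum_(n <- iota 0 N) \sum_(a <- s)
      running_max q.+1 n w * (q.+1%:R * v n w ^+ q * c n a w) * xi n a w <=
     \sum_(j <- iota 0 N) running_max q.+1 j w * (v j.+1 w ^+ q.+1 - v j w ^+ q.+1).
    apply: ler_sum => n _.
    have -> : \sum_(a <- s) running_max q.+1 n w * (q.+1%:R * v n w ^+ q * c n a w) * xi n a w
      = running_max q.+1 n w * (q.+1%:R * v n w ^+ q * \sum_(a <- s) c n a w * xi n a w).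
      by rewrite !mulr_sumr; apply: eq_bigr => a _; rewrite !mulrA.
    apply: ler_wpM2l; first exact: max_ge0.
    have := pow_tangent q (v_ge0 n.+1 w) (v_ge0 n w).
    rewrite addrC -lerBrDr; apply: le_trans.
    apply: ler_wpM2l; first by rewrite mulr_ge0// exprn_ge0.
    rewrite v_step; have := mulr_ge0 (ltW tau_gt0) (rho_ge0 B tau_gt0 s js al p_ge0 k_ge0 n w).
    have := mulr_ge0 K_ge0 (ltW tau_gt0).
    by move: (K * tau) (tau * _) (\sum_(_ <- _) _) (v n w) => *; lra.
  have e : v N w ^+ (q * 2).+2 = (v N w ^+ q.+1) ^+ 2 by rewrite -exprM.
  rewrite e; have h2 := sqr_ge0 (running_max q.+1 N w / 2 - v N w ^+ q.+1).
  move: h hs h2; move: (running_max q.+1 N w) (v N w ^+ q.+1) => M a.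
  move: (\sum_(_ <- _) _) (\sum_(_ <- _) _) => S S'.
  have -> : (M / 2 - a) ^+ 2 = M ^+ 2 / 4 - M * a + a ^+ 2 by field.
  by rewrite (mulrC 4^-1); move: (M ^+ 2) (M * a) (a ^+ 2) => x y z; lra.
rewrite ExZ//; last 2 first.
- exact: measurable_funX.
- by move=> w; exact: sqr_ge0.
move=> h; have h4 : (4%:E * ((4^-1)%:E * Ex (fun w => running_max q.+1 N w ^+ 2)%R) <=
    4%:E * Ex (fun w => v N w ^+ (q * 2).+2))%E.
  by apply: lee_wpmul2l h; rewrite lee_fin.
move: h4; rewrite muleA -EFinM divff ?pnatr_eq0// mul1e => h4.
apply: (le_trans h4); rewrite EFinM; apply: lee_wpmul2l; first by rewrite lee_fin.
apply: (le_trans (mb N)); rewrite lee_fin; apply: ler_wpM2l; first exact: exprn_ge0.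
by rewrite ler_expR; apply: ler_wpM2l.
Qed.

End energy_moments.

(** * The energy process *)

Section nodal_potential.
Context {R : realType} {d : nat}.
Variables (h : R) (T : seq (simplex R d)).
Hypothesis hT : torus_partition h T.
Hypothesis d_gt0 : (0 < d)%N.
Implicit Types (u phi : 'rV[R]_d -> R).

(* The discrete inverse Laplacian as an explicit linear function of nodal
   values, which makes it measurable in them. *)
Definition potential u : 'rV[R]_d -> R :=
  fun x => \sum_(r <- nodes T) u r * invl T (hat T r) (wt T r) x.

Let G r := invl T (hat T r) (wt T r).
Let GP r := invlP hT d_gt0 (hat_Vh hT r) (erefl (wt T r)).

Let G_Vh r : Vh T (G r). Proof. by have [] := GP r. Qed.

Lemma potential_Vh u : Vh T (potential u).
Proof. by apply: (Vh_sum hT) => r; apply: (VhZ hT); exact: G_Vh. Qed.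

(** Linearity: the hat functions with their means [wt T r] subtracted, weighted by the nodal values
    of [u], add up to [u - m]. *)
Lemma potential_invl u m : Vh T u -> mean u = m -> potential u = invl T u m.
Proof.
move=> Vu mu; apply/esym; apply: (inv_lap_unique hT d_gt0); first exact: potential_Vh.
  have := form_sum hT (nodes T) (fun r => u r) (L2_form hT) G_Vh (Vh_cst hT 1).
  rewrite !L2ipE; under eq_fun do rewrite mulr1.
  move=> ->; rewrite big1// => r _; rewrite L2ipE.
  under eq_fun do rewrite mulr1.
  by have [_ -> _] := GP r; rewrite mulr0.
move=> phi Vphi.
have pphi := Vh_periodic Vphi.
transitivity (\sum_(r <- nodes T) u r * grad_ip (G r) phi).
  exact: (form_sum hT (nodes T) (fun r => u r) (grad_ip_form hT d_gt0) G_Vh Vphi).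
rewrite (iphE hT (sub_mean_periodic m Vu) pphi).
have e r : u r * grad_ip (G r) phi = \sum_(t <- nodes T)
    u r * (wt T t * ((hat T r t - wt T r) * phi t)).
  have [_ _ ->//] := GP r.
  by rewrite (iphE hT (sub_mean_periodic _ (hat_Vh hT r)) pphi) mulr_sumr.
rewrite (eq_bigr _ (fun r _ => e r)) exchange_big/=; apply: eq_bigr => t _.
have -> : u t - m = \sum_(r <- nodes T) u r * (hat T r t - wt T r).
  under eq_bigr do rewrite mulrBr; rewrite sumrB; congr (_ - _).
    by rewrite {1}(Vh_hat hT Vu).
  by rewrite -mu (mean_Vh hT Vu); apply: eq_bigr => r _; rewrite mulrC.
rewrite mulr_suml mulr_sumr; apply: eq_bigr => r _.
by rewrite mulrCA !mulrA.
Qed.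

Lemma grad_potential u : grad_ip (potential u) (potential u) =
  \sum_(r <- nodes T) \sum_(t <- nodes T) u r * (u t * grad_ip (G r) (G t)).
Proof.
have hf := grad_ip_form hT d_gt0.
rewrite [LHS](form_sum hT (nodes T) (fun r => u r) hf G_Vh (potential_Vh u)).
apply: eq_bigr => r _; rewrite -mulr_sumr; congr (_ * _).
have [_ sym] := hf; rewrite (sym _ _ (G_Vh r) (potential_Vh u)).
rewrite [LHS](form_sum hT (nodes T) (fun r => u r) hf G_Vh (G_Vh r)).
by apply: eq_bigr => t _; exact: (congr1 (fun x => u t * x) (sym _ _ (G_Vh t) (G_Vh r))).
Qed.

Variables (sigma : R -> R) (lam : int -> R) (g : int -> 'rV[R]_d -> R) (Z : {fset int}).
Variable (Ms : R).
Hypothesis sigma_le : forall t, `|sigma t| <= Ms.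
Hypothesis sigma_cont : continuous sigma.
Hypothesis g_periodic : forall k, Defs.periodic (g k).

Context {d0 : measure_display} {S : measurableType d0}.
Variables (V : S -> 'rV[R]_d -> R) (db : S -> int -> 'I_d -> R).
Hypothesis VV : forall w, Vh T (V w).
Hypothesis mV : forall r, measurable_fun setT (fun w => V w r).
Hypothesis mdb : forall k i, k \in Z -> measurable_fun setT (fun w => db w k i).

Let msigma : measurable_fun setT sigma.
Proof. exact: continuous_measurable_fun. Qed.

Lemma measurable_noise_hat t :
  measurable_fun setT (fun w => noise T sigma lam g Z (db w) (V w) (hat T t)).
Proof.
apply: measurable_sum_mem => i _; apply: measurable_sum_mem => k kZ.
apply: measurable_funM; last exact: mdb.
rewrite (_ : (fun w => _) = fun w => - \sum_(r <- nodes T)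
    sigma (V w r) * lam k * g k r * mean (fun x => gr T i (hat T t) x * hat T r x)).
  apply: measurableT_comp => //; apply: measurable_sum_mem => r _.
  do 3 apply: measurable_funM => //.
  exact: (measurableT_comp msigma (mV r)).
apply/funext => w.
exact: (noise_coefE hT d_gt0 sigma lam g_periodic k i (Vh_periodic (VV w)) (hat_Vh hT t)).
Qed.

Lemma measurable_potential t : measurable_fun setT (fun w => potential (V w) t).
Proof.
by apply: measurable_sum_mem => r _; apply: measurable_funM.
Qed.

Lemma measurable_grad_potential :
  measurable_fun setT (fun w => grad_ip (potential (V w)) (potential (V w))).
Proof.
under eq_fun do rewrite grad_potential.
apply: measurable_sum_mem => r _; apply: measurable_sum_mem => t _.
by apply: measurable_funM => //; exact: measurable_funM.
Qed.

Lemma measurable_noise_potential :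
  measurable_fun setT (fun w => noise T sigma lam g Z (db w) (V w) (potential (V w))).
Proof.
under eq_fun => w do rewrite (noise_hat hT d_gt0 lam Z sigma_le g_periodic (db w)
  (Vh_periodic (VV w)) (potential_Vh (V w))).
apply: measurable_sum_mem => r _; apply: measurable_funM; first exact: measurable_potential.
exact: measurable_noise_hat.
Qed.

Lemma measurable_step_data :
  measurable_fun setT (fun w => step_data T sigma lam g Z (db w) (V w)).
Proof.
apply: measurable_rV_fun => i.
have [j ->|j ->] := @split_ordP (size (nodes T)) (size (nodes T)) i.
  by under eq_fun do rewrite step_data_l; exact: mV.
by under eq_fun do rewrite step_data_r; exact: measurable_noise_hat.
Qed.

End nodal_potential.

Lemma le_of_add_ge0 {R : realFieldType} (a b c e : R) : 0 <= b -> 0 <= c ->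
  a + b + c <= e -> a <= e.
Proof. lra. Qed.

Lemma telescoping_arith {R : realFieldType} (G b D e G' b' q e2 e3 e4 k s n : R) :
  G + b + D <= e - 1 -> G' + b' + q + e2 + e3 + e4 <= G + b + k + s + n ->
  G' + b' + (D + (q + e2 + e3 + e4)) <= e + k + s + n - 1.
Proof. lra. Qed.

Lemma dissipation_sum_le {R : realFieldType} (a b D e : R) : 0 <= a -> 0 <= b ->
  a / 2 + b + D <= e - 1 -> 4 * D <= 4 * e.
Proof. lra. Qed.

Lemma star_norm_le {R : realFieldType} (a b D e : R) : 0 <= a -> 0 <= b -> 0 <= D ->
  a / 2 + b + D <= e - 1 -> a <= 4 * e.
Proof. lra. Qed.

Lemma star_part_le {R : realFieldType} (a b c e : R) :
  [/\ 0 <= a, 0 <= b, 0 <= c & 0 <= e] -> a <= 4 * (a / 4 + b + c + e).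
Proof. by case; lra. Qed.

Lemma gradient_part_le {R : realFieldType} (a b c e : R) :
  [/\ 0 <= a, 0 <= b, 0 <= c & 0 <= e] -> b <= 4 * (a / 4 + b + c + e).
Proof. by case; lra. Qed.

Lemma increment_part_le {R : realFieldType} (a b k c e : R) :
  [/\ 0 <= a, 0 <= b, 0 <= k * c & 0 <= e] -> 2 * k * c <= 4 * (a / 4 + b + k * c + e).
Proof. by rewrite -mulrA; move: (k * c) => x []; lra. Qed.

Lemma potential_part_le {R : realFieldType} (a b c k e : R) :
  [/\ 0 <= a, 0 <= b, 0 <= c & 0 <= k * e] -> 2 * k * e <= 4 * (a / 4 + b + c + k * e).
Proof. by rewrite -mulrA; move: (k * e) => x []; lra. Qed.

Section energy_process.
Context {R : realType} {d : nat}.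
Variables (h : R) (T : seq (simplex R d)).
Hypothesis hT : torus_partition h T.
Hypothesis d_gt0 : (0 < d)%N.
Context {dO : measure_display} {Omega : measurableType dO}.
Variable P : probability Omega R.
Variable F : R -> set (set Omega).
Hypothesis usualF : filtration_usual P F.
Variable beta : int -> 'I_d -> R -> Omega -> R.
Hypothesis BM : forall k i, brownian_motion P F (beta k i).
Let Bt (a : int * 'I_d) := beta a.1 a.2.
Hypothesis indB : independent_processes P (fun a : int * 'I_d => beta a.1 a.2).
Variables (eps tau delta tT : R).
Hypotheses (eps0 : 0 < eps) (tau0 : 0 < tau) (delta0 : 0 < delta) (delta8 : delta <= 1 / 8).
Hypothesis tau_le : tau <= tT.
Variables (sigma : R -> R) (lam : int -> R) (g : int -> 'rV[R]_d -> R) (Z : {fset int}).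
Variables (Ms Bd : R).
Hypothesis sigma_le : forall t, `|sigma t| <= Ms.
Hypothesis sigma_cont : continuous sigma.
Hypothesis g_periodic : forall k, Defs.periodic (g k).
Hypothesis g_bound : forall x, \sum_(k <- Z) (lam k * g k x) ^+ 2 <= Bd.
Variables (m : R) (U0 : 'rV[R]_d -> R).
Hypothesis m1 : `|m| <= 1.
Hypotheses (VU0 : Vh T U0) (mU0 : mean U0 = m).
Variable v0 : R.
Hypothesis v0_ge : grad_ip (invl T U0 m) (invl T U0 m) / 2 +
  tau / (2 * eps) * iph T (fun x => U0 x - m) (fun x => U0 x - m) <= v0 - 1.
Variable Phi : 'rV[R]_d -> 'rV[R]_(size (nodes T) + size (nodes T)) -> R.
Hypothesis Phi_cont : forall r, continuous (Phi r).
Hypothesis Phi_step : forall db Uo U W r, r \in nodes T -> Vh T Uo -> Vh T U -> Vh T W ->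
  mean Uo = m -> scheme_step eps tau delta sigma lam g T Z db Uo U W ->
  U r = Phi r (step_data T sigma lam g Z db Uo).

Let A : seq (int * 'I_d) := [seq (k, i) | k <- (Z : seq int), i <- enum 'I_d].
Local Notation xi := (incr Bt tau).
Local Notation past n := (g_sigma_algebraType (past_gen Bt tau A n)).
Local Notation N := (noise T sigma lam g Z).
Local Notation size_ := (noise_size T lam g Z Ms).
Let dB n w (k : int) (i : 'I_d) : R := xi n (k, i) w.

Let uA : uniq A.
Proof.
apply: allpairs_uniq; [exact: fset_uniq|exact: enum_uniq|].
by move=> [a b] [a' b'].
Qed.

Let in_A k i : k \in Z -> (k, i) \in A.
Proof.
by move=> kZ; apply/allpairsP; exists (k, i); rewrite kZ mem_enum.
Qed.

Let sum_A (G : int * 'I_d -> R) : \sum_(a <- A) G a = \sum_i \sum_(k <- Z) G (k, i).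
Proof.
by rewrite big_allpairs exchange_big/= big_enum.
Qed.

Let sum_enum (G : 'I_d -> R) : \sum_(i <- enum 'I_d) G i = \sum_i G i.
Proof. by rewrite big_enum. Qed.

(** The noise is linear in the increments, so evaluating it at this input extracts the coefficient
    of the [a]-th increment. *)
Let unit_db (a : int * 'I_d) (k : int) (i : 'I_d) : R := ((k, i) == a)%:R.

Let pick_A (G : int * 'I_d -> R) a : a \in A ->
  \sum_(b <- A) G b * (b == a)%:R = G a.
Proof.
move=> aA; rewrite (bigD1_seq a aA uA)/= eqxx mulr1 big1 ?addr0// => b /negbTE ->.
by rewrite mulr0.
Qed.

Let noise_sum db U phi : N db U phi = \sum_(a <- A) N (unit_db a) U phi * db a.1 a.2.
Proof.
rewrite sum_A /noise; apply: eq_bigr => i _.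
rewrite big_seq [RHS]big_seq; apply: eq_bigr => k kZ; congr (_ * _).
apply/esym; apply: etrans (pick_A (fun b => noise_coef T sigma lam g U phi b.1 b.2)
  (in_A i kZ)).
by rewrite sum_A.
Qed.

(** Agrees with the solution on almost every path, but is defined on every path and measurable with
    respect to the past increments. *)
Fixpoint sim (n : nat) (w : Omega) : 'rV[R]_d -> R :=
  if n is n'.+1 then fun x => \sum_(r <- nodes T)
    Phi r (step_data T sigma lam g Z (dB n' w) (sim n' w)) * hat T r x
  else U0.

Let zo n w := potential T (sim n w).

(** With [p], [al] and [kq] this brings [noise_size] into the form [tau * rho]. An index is a
    direction together with a node; dividing by [d%:R] makes the weights sum to 1 and is compensated
    in [kq]. *)
Let js : seq ('I_d * 'rV[R]_d) := [seq (i, r) | i <- enum 'I_d, r <- nodes T].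
Let p (j : 'I_d * 'rV[R]_d) : R := wt T j.2 / d%:R.
Let al (j : 'I_d * 'rV[R]_d) (a : int * 'I_d) : R :=
  if a.2 == j.1 then lam a.1 * g a.1 j.2 else 0.
Let kq : R := Ms ^+ 2 * d%:R.
Local Notation rho := (noise_intensity Bt tau A js p al kq).

Let K : R := 5 / 2 / eps.

(* The noise is switched off as soon as it could push the process below 1;
   almost surely this never happens. *)
Fixpoint energy (n : nat) (w : Omega) {struct n} : R :=
  if n is n'.+1 then energy n' w + K * tau + tau * rho n' w +
    (if grad_ip (zo n' w) (zo n' w) / 2 <= energy n' w - 1
     then N (dB n' w) (sim n' w) (zo n' w) else 0)
  else v0.

Let coef n (a : int * 'I_d) w : R :=
  if grad_ip (zo n w) (zo n w) / 2 <= energy n w - 1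
  then N (unit_db a) (sim n w) (zo n w) else 0.

Let dn0 : (d%:R : R) != 0. Proof. by rewrite pnatr_eq0 -lt0n. Qed.

Let p_ge0 j : 0 <= p j.
Proof. by rewrite divr_ge0// (wt_ge0 hT). Qed.

Let p_sum : \sum_(j <- js) p j = 1.
Proof.
rewrite big_allpairs/= sum_enum /p/=.
under eq_bigr do rewrite -mulr_suml (wt_sum hT) mul1r.
by rewrite sumr_const card_ord -[_ *+ _]mulr_natr mulVf.
Qed.

Let kq_ge0 : 0 <= kq. Proof. by rewrite mulr_ge0 ?sqr_ge0. Qed.

Let al_le j : \sum_(a <- A) al j a ^+ 2 <= Bd.
Proof.
rewrite sum_A (bigD1 j.1)//= [X in _ + X]big1 => [|i /negbTE ij]; last first.
  by rewrite big1// => k _; rewrite /al/= ij expr0n.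
rewrite addr0; apply: le_trans (g_bound j.2); rewrite le_eqVlt; apply/orP; left.
by apply/eqP; apply: eq_bigr => k _; rewrite /al/= eqxx.
Qed.

Let rhoE n w : tau * rho n w = size_ (dB n w).
Proof.
rewrite /noise_intensity /noise_size /kq; transitivity (Ms ^+ 2 * \sum_(j <- js)
    d%:R * tau * (p j * (\sum_(a <- A) al j a * xi n a w) ^+ 2 / tau)).
  by rewrite -mulr_sumr; move: (\sum_(_ <- _) _) (Ms ^+ 2) => S b; ring.
congr (_ * _); rewrite big_allpairs sum_enum.
apply: eq_bigr => i _; apply: eq_bigr => r _.
have -> : \sum_(a <- A) al (i, r) a * xi n a w = field lam g Z (dB n w) i r.
  rewrite sum_A (bigD1 i)//= [X in _ + X]big1 => [|i' /negbTE ij]; last first.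
    by rewrite big1// => k _; rewrite /al/= ij mul0r.
  rewrite addr0 /field; apply: eq_bigr => k _.
  by rewrite /al/= eqxx /dB mulrC mulrA.
rewrite /p; move: (wt T r) (field _ _ _ _ _ _) => a b /=; field.
by rewrite dn0 gt_eqF.
Qed.

Let rho_ge0' n w : 0 <= rho n w.
Proof. exact: rho_ge0. Qed.

Let sim_Vh n w : Vh T (sim n w).
Proof.
case: n => [|n] //=.
by apply: (Vh_sum hT) => r; apply: (VhZ hT); exact: (hat_Vh hT).
Qed.

Let zo_Vh n w : Vh T (zo n w). Proof. exact: (potential_Vh hT d_gt0). Qed.

Let mdB n k i : k \in Z ->
  measurable_fun (setT : set (past n.+1)) (fun w : past n.+1 => dB n w k i).
Proof. by move=> kZ; apply: incr_past => //; exact: in_A. Qed.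

Let sim_past n r : measurable_fun (setT : set (past n)) (fun w : past n => sim n w r).
Proof.
elim: n r => [|n IH] r; first exact: measurable_cst.
have ms : measurable_fun (setT : set (past n.+1))
    (fun w : past n.+1 => step_data T sigma lam g Z (dB n w) (sim n w)).
  apply: (measurable_step_data hT d_gt0 lam sigma_cont g_periodic
    (V := fun w : past n.+1 => sim n w) (db := fun w : past n.+1 => dB n w)).
  - by move=> w; exact: sim_Vh.
  - by move=> s; exact: past_monotone (leqnSn n) (IH s).
  - by move=> k i kZ; exact: mdB.
have mP t : measurable_fun (setT : set (past n.+1))
    (fun w : past n.+1 => Phi t (step_data T sigma lam g Z (dB n w) (sim n w))).
  have mt : measurable_fun setT (Phi t) by exact: continuous_measurable_rV.
  exact: (measurableT_comp mt ms).
apply: measurable_sum_mem => t _; apply: measurable_funM => //; exact: mP.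
Qed.

Let grad_past n : measurable_fun (setT : set (past n))
  (fun w : past n => grad_ip (zo n w) (zo n w)).
Proof.
apply: (measurable_grad_potential hT d_gt0 (V := fun w : past n => sim n w)).
by move=> r; exact: sim_past.
Qed.

Let rho_past n : measurable_fun (setT : set (past n.+1)) (rho n).
Proof.
apply: measurable_funM => //; apply: measurable_sum_mem => j _.
apply: measurable_funM => //; apply: measurable_funM => //.
apply: measurable_funX; apply: measurable_sum_mem => a aA.
by apply: measurable_funM => //; exact: incr_past.
Qed.

Let noise_past n (db : past n -> int -> 'I_d -> R) :
  (forall k i, k \in Z -> measurable_fun setT (fun w => db w k i)) ->
  measurable_fun (setT : set (past n)) (fun w : past n => N (db w) (sim n w) (zo n w)).
Proof.
by move=> mdb; apply: (measurable_noise_potential hT d_gt0 lam sigma_le sigma_cont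
  g_periodic (V := fun w : past n => sim n w)).
Qed.

Let energy_past n : measurable_fun (setT : set (past n)) (energy n).
Proof.
elim: n => [|n IH] /=; first exact: measurable_cst.
have IH' : measurable_fun (setT : set (past n.+1)) (energy n) by exact: past_monotone IH.
apply: measurable_funD.
  apply: measurable_funD; first exact: measurable_funD.
  by apply: measurable_funM => //; exact: rho_past.
pose gn (w : Omega) : R := grad_ip (zo n w) (zo n w).
have g1 : measurable_fun (setT : set (past n)) gn by exact: grad_past.
have gp : measurable_fun (setT : set (past n.+1)) gn by exact: past_monotone (leqnSn n) g1.
apply: measurable_fun_ifT => //.
  by apply: measurable_fun_ler; [apply: measurable_funM|apply: measurable_funB].
apply: (measurable_noise_potential hT d_gt0 lam sigma_le sigma_cont g_periodic
  (V := fun w : past n.+1 => sim n w) (db := fun w : past n.+1 => dB n w)).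
- by move=> w; exact: sim_Vh.
- move=> r; pose sn (w : Omega) : R := sim n w r.
  have s1 : measurable_fun (setT : set (past n)) sn by exact: sim_past.
  exact: past_monotone (leqnSn n) s1.
- by move=> k i kZ; exact: mdB.
Qed.

Let coef_past n a : measurable_fun (setT : set (past n)) (coef n a).
Proof.
apply: measurable_fun_ifT => //.
  apply: measurable_fun_ler; first by apply: measurable_funM => //; exact: grad_past.
  by apply: measurable_funB => //; exact: energy_past.
by apply: (@noise_past n (fun=> unit_db a)) => k i kZ; exact: measurable_cst.
Qed.

Let coef_sum n w : \sum_(a <- A) coef n a w * xi n a w =
  if grad_ip (zo n w) (zo n w) / 2 <= energy n w - 1
  then N (dB n w) (sim n w) (zo n w) else 0.
Proof.
rewrite /coef; case: ifP => _; last by rewrite big1// => a _; rewrite mul0r.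
by rewrite [RHS]noise_sum; apply: eq_bigr => -[k i] _.
Qed.

Let K_ge0 : 0 <= K.
Proof. by rewrite !divr_ge0// ltW. Qed.

(** Where the noise is on, the squared gradient is at most twice [energy n w - 1]. The maximum with
    0 covers the other branch and makes the bound usable inside the induction that proves
    [energy >= 1]. *)
Let clipped_sqr db n w :
  (if grad_ip (zo n w) (zo n w) / 2 <= energy n w - 1
   then N db (sim n w) (zo n w) else 0) ^+ 2 <=
  2 * size_ db * Num.max 0 (energy n w - 1).
Proof.
have s0 := noise_size_ge0 hT lam g Z Ms db.
case: ifP => hc; last first.
  by rewrite expr0n/=; apply: mulr_ge0; [exact: mulr_ge0|rewrite le_max lexx].
have hs := noise_sqr_le hT d_gt0 lam Z sigma_le g_periodic db
  (Vh_periodic (sim_Vh n w)) (zo_Vh n w).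
apply: (le_trans hs).
rewrite (mulrC 2) -[leRHS]mulrA; apply: ler_wpM2l => //.
apply: (@le_trans _ _ (2 * (energy n w - 1))).
  by move: hc; move: (grad_ip _ _) (energy n w) => a c; lra.
by apply: ler_wpM2l => //; rewrite le_max lexx orbT.
Qed.

(** With [y = tau * rho] and [e] the current energy, the noise satisfies [b ^+ 2 <= 2 * y * (e - 1)
    <= (y + (e - 1)) ^+ 2], so even the most negative value leaves at least 1. The switch compares
    with [energy - 1] for this reason. *)
Lemma energy_ge1 n w : 1 <= energy n w.
Proof.
elim: n => [|n IH] /=.
  rewrite -subr_ge0; apply: le_trans v0_ge.
  apply: addr_ge0; first by rewrite divr_ge0// grad_ip_ge0.
  apply: mulr_ge0; first by rewrite divr_ge0 ?mulr_ge0// ltW.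
  exact: (iph_ge0 hT (sub_mean_periodic m VU0)).
have := clipped_sqr (dB n w) n w; rewrite -rhoE max_r ?subr_ge0//.
have := rho_ge0' n w; have := mulr_ge0 K_ge0 (ltW tau0).
move: (if _ then _ else _) => b; move: IH; move: (energy n w) (K * tau).
move=> e kt e1 kt0 r0; have := mulr_ge0 (ltW tau0) r0; move: (tau * _) => y y0 hb.
have : b ^+ 2 <= (y + (e - 1)) ^+ 2.
  apply: (le_trans hb); have := sqr_ge0 y; have := sqr_ge0 (e - 1).
  rewrite (_ : (y + (e - 1)) ^+ 2 = y ^+ 2 + 2 * y * (e - 1) + (e - 1) ^+ 2); last by ring.
  by move: (y ^+ 2) ((e - 1) ^+ 2) (2 * y * (e - 1)) => *; lra.
have ye : 0 <= y + (e - 1) by rewrite addr_ge0// subr_ge0.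
rewrite -ler_sqrt ?sqr_ge0// !sqrtr_sqr (ger0_norm ye).
by rewrite ler_norml => /andP[]; lra.
Qed.

Lemma measurable_energy n : measurable_fun setT (energy n).
Proof.
have := @past_measurable _ _ _ P F usualF _ Bt (fun a => BM a.1 a.2) tau tau0 A n
  (energy n) (@energy_past n).
exact.
Qed.

Lemma energy_maximal q n : n%:R * tau <= tT ->
  (Ex P (fun w => running_max energy q.+1 n w ^+ 2)%R <=
   (4 * (v0 ^+ (q.+1 * 2) *
     expR (moment_rate (Ms ^+ 2 * d%:R) Bd (5 / 2 / eps) tT (q * 2).+1 * tT)))%:E)%E.
Proof.
have clip0 e : 0 <= energy e.1 e.2 - 1 by rewrite subr_ge0 energy_ge1.
(* Depends on the mesh and on the truncation, which is harmless since it enters integrability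
   only. *)
pose kappa := \sum_(a <- A) 2 * size_ (unit_db a).
have s0 a : 0 <= 2 * size_ (unit_db a) by rewrite mulr_ge0// (noise_size_ge0 hT).
apply: (@maximal_bound _ _ _ P F usualF _ Bt (fun a => BM a.1 a.2) indB tau tau0 A uA
  _ js p al kq Bd p_ge0 p_sum kq_ge0 al_le K tT kappa v0 energy coef K_ge0 tau_le) => //.
- by apply: sumr_ge0 => a _.
- by move=> n' w; exact: energy_ge1.

- move=> n' a w aA; have := clipped_sqr (unit_db a) n' w.
  rewrite max_r ?(clip0 (n', w))// => hc; apply: (le_trans hc).
  apply: ler_pM => //; first exact: (clip0 (n', w)).
  - rewrite /kappa (bigD1_seq a)//= lerDl; exact: sumr_ge0.
  - by rewrite lerBlDr lerDl.
- move=> n' w; rewrite coef_sum; apply: (le_trans (clipped_sqr _ _ _)).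
  rewrite -rhoE max_r ?(clip0 (n', w))// mulrA.
  have tr0 := mulr_ge0 (ltW tau0) (rho_ge0' n' w).
  apply: ler_wpM2l; first by rewrite -mulrA mulr_ge0.
  by rewrite lerBlDr lerDl.
- by move=> n' w; rewrite coef_sum.
Qed.

Variables (U W : nat -> 'rV[R]_d -> R) (w : Omega) (M : nat).
Hypothesis UV : forall n, (n <= M)%N -> Vh T (U n).
Hypothesis WV : forall n, (n < M)%N -> Vh T (W n.+1).
Hypothesis U_start : U 0 = U0.
Hypothesis U_step : forall n, (n < M)%N ->
  scheme_step eps tau delta sigma lam g T Z (dB n w) (U n) (U n.+1) (W n.+1).

Lemma solution_mean n : (n <= M)%N -> mean (U n) = m.
Proof.
elim: n => [|n IH] nM; first by rewrite U_start.
rewrite (scheme_mean hT d_gt0 sigma_le g_periodic (UV (ltnW nM)) (UV nM) (WV nM)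
  (U_step nM)).
exact: IH (ltnW nM).
Qed.

(** The path [w] is fixed with the scheme holding at every step, so [Phi_step] reproduces the nodal
    values one step after the other. *)
Let solution_sim n : (n <= M)%N -> U n = sim n w.
Proof.
elim: n => [|n IH] nM; first by rewrite U_start.
rewrite [LHS](Vh_hat hT (UV nM)) /=; apply/funext => x.
rewrite big_seq [RHS]big_seq; apply: eq_bigr => r rn; congr (_ * _).
rewrite (Phi_step rn (UV (ltnW nM)) (UV nM) (WV nM) (solution_mean (ltnW nM)) (U_step nM)).
by rewrite (IH (ltnW nM)).
Qed.

Let dissipation n : R :=
  norm_star T (fun x => U n.+1 x - U n x) ^+ 2 / 4
  + tau * eps * grad_norm (U n.+1) ^+ 2
  + tau / (2 * eps) * normh T (fun x => U n.+1 x - U n x) ^+ 2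
  + tau / (2 * eps) * iph T (f_ delta \o U n.+1) (fun x => U n.+1 x - m).

Let dissipation_parts j : (j < M)%N -> [/\
  0 <= norm_star T (fun x => U j.+1 x - U j x) ^+ 2,
  0 <= tau * eps * grad_norm (U j.+1) ^+ 2,
  0 <= tau / (2 * eps) * normh T (fun x => U j.+1 x - U j x) ^+ 2
& 0 <= tau / (2 * eps) * iph T (f_ delta \o U j.+1) (fun x => U j.+1 x - m)].
Proof.
move=> jM; have Vj := UV jM.
have fpos : 0 <= iph T (f_ delta \o U j.+1) (fun x => U j.+1 x - m).
  exact: le_trans (iph_F_ge0 hT delta0 Vj) (iph_F_le_f hT delta0 m1 Vj).
have te : 0 <= tau / (2 * eps) by rewrite divr_ge0 ?mulr_ge0// ltW.
have te' : 0 <= tau * eps by rewrite mulr_ge0 ?ltW.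
by split; rewrite ?sqr_ge0// mulr_ge0// sqr_ge0.
Qed.

(** The claim contains the condition of the switch: dropping the other non-negative terms gives
    [grad_ip (zo n w) (zo n w) / 2 <= energy n w - 1]. The noise is therefore never switched off
    along the solution, and [energy_step] matches the recursion of [energy]. *)
Lemma energy_dominates n : (n <= M)%N ->
  norm_star T (fun x => U n x - m) ^+ 2 / 2 +
  tau / (2 * eps) * normh T (fun x => U n x - m) ^+ 2 +
  \sum_(0 <= j < n) dissipation j <= energy n w - 1.
Proof.
elim: n => [|n IH] nM.
  rewrite big_geq// addr0 U_start (norm_star_sub hT VU0 mU0) (normh_sqr hT) //.
  exact: (sub_mean_periodic m VU0).
have Vn := UV (ltnW nM); have Vn1 := UV nM.
have pn := sub_mean_periodic m Vn; have pn1 := sub_mean_periodic m Vn1.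
have mn := solution_mean (ltnW nM); have mn1 := solution_mean nM.
have := energy_step hT d_gt0 eps0 tau0 delta0 delta8 sigma_le g_periodic m1
  Vn Vn1 (WV nM) mn (U_step nM).
have := IH (ltnW nM).
rewrite big_nat_recr//= [dissipation n]/dissipation.
rewrite (norm_star_sub hT Vn mn) (norm_star_sub hT Vn1 mn1).
rewrite (norm_star_diff hT d_gt0 Vn1 Vn mn1 mn) grad_norm_sqr.
rewrite !(normh_sqr hT)//; last exact: Vh_periodic (VhB hT Vn1 Vn).
have -> : zo n w = invl T (U n) m.
  by rewrite /zo -(solution_sim (ltnW nM)) (potential_invl hT d_gt0 Vn mn).
rewrite rhoE -(solution_sim (ltnW nM)).
have D0 : 0 <= \sum_(0 <= j < n) dissipation j.
  rewrite big_nat; apply: sumr_ge0 => j /andP[_ jn].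
  have [] := dissipation_parts (leq_trans jn (ltnW nM)).
  by rewrite /dissipation => *; rewrite !addr_ge0// divr_ge0.
have te : 0 <= tau / (2 * eps) by rewrite divr_ge0 ?mulr_ge0// ltW.
have i0 : 0 <= tau / (2 * eps) * iph T (fun x => U n x - m) (fun x => U n x - m).
  by rewrite mulr_ge0//; exact: (iph_ge0 hT pn).
move: D0 i0; move: (\sum_(0 <= j < n) dissipation j) => D D0.
have -> : K * tau = 5 / 2 * (tau / eps).
  by rewrite /K -!mulrA; congr (_ * (_ * _)); rewrite mulrC.
move=> i0 IHn st.
rewrite (le_of_add_ge0 i0 D0 IHn).
exact: telescoping_arith IHn st.
Qed.

(** The factor 4 undoes the weight [1 / 4] of the increments in the star norm, the smallest of the
    five weights. *)
Lemma energy_controls n : (n <= M)%N -> [/\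
  norm_star T (fun x => U n x - m) ^+ 2 <= 4 * energy n w,
  \sum_(1 <= j < n.+1) norm_star T (fun x => U j x - U j.-1 x) ^+ 2 <= 4 * energy n w,
  \sum_(1 <= j < n.+1) tau * eps * grad_norm (U j) ^+ 2 <= 4 * energy n w,
  \sum_(1 <= j < n.+1) tau / eps * normh T (fun x => U j x - U j.-1 x) ^+ 2
    <= 4 * energy n w
& \sum_(1 <= j < n.+1) tau / eps * iph T (f_ delta \o U j) (fun x => U j x - m)
    <= 4 * energy n w].
Proof.
move=> nM; have := energy_dominates nM.
have te : 0 <= tau / (2 * eps) by rewrite divr_ge0 ?mulr_ge0// ltW.
have teE : tau / eps = 2 * (tau / (2 * eps)) by field; rewrite gt_eqF.
set a := norm_star T _ ^+ 2; set D := \sum_(0 <= j < n) _.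
have D0 : 0 <= D.
  rewrite /D big_nat; apply: sumr_ge0 => j /andP[_ jn].
  have [] := dissipation_parts (leq_trans jn nM).
  by rewrite /dissipation => *; rewrite !addr_ge0// divr_ge0.
have : 0 <= tau / (2 * eps) * normh T (fun x => U n x - m) ^+ 2 by rewrite mulr_ge0 ?sqr_ge0.
have : 0 <= a by exact: sqr_ge0.
move: (tau / (2 * eps) * normh T (fun x => U n x - m) ^+ 2) => b a0 b0 abD.
have De : 4 * D <= 4 * energy n w.
  exact: dissipation_sum_le a0 b0 abD.
have key (X : nat -> R) : (forall j, (j < n)%N -> X j.+1 <= 4 * dissipation j) ->
    \sum_(1 <= j < n.+1) X j <= 4 * energy n w.
  move=> hX; apply: le_trans De; rewrite big_add1/= mulr_sumr.
  by apply: ler_sum_nat => j /andP[_ jn]; exact: hX.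
have part j : (j < n)%N -> _ := fun jn => dissipation_parts (leq_trans jn nM).
split.
- exact: star_norm_le a0 b0 D0 abD.
- by apply: key => j /part; rewrite /dissipation; exact: star_part_le.
- by apply: key => j /part; rewrite /dissipation; exact: gradient_part_le.
- by apply: key => j /part; rewrite /dissipation teE; exact: increment_part_le.
- by apply: key => j /part; rewrite /dissipation teE; exact: potential_part_le.
Qed.

End energy_process.

(** * From the energy process to the expectations of the theorem *)

Section domination.
Context {dO : measure_display} {Omega : measurableType dO} {R : realType}.
Variable P : probability Omega R.

Lemma expectation_le_Ex (X Y : Omega -> R) : (forall w, 0 <= X w) -> (forall w, 0 <= Y w) ->
  {ae P, forall w, X w <= Y w} -> ('E_P[X] <= Ex P Y)%E.
Proof.
move=> X0 Y0 XY; rewrite unlock; apply: ge0_le_integral_ae.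
- by move=> w; rewrite lee_fin.
- by move=> w; rewrite lee_fin.
- by apply: filterS XY => w; rewrite lee_fin.
Qed.

Lemma measurable_running_max (v : nat -> Omega -> R) q n :
  (forall j, measurable_fun setT (v j)) -> measurable_fun setT (running_max v q n).
Proof.
move=> mv; elim: n => [|n IH] /=; first exact: measurable_funX.
by apply: measurable_maxr => //; exact: measurable_funX.
Qed.

(** The real exponent is raised to an integer, which is allowed because the base [4 * e] is at least
    1. *)
Lemma powR_domination (s e p : R) q : 0 <= s -> s <= 4 * e -> 1 <= e -> 0 <= p ->
  p <= q.+1%:R -> s `^ p <= 4 ^+ q.+1 * e ^+ q.+1.
Proof.
move=> s0 se e1 p0 pq; have e4 : 1 <= 4 * e by lra.
apply: (@le_trans _ _ ((4 * e) `^ p)).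
  by apply: ge0_ler_powR => //; rewrite nnegrE// (le_trans s0).
apply: (le_trans (ler_powR e4 pq)).
by rewrite powR_mulrn ?exprMn// (le_trans ler01).
Qed.

Lemma big_max_le (f : nat -> R) N b : 0 <= b -> (forall n, (n < N)%N -> f n <= b) ->
  \big[Num.max/0]_(0 <= n < N) f n <= b.
Proof.
move=> b0 fb; rewrite big_nat; apply: (big_ind (fun x => x <= b)) => //.
by move=> x y xb yb; rewrite ge_max xb yb.
Qed.

Lemma big_max_ge0 (f : nat -> R) N : (forall n, 0 <= f n) ->
  0 <= \big[Num.max/0]_(0 <= n < N) f n.
Proof.
move=> f0; apply: (big_ind (fun x => 0 <= x)) => //.
by move=> x y x0 y0; rewrite le_max x0.
Qed.

End domination.

Theorem lemma3p1 (R : realType) (d : nat) (hd : (1 <= d <= 3)%N)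
  (dO : measure_display) (Omega : measurableType dO) (P : probability Omega R)
  (F : R -> set (set Omega)) (hF : filtration_usual P F)
  (beta : int -> 'I_d -> R -> Omega -> R)
  (hbeta : forall k i, brownian_motion P F (beta k i))
  (hindep : independent_processes P (fun p : int * 'I_d => beta p.1 p.2))
  (tT eps : R) (hT : 0 < tT) (heps : 0 < eps)
  (lam : int -> R) (hlam : forall k, 0 < lam k)
  (g : int -> 'rV[R]_d -> R) (hg : smooth_orthonormal_basis g)
  (hsum : (\esum_(k in [set: int])
     ((lam k ^+ 2)%:E * (W1oo_norm (g k) ^+ 2 + H2_norm_sq (g k))) < +oo)%E)
  (sigma : R -> R) (hsigma : in_W2oo sigma /\ in_C10 sigma)
  (u0 : 'rV[R]_d -> R) (hu0 : in_H1 u0)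
  (hu0_le1 : {ae @cube_measure R d, forall x, `|u0 x| <= 1})
  (hm : -1 < mean u0 < 1)
  (Th : R -> seq (simplex R d))
  (hTh : forall h, 0 < h -> torus_partition h (Th h))
  (hqu : quasi_uniform Th)
  (Zh : R -> {fset int}) :
  let m := mean u0 in
  let is_solution (h : R) (N : nat) (delta : R)
      (U W : nat -> Omega -> 'rV[R]_d -> R) :=
    [/\ 0 < h, (0 < N)%N, 0 < delta <= 1 / 8
      & scheme_solution P eps (tT / N%:R) delta N sigma lam g beta u0
          (Th h) (Zh h) U W] in
  [/\ forall p : R, 1 <= p -> exists C : R,
        forall h N delta U W, is_solution h N delta U W ->
        let tau := tT / N%:R in
        ('E_P[(fun w => \big[Num.max/0]_(0 <= n < N.+1)
                 (norm_star (Th h) (fun x => U n w x - m) `^ (2 * p)))%R]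
         + 'E_P[(fun w => (\sum_(1 <= n < N.+1)
                 norm_star (Th h) (fun x => U n w x - U n.-1 w x) ^+ 2) `^ p)%R]
         + 'E_P[(fun w => (\sum_(1 <= n < N.+1)
                 tau * eps * grad_norm (U n w) ^+ 2) `^ p)%R]
         + 'E_P[(fun w => (\sum_(1 <= n < N.+1)
                 tau / eps *
                 normh (Th h) (fun x => U n w x - U n.-1 w x) ^+ 2) `^ p)%R]
         + 'E_P[(fun w => (\sum_(1 <= n < N.+1)
                 tau / eps *
                 iph (Th h) (f_ delta \o U n w) (fun x => U n w x - m)) `^ p)%R]
         <= C%:E)%E,
      forall h N delta U W, is_solution h N delta U W ->
        forall n w, (0 < n <= N)%N ->
          0 <= iph (Th h) (F_ delta \o U n w) (cst 1)
            <= iph (Th h) (f_ delta \o U n w) (fun x => U n w x - m)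
    & exists C' : R, forall h N delta U W, is_solution h N delta U W ->
        forall n w, (0 < n <= N)%N ->
          - C' <= iph (Th h) (F_ delta \o U n w) (cst 1)
                  - 2 * normh (Th h) (U n w) ^+ 2].

Proof.
move=> m is_solution.
have d_gt0 : (0 < d)%N by case/andP: hd.
have [gP _ _] := hg.
have g_periodic k : Defs.periodic (g k) by have [] := gP k.
have [Ms Ms0 sigma_le] := C10_bounded hsigma.2.
have sigma_cont := C10_continuous hsigma.2.
have [Bd Bd0 g_bound] := coefficient_bound gP hsum.
have m1 : `|m| <= 1 by rewrite ler_norml; case/andP: hm => /ltW -> /ltW ->.
have U_Vh h N delta U W : is_solution h N delta U W ->
    forall n w, (n <= N)%N -> Vh (Th h) (U n w).
  move=> [h0 N0 _ [U_start sol]] [|n] w nN; last by have [[VU _] _ _] := sol n.+1 nN; exact: VU.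
  by rewrite U_start; have [] := initial_bounds (hTh _ h0) d_gt0 hu0.1 hu0_le1.
split; last 2 first.
- move=> h N delta U W sol n w /andP[_ nN]; have V := U_Vh _ _ _ _ _ sol n w nN.
  have [h0 _ /andP[delta0 _] _] := sol.
  by rewrite (iph_F_ge0 (hTh _ h0) delta0 V) (iph_F_le_f (hTh _ h0) delta0 m1 V).
(* The constant of [F_lower], unchanged because the nodal weights sum to 1. *)
- exists 5 => h N delta U W sol n w /andP[_ nN]; have V := U_Vh _ _ _ _ _ sol n w nN.
  have [h0 _ /andP[delta0 delta8] _] := sol.
  rewrite (normh_sqr (hTh _ h0) (Vh_periodic V)).
  exact: (iph_F_lower (hTh _ h0) delta0 delta8 V).
move=> p p1; have p0 : 0 <= p by apply: le_trans p1.
pose q := Num.bound p.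
have pq : p <= q.+1%:R.
  by apply: le_trans (ltW (archi_boundP p0)) _; rewrite ler_nat.
(* The two bounds of [initial_bounds], with [tau] replaced by [tT], and the 1 that starts the energy
   above its threshold. None of this depends on [h], [tau] or [delta]. *)
pose v0 : R := 1 + ((4 ^+ d.+1) ^+ 2 * d%:R / 2 + tT / (2 * eps) * 4 ^+ d.+1).
pose Cq : R := 4 ^+ q.+1 * (4 * (v0 ^+ (q.+1 * 2) *
  expR (moment_rate (Ms ^+ 2 * d%:R) Bd (5 / 2 / eps) tT (q * 2).+1 * tT))).
(* Each of the five expectations is bounded by the same [Cq]. *)
exists (Cq *+ 5) => h N delta U W sol; cbv zeta; set tau := tT / N%:R.
have Vh_U := U_Vh _ _ _ _ _ sol.
have [h0 N0 /andP[delta0 delta8] [U_start sol_step]] := sol.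
have hT' := hTh _ h0.
have N0' : 0 < (N%:R : R) by rewrite ltr0n.
have tau0 : 0 < tau by rewrite divr_gt0.
have NtT : N%:R * tau <= tT by rewrite mulrC divfK// gt_eqF.
have tau_le : tau <= tT by rewrite ler_pdivrMr// ler_peMr ?ler1n// ltW.
have [VU0 mU0 i0 g0] := initial_bounds hT' d_gt0 hu0.1 hu0_le1.
have v0_ge : grad_ip (invl (Th h) (L2_proj (Th h) u0) m) (invl (Th h) (L2_proj (Th h) u0) m) / 2
    + tau / (2 * eps) * iph (Th h) (fun x => L2_proj (Th h) u0 x - m)
        (fun x => L2_proj (Th h) u0 x - m) <= v0 - 1.
  rewrite /v0 addrAC subrr add0r; apply: lerD; first by rewrite ler_pM2r.
  apply: ler_pM => //.
  - by rewrite divr_ge0 ?mulr_ge0// ltW.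
  - exact: (iph_ge0 hT' (sub_mean_periodic m VU0)).
  - by rewrite ler_pM2r// invr_gt0 mulr_gt0.
have [Phi Phi_cont Phi_step] := step_function hT' d_gt0 lam (Zh h) heps tau0 delta0
  sigma_le g_periodic m.
pose E := energy beta eps tau sigma lam g (Zh h) Ms (L2_proj (Th h) u0) v0 Phi.
have E1 n w : 1 <= E n w.
  exact: (energy_ge1 hT' d_gt0 beta heps tau0 lam (Zh h) sigma_le g_periodic VU0 v0_ge).
have ctl : {ae P, forall w, forall n, (n <= N)%N -> [/\
  norm_star (Th h) (fun x => U n w x - m) ^+ 2 <= 4 * E n w,
  \sum_(1 <= j < n.+1) norm_star (Th h) (fun x => U j w x - U j.-1 w x) ^+ 2 <= 4 * E n w,
  \sum_(1 <= j < n.+1) tau * eps * grad_norm (U j w) ^+ 2 <= 4 * E n w,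
  \sum_(1 <= j < n.+1) tau / eps * normh (Th h) (fun x => U j w x - U j.-1 w x) ^+ 2
    <= 4 * E n w
& \sum_(1 <= j < n.+1) tau / eps * iph (Th h) (f_ delta \o U j w) (fun x => U j w x - m)
    <= 4 * E n w]}.
  have steps : {ae P, forall w, forall n, (n < N)%N ->
      scheme_step eps tau delta sigma lam g (Th h) (Zh h)
        (fun k i => beta k i (n.+1%:R * tau) w - beta k i (n%:R * tau) w)
        (U n w) (U n.+1 w) (W n.+1 w)}.
    (* A single exceptional null set serves all time steps. *)
    apply: ae_foralln => n; case: (ltnP n N) => nN; last first.
      by apply: aeW.
    by have [_ _ st] := sol_step n.+1 nN; apply: filterS st => w st _; exact: st.
  apply: filterS steps => w st n nN.
  apply: (energy_controls hT' d_gt0 heps tau0 delta0 delta8 sigma_le g_periodic m1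
    VU0 mU0 v0_ge Phi_step (U := fun n => U n w) (W := fun n => W n w) (M := N)) => //.
  - by move=> j jN; exact: Vh_U.
  - by move=> j jN; have [_ [WV _] _] := sol_step j.+1 jN; exact: WV.
pose MX w := running_max E q.+1 N w.
have MX1 w : 1 <= MX w.
  by apply: le_trans (running_max_ge E q.+1 w (leq0n N)); rewrite exprn_ege1.
(* Doob's inequality bounds the square of the maximum; since [MX] is at least 1, the square
   dominates its first power. *)
have EM n w : (n <= N)%N -> 4 ^+ q.+1 * E n w ^+ q.+1 <= 4 ^+ q.+1 * MX w ^+ 2.
  move=> nN; apply: ler_wpM2l; first exact: exprn_ge0.
  apply: (le_trans (running_max_ge E q.+1 w nN)).
  by rewrite -/(MX w) expr2 ler_peMr// (le_trans ler01).
have mE n : measurable_fun setT (E n).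
  exact: (measurable_energy hT' d_gt0 hF hbeta eps tau0 lam (Zh h) sigma_le sigma_cont
    g_periodic VU0 v0 Phi_cont).
have bound (X : Omega -> R) : (forall w, 0 <= X w) ->
    {ae P, forall w, X w <= 4 ^+ q.+1 * MX w ^+ 2} -> ('E_P[X] <= Cq%:E)%E.
  move=> X0 XM; apply: (@le_trans _ _ (Ex P (fun w => 4 ^+ q.+1 * MX w ^+ 2))).
    by apply: expectation_le_Ex => // w; rewrite mulr_ge0 ?sqr_ge0// exprn_ge0.
  rewrite ExZ ?exprn_ge0//; last 2 first.
  - by apply: measurable_funX; exact: measurable_running_max.
  - by move=> w; exact: sqr_ge0.
  rewrite /Cq [leRHS]EFinM; apply: lee_wpmul2l; first by rewrite lee_fin exprn_ge0.
  exact: (energy_maximal hT' d_gt0 hF hbeta hindep heps tau0 tau_le sigma_le sigma_cont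
    g_periodic (g_bound (Zh h)) VU0 v0_ge Phi_cont q NtT).
have pow_bound (s : Omega -> R) : (forall w, 0 <= s w) ->
    {ae P, forall w, s w <= 4 * E N w} -> ('E_P[(fun w => s w `^ p)%R] <= Cq%:E)%E.
  move=> s0 sE; apply: bound => [w|]; first exact: powR_ge0.
  apply: filterS sE => w h1; apply: le_trans (EM N w (leqnn N)).
  exact: powR_domination.
have te : 0 <= tau / eps by rewrite divr_ge0// ltW.
have -> : (Cq *+ 5)%:E = (Cq%:E + Cq%:E + Cq%:E + Cq%:E + Cq%:E)%E.
  by rewrite -!EFinD; congr EFin; rewrite !mulrS mulr0n addr0 !addrA.
apply: leeD; [apply: leeD; [apply: leeD; [apply: leeD|]|]|].
- apply: bound => [w|]; first by apply: big_max_ge0 => n; exact: powR_ge0.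
  apply: filterS ctl => w hw; apply: big_max_le.
    by rewrite mulr_ge0 ?sqr_ge0// exprn_ge0.
  move=> n nN; have [h1 _ _ _ _] := hw n nN.
  (* The exponent [2 * p] on the norm acts as [p] on its square, which is the quantity controlled by
     the energy. *)
  apply: le_trans (EM n w nN); rewrite powRrM powR_mulrn ?sqrtr_ge0//.
  by apply: powR_domination => //; exact: sqr_ge0.
- apply: pow_bound => [w|]; first by apply: sumr_ge0 => n _; exact: sqr_ge0.
  by apply: filterS ctl => w /(_ N (leqnn N))[].
- apply: pow_bound => [w|].
    by apply: sumr_ge0 => n _; rewrite mulr_ge0 ?sqr_ge0// mulr_ge0// ltW.
  by apply: filterS ctl => w /(_ N (leqnn N))[].
- apply: pow_bound => [w|].
    by apply: sumr_ge0 => n _; rewrite mulr_ge0 ?sqr_ge0.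
  by apply: filterS ctl => w /(_ N (leqnn N))[].
- apply: pow_bound => [w|]; last by apply: filterS ctl => w /(_ N (leqnn N))[].
  rewrite big_nat; apply: sumr_ge0 => n /andP[_ nN]; apply: mulr_ge0 => //.
  have V := Vh_U n w nN.
  exact: le_trans (iph_F_ge0 hT' delta0 V) (iph_F_le_f hT' delta0 m1 V).
Qed.
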